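(* (Collar Lemma) Let $\mathbb F$ be a real closed field, $V_{\mathbb F}$ a symplectic $\mathbb F$-vector space of dimension $2n$, and $\rho:\Gamma\to\mathrm{Sp}(V_{\mathbb F})$ a representation admitting a maximal framing. If $\gamma\in\Gamma$ is hyperbolic, then $\rho(\gamma)$ has no eigenvalue of absolute value $1$. Let $|\lambda_1(\gamma)|\ge\dots\ge|\lambda_n(\gamma)|>1$ be the eigenvalues of $\rho(\gamma)$ of absolute value larger than $1$. If the hyperbolic elements $\gamma,\eta\in\Gamma$ have positive intersection number, then $$(1)\qquad |\lambda_1(\gamma)|^{2n}\ \ge\ \frac{1}{|\lambda_n(\eta)|^2-1},$$ $$(2)\qquad \Big(\prod_{i=1}^n|\lambda_i(\gamma)|^{2/n}-1\Big)\Big(\prod_{i=1}^n|\lambda_i(\eta)|^{2/n}-1\Big)\ \ge\ 1 .$$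
   Context: Surface: $\Sigma$ is an oriented surface of genus $g$ with $p\ge 0$ punctures, endowed with a complete hyperbolic metric of finite area; $\Gamma=\pi_1(\Sigma)$ is identified with a discrete subgroup of $\mathrm{PSL}(2,\mathbb R)$ with $\Sigma=\Gamma\backslash\mathbb H^2$. Hyperbolic $\gamma,\eta\in\Gamma$ have positive intersection number if the corresponding closed geodesics in $\Sigma$ cross, i.e. for some $\delta\in\Gamma$ the axes in $\mathbb H^2$ of $\gamma$ and $\delta\eta\delta^{-1}$ are distinct and intersect. Eigenvalues lie in $\mathbb F[i]$, are counted with multiplicity as roots of the characteristic polynomial, and $|a+ib|=\sqrt{a^2+b^2}\in\mathbb F$ is the $\mathbb F$-valued absolute value on $\mathbb F[i]$. The set of eigenvalues of a symplectic element is closed under inversion, so an element with no eigenvalue of absolute value $1$ has exactly $n$ eigenvalues of absolute value $>1$. Roots of positive elements are the positive roots in $\mathbb F$. Maximal triples: $\mathcal L(V_{\mathbb F})$ is the set of Lagrangians of $V_{\mathbb F}$. For pairwise transverse $l_1,l_2,l_3$ and $v\in l_1$ let $T(v)\in l_3$ be the unique vector with $v+T(v)\in l_2$; put $Q_{l_1,l_2,l_3}(v)=\langle v,T(v)\rangle$. The triple is maximal if $Q_{l_1,l_2,l_3}$ is positive definite. Maximal framing: $\rho$ admits a maximal framing if there is a $\rho$-equivariant map $\phi:S\to\mathcal L(V_{\mathbb F})$, where $S\subseteq\partial\mathbb H^2$ is a $\Gamma$-invariant subset containing all fixed points of hyperbolic elements of $\Gamma$, such that for every positively oriented triple $(x,y,z)$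 in $S$ the triple $(\phi(x),\phi(y),\phi(z))$ is maximal. *)

(* Defs.v *)
From mathcomp Require Import all_boot all_order all_algebra complex.
From mathcomp Require Import all_classical all_reals all_analysis.

Set Implicit Arguments.
Unset Strict Implicit.
Unset Printing Implicit Defensive.

Import Order.TTheory GRing.Theory Num.Theory.
Import numFieldNormedType.Exports.

Local Open Scope classical_set_scope.
Local Open Scope ring_scope.
Local Open Scope complex_scope.

(* As opposed to the real and imaginary parts of Num, which are F[i]-valued.  *)
Local Notation Re := complex.Re.
Local Notation Im := complex.Im.

Section HyperbolicPlane.
Variable R : realType.
Implicit Types (A B : 'M[R]_2) (G : set 'M[R]_2).

Definition upper_half_plane : set R[i] := [set z | 0 < Im z].

Definition mobius A (z : R[i]) : R[i] :=
  ((A 0 0)%:C * z + (A 0 1)%:C) / ((A 1 0)%:C * z + (A 1 1)%:C).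

(* The boundary R u {oo} of the upper half-plane; None is the point oo. *)
Definition boundary := option R.

Definition mobius_bd A (x : boundary) : boundary :=
  match x with
  | Some t => if A 1 0 * t + A 1 1 == 0 then None
              else Some ((A 0 0 * t + A 0 1) / (A 1 0 * t + A 1 1))
  | None => if A 1 0 == 0 then None else Some (A 0 0 / A 1 0)
  end.

(* Cyclic orientation of R u {oo}: increasing real numbers, with oo on top. *)
Definition bd_lt (x y : boundary) : bool :=
  match x, y with
  | Some s, Some t => s < t
  | Some _, None => true
  | None, _ => false
  end.

Definition positively_oriented (x y z : boundary) : bool :=
  [|| bd_lt x y && bd_lt y z, bd_lt y z && bd_lt z x | bd_lt z x && bd_lt x y].

(* The complete geodesic with endpoints x != y. *)
Definition geodesic (x y : boundary) : set R[i] :=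
  match x, y with
  | Some s, Some t =>
      [set z | 0 < Im z /\
               (Re z - (s + t) / 2) ^+ 2 + Im z ^+ 2 = ((t - s) / 2) ^+ 2]
  | Some s, None | None, Some s => [set z | 0 < Im z /\ Re z = s]
  | None, None => set0
  end.

Definition hyperbolic A : Prop := 2 < `|\tr A|.

Definition axis A : set R[i] :=
  [set z | exists x y, [/\ x != y, mobius_bd A x = x, mobius_bd A y = y
                         & geodesic x y z]].

(* A subgroup of PSL(2, R) is encoded by its preimage in SL(2, R), which is a *)
(* subgroup of SL(2, R) stable under A |-> - A.                               *)
Definition PSL2_subgroup G : Prop :=
  [/\ G 1%:M,
      forall A, G A -> \det A = 1,
      forall A B, G A -> G B -> G (A *m B),
      forall A, G A -> G (invmx A)
    & forall A, G A -> G (- A)].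

Definition discrete_subgroup G : Prop := G `<=` isolated G.

(* Freeness of the action on the upper half-plane: this is what makes the     *)
(* quotient a hyperbolic surface with fundamental group G.                    *)
Definition acts_freely G : Prop :=
  forall A z, G A -> upper_half_plane z -> mobius A z = z ->
    A = 1%:M \/ A = - 1%:M.

Definition fundamental_domain G (D : set R[i]) : Prop :=
  D `<=` upper_half_plane /\
  forall z, upper_half_plane z ->
    exists! w, D w /\ exists2 A, G A & w = mobius A z.

Definition plane_coords (D : set R[i]) :
    set (measurableTypeR R * measurableTypeR R) :=
  [set p | D (p.1 +i* p.2)].

(* Integral of dx dy / y ^ 2. *)
Definition hyperbolic_area (D : set R[i]) : \bar R :=
  (\int[@lebesgue_measure R \x @lebesgue_measure R]_(p in plane_coords D)
     (p.2 ^- 2)%:E)%E.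

Definition finite_coarea G : Prop :=
  exists D, [/\ fundamental_domain G D, measurable (plane_coords D)
              & (hyperbolic_area D < +oo)%E].

Definition surface_group G : Prop :=
  [/\ PSL2_subgroup G, discrete_subgroup G, acts_freely G & finite_coarea G].

Definition positive_intersection G A B : Prop :=
  exists2 C, G C &
    axis A <> axis (C *m B *m invmx C) /\
    (axis A `&` axis (C *m B *m invmx C)) !=set0.

End HyperbolicPlane.

Section Symplectic.
Variables (F : rcfType) (V : vectType F) (om : {skew_symmetric V}).
Implicit Types (L : {vspace V}) (f : 'End(V)).

Definition lagrangian L : Prop :=
  (L <= orthov om L)%VS /\ ((\dim L).*2 = \dim {:V})%N.

Definition transverse L L' : Prop := (L :&: L' = 0)%VS.

(* For transverse l2 and l3, minus the projection onto l3 along l2; this is   *)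
(* characterised by triple_mapP below.                                        *)
Definition triple_map (l2 l3 : {vspace V}) (v : V) : V := - daddv_pi l3 l2 v.

Lemma triple_mapP (l2 l3 : {vspace V}) (v w : V) :
  transverse l2 l3 -> v \in (l2 + l3)%VS ->
  (w \in l3 /\ v + w \in l2) <-> w = triple_map l2 l3 v.
Proof.
rewrite /transverse /triple_map => tr23 vl.
have tr32 : (l3 :&: l2 = 0)%VS by rewrite capvC.
have dec : daddv_pi l2 l3 v + daddv_pi l3 l2 v = v by exact: daddv_pi_add.
split=> [[wl3 vwl2]|->]; last first.
  split; first by rewrite rpredN memv_pi.
  by rewrite -{1}dec addrK memv_pi.
have e : v = (v + w) - w by rewrite addrK.
rewrite e linearB /= (daddv_pi_id tr32 wl3).
have : daddv_pi l2 l3 (v + w) + daddv_pi l3 l2 (v + w) = v + w.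
  by apply: daddv_pi_add => //; exact: subvP (addvSl _ _) _ vwl2.
rewrite (daddv_pi_id tr23 vwl2) => /(canRL (addKr _)) ->.
by rewrite addNr sub0r opprK.
Qed.

Definition triple_form (l2 l3 : {vspace V}) (v : V) : F :=
  om v (triple_map l2 l3 v).

Definition maximal_triple (l1 l2 l3 : {vspace V}) : Prop :=
  [/\ transverse l1 l2, transverse l2 l3, transverse l1 l3
    & forall v, v \in l1 -> v != 0 -> 0 < triple_form l2 l3 v].

Definition in_Sp f : Prop := forall u v, om (f u) (f v) = om u v.

(* The roots of the characteristic polynomial in F[i], with multiplicity. *)
Definition eigenvalues f : seq F[i] :=
  let e := vbasis {:V} in
  sval (closed_field_poly_normal
          (map_poly (real_complex F) (char_poly (passmx.mxof e e f)))).

Definition expanding_eigenvalues f : seq F[i] :=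
  sort (fun z w => Normc.normc w <= Normc.normc z)
       [seq z <- eigenvalues f | 1 < Normc.normc z].

End Symplectic.

Section Representation.
Variables (R : realType) (F : rcfType) (V : vectType F).
Variables (om : {skew_symmetric V}).
Variables (G : set 'M[R]_2) (rho : 'M[R]_2 -> 'End(V)).

(* Only the values of rho on G matter; rho (- A) = rho A makes it descend to  *)
(* the image of G in PSL(2, R).                                               *)
Definition symplectic_representation : Prop :=
  [/\ forall A, G A -> in_Sp om (rho A),
      forall A B, G A -> G B -> rho (A *m B) = (rho A \o rho B)%VF
    & forall A, G A -> rho (- A) = rho A].

Definition maximal_framing (S : set (boundary R))
    (phi : boundary R -> {vspace V}) : Prop :=
  [/\ forall A x, G A -> S x -> S (mobius_bd A x),
      forall A x, G A -> hyperbolic A -> mobius_bd A x = x -> S x,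
      forall x, S x -> lagrangian om (phi x),
      forall A x, G A -> S x -> phi (mobius_bd A x) = (rho A @: phi x)%VS
    & forall x y z, S x -> S y -> S z -> positively_oriented x y z ->
        maximal_triple om (phi x) (phi y) (phi z)].

Definition admits_maximal_framing : Prop := exists S phi, maximal_framing S phi.

End Representation.

(* For x > 0 and n > 0 this is the positive n-th root of x in F. *)
Definition pos_root (F : rcfType) (n : nat) (x : F) : F :=
  Re (n.-root (x%:C : F[i])).

Lemma pos_rootP (F : rcfType) (n : nat) (x : F) : (0 < n)%N -> 0 < x ->
  0 < pos_root n x /\ pos_root n x ^+ n = x.
Proof.
move=> n_gt0 x_gt0.
have := rootCK n_gt0 (x%:C : F[i]); have := rootC_gt0 (x%:C : F[i]) n_gt0.
rewrite /pos_root ltcR x_gt0; case: (n.-root _) => a b /=.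
rewrite ltcE /= => /andP[/eqP -> a_gt0] H; split=> //.
by have := H; rewrite -/(a%:C) -rmorphXn /= => -[].
Qed.

(* Main.v *)
From HB Require Import structures.
Require Import Defs.
From mathcomp Require Import all_boot all_order all_algebra complex.
From mathcomp Require Import all_classical all_reals all_analysis measurable_realfun.
From mathcomp Require Import ring lra.

Set Implicit Arguments.
Unset Strict Implicit.
Unset Printing Implicit Defensive.

Import Order.TTheory GRing.Theory Num.Theory.
Import numFieldNormedType.Exports.
Import passmx.
Local Open Scope classical_set_scope.
Local Open Scope ring_scope.

(** Three facts carry the proof.

    Positivity expands. Lagrangians transverse to a fixed Lagrangian [b] are graphs
    of symmetric matrices over a Lagrangian [a], and maximality of a triple means
    that the difference of two such matrices is positive definite. If a symplectic
    map [f] fixes [a] and [b] then it acts on these matrices by [P |-> g P g^T], and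
    if it moves one of them in the positive direction, so that [g P g^T - P] is
    positive definite, then all eigenvalues of [g] are larger than 1 in absolute
    value and those on the other invariant Lagrangian are smaller than 1
    ([expanding_spectrum]). To apply this to [rho A] one needs a third point where
    the framing is defined, besides the two end points of the axis of [A]. If there
    were none, all of [G] would preserve the axis; as [G] acts freely it would
    consist of diagonal matrices in a suitable basis, and its quotient would have
    infinite area ([off_axis]). The area is computed in the coordinates [(s, r)] of
    the point [s e^r + i e^r], where it is [ds dr] and diagonal matrices translate
    [r]. A fundamental domain then meets each line of constant [s] in a set whose
    length is bounded below independently of [s], the translations being discrete.

    Crossing axes can be normalized. Diagonalize [A] with axis from 0 to infinity, and
    let [B] cross it from the negative fixed point [q] to the positive fixed point [p].
    Among all conjugates of [B] by [G] that cross in the same direction, one has the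
    smallest angle with the axis of [A], by discreteness. If [B] mapped infinity
    beyond [A p] then [B^-1 A B A^-1 B] would be a conjugate crossing at a still smaller
    angle. So [p], [B oo], [A p], [oo] are in this order, [B oo] and [A p] possibly equal
    ([minimal_crossing]).

    The collar inequalities are then inequalities between matrices. Let [P], [- N] and
    [Y] be the symmetric matrices of the Lagrangians at [p], [q] and [B oo], let [g] be as
    above for [A], and [k] the matrix of [rho B] on the Lagrangian at [p]. The order of
    the points gives [P < Y <= g P g^T], and [Y - P] is the inverse of [k^T C k - C] with
    [C] the inverse of [P + N]. Minkowski's determinant inequality, applied to
    [g P g^T = P + (g P g^T - P)] and to [k^T C k = C + (k^T C k - C)], yields the
    inequality between products ([collar_det]). Testing [k^T C k - C] on an eigenvector of
    [k] and adding a form of rank one yields the inequality for a single eigenvalue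
    ([collar_eigen]). *)

(** * Complex roots of matrices over a real closed field *)

Section ComplexRoots.
Variable F : rcfType.
Local Notation toC := (real_complex F).

Lemma horner_char_poly (R : comNzRingType) n (A : 'M[R]_n) a :
  (char_poly A).[a] = \det (a%:M - A).
Proof.
rewrite -/(horner_eval a _) /char_poly -det_map_mx; congr (\det _).
apply/matrixP=> i j; rewrite !mxE -[LHS]/(_.[a]).
by rewrite hornerD hornerN hornerMn hornerX hornerC.
Qed.

(** Spelled as in [eigenvalues], so that the two agree by conversion. *)
Definition croots n (A : 'M[F]_n) : seq F[i] :=
  sval (closed_field_poly_normal (map_poly toC (char_poly A))).

Lemma crootsE n (A : 'M[F]_n) :
  map_poly toC (char_poly A) = \prod_(z <- croots A) ('X - z%:P).
Proof.
rewrite /croots; case: closed_field_poly_normal => r /= {1}->.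
by rewrite lead_coef_map (monicP (char_poly_monic A)) rmorph1 scale1r.
Qed.

Lemma size_croots n (A : 'M[F]_n) : size (croots A) = n.
Proof.
have := congr1 (fun p : {poly _} => size p) (crootsE A).
by rewrite size_map_poly size_char_poly size_prod_XsubC => -[].
Qed.

Lemma det_croots n (A : 'M[F]_n) (a : F) :
  (\det (a%:M + A))%:C%C = \prod_(z <- croots A) (a%:C%C + z).
Proof.
have := congr1 (fun p : {poly _} => p.[toC (- a)]) (crootsE A).
rewrite horner_map horner_char_poly horner_prod.
have -> : (- a)%:M - A = - (a%:M + A) by rewrite raddfN opprD.
rewrite -scaleN1r detZ rmorphM rmorphXn rmorphN1.
under eq_bigr => z _ do rewrite !hornerE rmorphN -opprD -mulN1r.
rewrite big_split /= big_const_seq count_predT size_croots iter_mulr mulr1.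
by move=> /(mulfI _); apply; rewrite signr_eq0.
Qed.

Lemma prod_croots n (A : 'M[F]_n) : \prod_(z <- croots A) z = (\det A)%:C%C.
Proof.
have := det_croots A 0; rewrite raddf0 add0r => ->.
by apply: eq_bigr => z _; rewrite add0r.
Qed.

(** [u] and [v] are the real and imaginary parts of a row eigenvector. Keeping
    them apart lets forms over [F] be evaluated on complex eigenvectors. *)
Lemma croots_eigen n (A : 'M[F]_n) (z : F[i]) : z \in croots A ->
  exists u v : 'rV[F]_n, [/\ (u != 0) || (v != 0),
    u *m A = complex.Re z *: u - complex.Im z *: v
  & v *m A = complex.Re z *: v + complex.Im z *: u].
Proof.
move=> zA; have : root (map_poly toC (char_poly A)) z.
  by rewrite crootsE root_prod_XsubC.
rewrite map_char_poly -eigenvalue_root_char => /eigenvalueP[w wA w0].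
pose u := map_mx (@complex.Re F) w; pose v := map_mx (@complex.Im F) w.
exists u, v; case: z wA {zA} => a b /= wA.
have wE i j : (w *m map_mx toC A) i j =
   ((u *m A) i j +i* (v *m A) i j)%C.
  rewrite !mxE; elim/big_rec3: _ => [//|k x y [s t] _ ->].
  rewrite !mxE; case: (w i k) => c d /=.
  by apply/eqP; rewrite eq_complex /= !mulr0 subr0 add0r !eqxx.
have wij i j : w i j = (u i j +i* v i j)%C by rewrite !mxE; case: (w i j).
split.
- apply: contraNT w0; rewrite negb_or !negbK => /andP[/eqP u0 /eqP v0].
  by apply/eqP/matrixP=> i j; rewrite wij u0 v0 !mxE.
- by apply/matrixP=> i j; have := wE i j; rewrite wA mxE wij => -[<- _]; rewrite !mxE.
- by apply/matrixP=> i j; have := wE i j; rewrite wA mxE wij => -[_ <-]; rewrite !mxE.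
Qed.

Lemma croots_char_poly n (A B : 'M[F]_n) : char_poly A = char_poly B -> croots A = croots B.
Proof. by rewrite /croots => ->. Qed.

End ComplexRoots.

(** * Positive definite forms and determinants *)

Section PosDef.
Variable F : rcfType.
Implicit Types n : nat.

Definition bf n (Q : 'M[F]_n) (u v : 'rV[F]_n) : F := (u *m Q *m v^T) 0 0.

Definition qf n (Q : 'M[F]_n) (v : 'rV[F]_n) : F := bf Q v v.

Lemma bfDl n (Q : 'M[F]_n) u u' v : bf Q (u + u') v = bf Q u v + bf Q u' v.
Proof. by rewrite /bf !mulmxDl mxE. Qed.

Lemma bfDr n (Q : 'M[F]_n) u v v' : bf Q u (v + v') = bf Q u v + bf Q u v'.
Proof. by rewrite /bf linearD mulmxDr mxE. Qed.

Lemma bfZl n (Q : 'M[F]_n) c u v : bf Q (c *: u) v = c * bf Q u v.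
Proof. by rewrite /bf -!scalemxAl mxE. Qed.

Lemma bfZr n (Q : 'M[F]_n) c u v : bf Q u (c *: v) = c * bf Q u v.
Proof. by rewrite /bf linearZ /= -scalemxAr mxE. Qed.

Lemma bfNl n (Q : 'M[F]_n) u v : bf Q (- u) v = - bf Q u v.
Proof. by rewrite -scaleN1r bfZl mulN1r. Qed.

Lemma bfNr n (Q : 'M[F]_n) u v : bf Q u (- v) = - bf Q u v.
Proof. by rewrite -scaleN1r bfZr mulN1r. Qed.

Lemma bf_sym n (Q : 'M[F]_n) u v : Q^T = Q -> bf Q u v = bf Q v u.
Proof.
by move=> Qs; rewrite /bf -[in LHS](trmxK (u *m Q *m v^T)) mxE !trmx_mul trmxK Qs mulmxA.
Qed.

Definition bfE := (bfDl, bfDr, bfNl, bfNr, bfZl, bfZr).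

Definition posdef n (Q : 'M[F]_n) : Prop :=
  Q^T = Q /\ forall v, v != 0 -> 0 < qf Q v.

Lemma qf0 n (Q : 'M[F]_n) : qf Q 0 = 0.
Proof. by rewrite /qf /bf mul0mx mul0mx mxE. Qed.

Lemma qfD n (P Q : 'M[F]_n) v : qf (P + Q) v = qf P v + qf Q v.
Proof. by rewrite /qf /bf mulmxDr mulmxDl mxE. Qed.

Lemma qfB n (P Q : 'M[F]_n) v : qf (P - Q) v = qf P v - qf Q v.
Proof. by rewrite /qf /bf mulmxBr mulmxBl !mxE. Qed.

Lemma qfZ n (Q : 'M[F]_n) c v : qf (c *: Q) v = c * qf Q v.
Proof. by rewrite /qf /bf -scalemxAr -scalemxAl mxE. Qed.

Lemma qf_conj n (K Q : 'M[F]_n) v : qf (K *m Q *m K^T) v = qf Q (v *m K).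
Proof. by rewrite /qf /bf trmx_mul !mulmxA. Qed.

Lemma posdef_ge0 n (Q : 'M[F]_n) v : posdef Q -> 0 <= qf Q v.
Proof. by case=> _ Qp; have [->|/Qp/ltW//] := eqVneq v 0; rewrite qf0. Qed.

Lemma posdefD n (P Q : 'M[F]_n) : posdef P -> posdef Q -> posdef (P + Q).
Proof.
move=> [Ps Pp] [Qs Qp]; split; first by rewrite raddfD /= Ps Qs.
by move=> v v0; rewrite qfD addr_gt0 ?Pp ?Qp.
Qed.

Lemma posdef_unit n (Q : 'M[F]_n) : posdef Q -> Q \in unitmx.
Proof.
move=> [_ Qp]; rewrite -row_free_unit -kermx_eq0; apply/rowV0P=> v.
move=> /sub_kermxP vQ; apply/eqP; apply: contraT => /Qp.
by rewrite /qf /bf vQ mul0mx mxE ltxx.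
Qed.

Lemma posdef_conj n (K Q : 'M[F]_n) : K \in unitmx -> posdef Q ->
  posdef (K *m Q *m K^T).
Proof.
move=> Ku [Qs Qp]; split; first by rewrite !trmx_mul trmxK Qs mulmxA.
move=> v v0; rewrite qf_conj Qp //; apply: contra v0 => /eqP vK.
by rewrite -(mulmxK Ku v) vK mul0mx.
Qed.

Lemma posdef_inv n (Q : 'M[F]_n) : posdef Q -> posdef (invmx Q).
Proof.
move=> Qp; have Qu := posdef_unit Qp.
have -> : invmx Q = invmx Q *m Q *m (invmx Q)^T.
  by rewrite trmx_inv Qp.1 mulVmx // mul1mx.
by apply: posdef_conj; rewrite ?unitmx_inv.
Qed.

(** The hypotheses say that [u + i v] is an eigenvector of [A] for [a + i b]; the
    sum of the values at [u] and [v] is the Hermitian form at [u + i v]. *)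
Lemma qf_sum n (Q A : 'M[F]_n) (u v : 'rV_n) (a b : F) : Q^T = Q ->
  u *m A = a *: u - b *: v -> v *m A = a *: v + b *: u ->
  qf (A *m Q *m A^T) u + qf (A *m Q *m A^T) v =
  (a ^+ 2 + b ^+ 2) * (qf Q u + qf Q v).
Proof.
move=> Qs uA vA; rewrite !qf_conj uA vA /qf !bfE (bf_sym v u Qs); ring.
Qed.

Lemma cauchy_schwarz n (Q : 'M[F]_n) u v : posdef Q ->
  bf Q u v ^+ 2 <= qf Q u * qf Q v.
Proof.
move=> Qp; have [->|v0] := eqVneq v 0.
  by rewrite qf0 mulr0 /bf trmx0 mulmx0 mxE expr0n.
have vp := Qp.2 v v0.
have := posdef_ge0 (qf Q v *: u - bf Q u v *: v) Qp.
rewrite {1}/qf !bfE (bf_sym v u Qp.1) -!/(qf Q _).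
set a := qf Q v in vp *; set b := qf Q u; set c := bf Q u v.
rewrite (_ : _ + _ = a * (b * a - c ^+ 2)); last by ring.
by rewrite pmulr_rge0 // subr_ge0.
Qed.

Definition psd n (Q : 'M[F]_n) : Prop := Q^T = Q /\ forall v, 0 <= qf Q v.

Lemma posdef_psd n (Q : 'M[F]_n) : posdef Q -> psd Q.
Proof. by move=> Qp; split=> [|v]; [exact: Qp.1|exact: posdef_ge0]. Qed.

(** The [t i] are the roots of [X *m invmx Y]. On a complex eigenvector [u + i v]
    for [z] the Hermitian forms satisfy [X = z Y], and both values are real, the
    one of [Y] being positive; hence [z] is real and nonnegative. *)
Lemma psd_pair n (X Y : 'M[F]_n) : psd X -> posdef Y ->
  exists t : 'I_n -> F, [/\ forall i, 0 <= t i,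
    \det X = \det Y * \prod_i t i
  & forall a, \det (a *: Y + X) = \det Y * \prod_i (a + t i)].
Proof.
move=> Xp Yp; have Yu := posdef_unit Yp; pose A := X *m invmx Y.
have rA z : z \in croots A -> complex.Im z = 0 /\ 0 <= complex.Re z.
  move=> /croots_eigen[u [v [uv0]]]; case: z => a b /= uA vA.
  have uX : u *m X = (a *: u - b *: v) *m Y by rewrite -uA -!mulmxA mulVmx // mulmx1.
  have vX : v *m X = (a *: v + b *: u) *m Y by rewrite -vA -!mulmxA mulVmx // mulmx1.
  have e1 : bf X u v = bf Y (a *: u - b *: v) v by rewrite /bf uX.
  have e2 : bf X v u = bf Y (a *: v + b *: u) u by rewrite /bf vX.
  have e3 : qf X u = bf Y (a *: u - b *: v) u by rewrite /qf /bf uX.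
  have e4 : qf X v = bf Y (a *: v + b *: u) v by rewrite /qf /bf vX.
  have s0 : 0 < qf Y u + qf Y v.
    case/orP: uv0 => /Yp.2 h; first by apply: ltr_wpDr => //; apply: posdef_ge0.
    by apply: ltr_wpDl => //; apply: posdef_ge0.
  have s1 : 0 <= qf X u + qf X v by rewrite addr_ge0 ?Xp.2.
  split.
    move: e2; rewrite (bf_sym v u Xp.1) e1 !bfE (bf_sym v u Yp.1) -!/(qf Y _) => e.
    have : b * (qf Y u + qf Y v) = 0 by rewrite mulrDr; lra.
    by move/eqP; rewrite mulf_eq0 (gt_eqF s0) orbF => /eqP.
  move: s1; rewrite e3 e4 !bfE (bf_sym v u Yp.1) -!/(qf Y _).
  rewrite (_ : _ + _ = a * (qf Y u + qf Y v)); last by ring.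
  by rewrite pmulr_lge0.
pose t (i : 'I_n) := complex.Re (croots A)`_i.
have tE (i : 'I_n) : (croots A)`_i = (t i)%:C%C.
  rewrite /t; have /rA[] : (croots A)`_i \in croots A by rewrite mem_nth ?size_croots.
  by case: (croots A)`_i => a b /= ->.
have AY : A *m Y = X by rewrite mulmxKV.
have dE a : \det (a *: Y + X) = \det Y * \prod_i (a + t i).
  have -> : a *: Y + X = (a%:M + A) *m Y by rewrite mulmxDl AY mul_scalar_mx.
  rewrite det_mulmx mulrC; congr (_ * _); apply: (inj_comp (@complexI F) (fun x y e => e)).
  rewrite /= det_croots (big_nth 0) size_croots big_mkord rmorph_prod.
  by apply: eq_bigr => i _; rewrite tE rmorphD.
exists t; split=> //; last first.
  by have := dE 0; rewrite scale0r add0r => ->; under eq_bigr do rewrite add0r.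
by move=> i; have /rA[] : (croots A)`_i \in croots A by rewrite mem_nth ?size_croots.
Qed.

Lemma posdef_pair n (X Y : 'M[F]_n) : posdef X -> posdef Y ->
  exists t : 'I_n -> F, [/\ forall i, 0 < t i,
    \det X = \det Y * \prod_i t i
  & forall a, \det (a *: Y + X) = \det Y * \prod_i (a + t i)].
Proof.
move=> Xp Yp; have [t [t0 dX dXY]] := psd_pair (posdef_psd Xp) Yp.
exists t; split=> // i; rewrite lt_def t0 andbT.
have := posdef_unit Xp; rewrite unitmxE unitfE dX mulf_eq0 negb_or => /andP[_].
by move=> /prodf_neq0 /(_ i isT).
Qed.

Lemma posdef_det n (Q : 'M[F]_n) : posdef Q -> 0 < \det Q.
Proof.
have I : posdef (1%:M : 'M[F]_n).
  split; first by rewrite trmx1.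
  move=> v v0; rewrite /qf /bf mulmx1 mxE.
  have nn j : true -> 0 <= v 0 j * v^T j 0 by rewrite mxE -expr2 sqr_ge0.
  rewrite lt_def sumr_ge0 // andbT; apply: contra v0 => /eqP /(psumr_eq0P nn) h.
  apply/eqP/matrixP=> i j; rewrite !mxE ord1; apply/eqP; rewrite -sqrf_eq0 expr2.
  by have := h j isT; rewrite mxE => ->.
move=> /posdef_pair /(_ I) [t [t0 -> _]]; rewrite det1 mul1r.
by apply: prodr_gt0.
Qed.

Lemma det_add_mono n (X Y : 'M[F]_n) : psd X -> posdef Y -> \det Y <= \det (Y + X).
Proof.
move=> Xp Yp; have [t [t0 _ /(_ 1)]] := psd_pair Xp Yp.
rewrite scale1r => ->; apply: ler_peMr; first by rewrite ltW ?posdef_det.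
apply: (big_ind (fun x => 1 <= x)) => // [|i _]; first exact: mulr_ege1.
by rewrite lerDl.
Qed.

(** Minkowski's determinant inequality. With the relative eigenvalues [t i] of [X]
    and [Y], both [x / z] and [y / z] are geometric means of numbers that add up
    to 1 index by index. *)
Lemma minkowski_det n (X Y : 'M[F]_n) (x y z : F) : (0 < n)%N ->
  posdef X -> posdef Y -> 0 < x -> 0 < y -> 0 < z ->
  x ^+ n = \det X -> y ^+ n = \det Y -> z ^+ n = \det (X + Y) -> x + y <= z.
Proof.
move=> n0 Xp Yp x0 y0 z0 xn yn zn; have [t [t0 dX /(_ 1)]] := posdef_pair Xp Yp.
rewrite scale1r addrC -zn -yn => dZ; move: dX; rewrite -xn -yn => dX.
have t1 i : 0 < 1 + t i by rewrite ltr_wpDl.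
have yn0 : y ^+ n != 0 by rewrite expf_neq0 // gt_eqF.
have nR : 0 < n%:R :> F by rewrite ltr0n.
pose m1 := (\sum_i t i / (1 + t i)) / n%:R; pose m2 := (\sum_i 1 / (1 + t i)) / n%:R.
have m12 : m1 + m2 = 1.
  rewrite -mulrDl -big_split /= (eq_bigr (fun _ => 1)) => [|i _]; last first.
    by rewrite -mulrDl addrC divff // gt_eqF.
  by rewrite sumr_const card_ord divff // gt_eqF.
have agm (E : 'I_n -> F) : (forall i, 0 <= E i) -> \prod_i E i <= ((\sum_i E i) / n%:R) ^+ n.
  move=> E0; have := @leif_AGM F 'I_n predT E (fun i _ => E0 i).
  by rewrite card_ord => -[].
have q1 i : 0 <= t i / (1 + t i) by rewrite divr_ge0 // ltW.
have q2 i : 0 <= 1 / (1 + t i) by rewrite divr_ge0 // ltW.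
have m10 : 0 <= m1 by rewrite divr_ge0 ?sumr_ge0 // ltW.
have m20 : 0 <= m2 by rewrite divr_ge0 ?sumr_ge0 // ltW.
have xz0 : 0 <= x / z by rewrite divr_ge0 // ltW.
have yz0 : 0 <= y / z by rewrite divr_ge0 // ltW.
have h1 : x / z <= m1.
  rewrite -(ler_pXn2r n0) ?nnegrE // expr_div_n dX dZ -mulf_div divff // mul1r.
  by rewrite -prodf_div; apply: agm.
have h2 : y / z <= m2.
  rewrite -(ler_pXn2r n0) ?nnegrE // expr_div_n dZ invfM mulrA divff // mul1r.
  by rewrite -prodfV; under eq_bigr do rewrite -[_^-1]div1r; apply: agm.
by rewrite -[leRHS]mul1r -ler_pdivrMr // mulrDl -m12 lerD.
Qed.

Lemma det_rank1 n (u : 'cV[F]_n) (v : 'rV[F]_n) :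
  \det (1%:M + u *m v) = 1 + (v *m u) 0 0.
Proof.
have e : block_mx 1%:M 0 u 1%:M *m block_mx 1%:M (- v) 0 (1%:M + u *m v) =
    block_mx (1%:M + v *m u) (- v) 0 1%:M *m block_mx 1%:M 0 u 1%:M.
  rewrite !mulmx_block !(mul1mx, mulmx1, mul0mx, mulmx0, addr0, add0r, mulmxN, mulNmx).
  by rewrite addrK addrCA addNr addr0.
move: (congr1 determinant e); rewrite !det_mulmx !det_lblock !det_ublock !det1 !(mul1r, mulr1) => ->.
by rewrite [1%:M + _]mx11_scalar det_scalar1 !mxE.
Qed.

(** By Cauchy-Schwarz [R] dominates the form of rank one [w^T *m w] divided by
    [qf R x], where [w = x *m R]. The determinant of [M] plus that form is
    explicit, and Cauchy-Schwarz for [M] compares it with [qf M x]. *)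
Lemma det_add_rank1 n (M R : 'M[F]_n) (x : 'rV[F]_n) : posdef M -> posdef R ->
  x != 0 -> \det M * (1 + qf R x / qf M x) <= \det (M + R).
Proof.
move=> Mp Rp x0; have Mx := Mp.2 x x0; have Rx := Rp.2 x x0.
have Mu := posdef_unit Mp.
pose w := x *m R; pose E := (qf R x)^-1 *: (w^T *m w).
have wx y : (w *m y^T) 0 0 = bf R x y by [].
have qE v : qf E v = (qf R x)^-1 * (bf R x v) ^+ 2.
  rewrite qfZ; congr (_ * _); rewrite /qf /bf.
  have -> : v *m (w^T *m w) *m v^T = (v *m w^T) *m (w *m v^T) by rewrite !mulmxA.
  rewrite mxE big_ord1 wx expr2; congr (_ * _).
  by rewrite -wx -[v *m w^T]trmxK mxE trmx_mul trmxK.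
have Es : E^T = E by rewrite linearZ /= trmx_mul trmxK.
have Wp : psd (R - E).
  split; first by rewrite linearB /= Es Rp.1.
  move=> v; rewrite qfB qE subr_ge0 mulrC ler_pdivrMr // mulrC.
  exact: cauchy_schwarz.
have Ep : posdef (M + E).
  split; first by rewrite linearD /= Es Mp.1.
  move=> v v0; rewrite qfD qE ltr_wpDr ?Mp.2 //.
  by rewrite mulr_ge0 ?sqr_ge0 // invr_ge0 ltW.
apply: le_trans (_ : \det (M + E) <= _); last first.
  by have := det_add_mono Wp Ep; rewrite addrA [M + E + R]addrAC addrK.
have -> : M + E = M *m (1%:M + ((qf R x)^-1 *: (invmx M *m w^T)) *m w).
  by rewrite mulmxDr mulmx1 -scalemxAl -scalemxAr -(mulmxA (invmx M)) mulKVmx.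
rewrite det_mulmx ler_pM2l ?posdef_det // det_rank1 lerD2l -scalemxAr mulmxA mxE.
rewrite -[(w *m _ *m _) 0 0]/(qf (invmx M) w).
have := cauchy_schwarz (w *m invmx M) x Mp.
rewrite [bf _ _ _](_ : _ = qf R x); last by rewrite /bf mulmxKV // wx.
have -> : qf M (w *m invmx M) = qf (invmx M) w.
  by rewrite -qf_conj trmx_inv Mp.1 mulVmx // mul1mx.
by move=> h; rewrite ler_pdivlMl // mulrA -expr2 ler_pdivrMr.
Qed.

(** Inversion reverses the order of positive forms, by Cauchy-Schwarz for [P]
    applied to [x *m invmx P] and [x *m invmx (P + N)]. *)
Lemma qf_inv_mono n (P N : 'M[F]_n) (x : 'rV[F]_n) : posdef P -> posdef N ->
  qf (invmx (P + N)) x <= qf (invmx P) x.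
Proof.
move=> Pp Np; have Dp := posdefD Pp Np; have Du := posdef_unit Dp.
have Pu := posdef_unit Pp; have [->|x0] := eqVneq x 0; first by rewrite !qf0.
have q0 := (posdef_inv Dp).2 x x0; set q := qf _ _ in q0 *.
pose y := x *m invmx (P + N).
have qy : qf (P + N) y = q.
  by rewrite -qf_conj trmx_inv Dp.1 mulVmx // mul1mx.
have := cauchy_schwarz (x *m invmx P) y Pp.
rewrite [bf _ _ _](_ : _ = q); last first.
  by rewrite /bf mulmxKV // /y trmx_mul trmx_inv Dp.1 mulmxA.
have -> : qf P (x *m invmx P) = qf (invmx P) x.
  by rewrite -qf_conj trmx_inv Pp.1 mulVmx // mul1mx.
move=> h; rewrite -(ler_pM2r q0) -expr2 (le_trans h) // ler_wpM2l //.
  exact/posdef_ge0/posdef_inv.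
by rewrite -qy qfD lerDl posdef_ge0.
Qed.

(** Evaluate both forms on the complex eigenvector [u + i v] for [z]: [K] multiplies
    the Hermitian form of [Q] by the square of the absolute value of [z]. *)
Lemma posdef_expanding n (K Q : 'M[F]_n) (z : F[i]) : posdef Q ->
  posdef (K *m Q *m K^T - Q) -> z \in croots K ->
  exists u v : 'rV_n, [/\ (u != 0) || (v != 0), 1 < Normc.normc z &
  qf (K *m Q *m K^T - Q) u + qf (K *m Q *m K^T - Q) v =
  (Normc.normc z ^+ 2 - 1) * (qf Q u + qf Q v)].
Proof.
move=> Qp Mp /croots_eigen[u [v [uv0 uK vK]]]; exists u, v.
have e : qf (K *m Q *m K^T - Q) u + qf (K *m Q *m K^T - Q) v =
  (Normc.normc z ^+ 2 - 1) * (qf Q u + qf Q v).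
  rewrite !qfB addrACA (qf_sum Qp.1 uK vK); case: z {uK vK} => a b /=.
  by rewrite sqr_sqrtr ?addr_ge0 ?sqr_ge0 //; ring.
split=> //.
have pos W : posdef W -> 0 < qf W u + qf W v.
  move=> Wp; case/orP: uv0 => /Wp.2 h.
    by apply: ltr_wpDr => //; apply: posdef_ge0.
  by apply: ltr_wpDl => //; apply: posdef_ge0.
have nz : 0 <= Normc.normc z by case: (z) => a b; exact: sqrtr_ge0.
have := pos _ Mp; rewrite e pmulr_lgt0 ?pos // subr_gt0 -{1}(expr1n _ 2).
by rewrite ltr_pXn2r // nnegrE.
Qed.

Lemma char_poly_tr (R : comNzRingType) n (A : 'M[R]_n) : char_poly A^T = char_poly A.
Proof.
rewrite /char_poly -[in RHS]det_tr; congr (\det _).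
by apply/matrixP=> i j; rewrite !mxE eq_sym.
Qed.

Lemma root_ex n (a : F) : (0 < n)%N -> 0 < a -> exists2 x : F, 0 < x & x ^+ n = a.
Proof. by move=> n0 a0; have [] := pos_rootP n0 a0; exists (pos_root n a). Qed.

(** * The collar inequalities for matrices *)

(** The meaning of the matrices: [h] fixes the Lagrangians [p] and [q], [f] fixes
    [a] and [b]. In a basis of [a], and with Lagrangians transverse to [b] seen as
    graphs of symmetric maps from [a] to [b], [P], [- N] and [Y] are the forms of
    [p], [q] and [h b], and [g *m P *m g^T] is the form of [f p]. The matrix of [h]
    on [p] is [k], and [f] acts on [a] by the inverse of [g]. *)
Section Collar.
Variables (n : nat) (n0 : (0 < n)%N) (P N Y g k : 'M[F]_n).
Hypothesis (Pp : posdef P) (Np : posdef N).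
Let C := invmx (P + N).
Let M := k^T *m C *m k - C.
Hypothesis (YPp : posdef (Y - P)) (YM : (Y - P) *m M = 1%:M).
Hypothesis (gY : psd (g *m P *m g^T - Y)).

Let Cp : posdef C. Proof. exact/posdef_inv/posdefD. Qed.
Let Mu : M \in unitmx. Proof. by case: (mulmx1_unit YM). Qed.
Let MV : invmx M = Y - P. Proof. by rewrite -[RHS]mulmx1 -(mulmxV Mu) mulmxA YM mul1mx. Qed.
Let Mp : posdef M. Proof. by rewrite -[M]invmxK MV; apply: posdef_inv. Qed.
Let Yp : posdef Y. Proof. by rewrite -(subrK P Y); apply: posdefD. Qed.

Lemma collar_expanding_k z : z \in croots k -> 1 < Normc.normc z.
Proof.
rewrite -(croots_char_poly (char_poly_tr k)) => zk.
have [|u [v [//]]] := @posdef_expanding n k^T C z Cp _ zk.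
by rewrite trmxK.
Qed.

Let gPp : posdef (g *m P *m g^T - P).
Proof.
rewrite (_ : _ - P = (g *m P *m g^T - Y) + (Y - P)); last by rewrite addrA subrK.
split; first by rewrite linearD /= gY.1 YPp.1.
by move=> v v0; rewrite qfD ltr_wpDl ?gY.2 // YPp.2.
Qed.

Lemma collar_expanding_g z : z \in croots g -> 1 < Normc.normc z.
Proof. by move=> zg; have [u [v []]] := posdef_expanding Pp gPp zg. Qed.

Let det_g_ge : \det Y <= \det g ^+ 2 * \det P.
Proof.
rewrite (_ : _ * _ = \det (g *m P *m g^T)); last by rewrite !det_mulmx det_tr; ring.
by have := det_add_mono gY Yp; rewrite addrC subrK.
Qed.

(** The form [M] is at most [c C] at some real vector [x], where [c] is the
    square of the absolute value of [z] minus 1, and [C] is at most [invmx P].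
    The rank one estimate for [M + invmx P] then gives
    [\det g ^+ 2 >= \det Y / \det P >= 1 + c^-1]. *)
Lemma collar_eigen z : z \in croots k -> (Normc.normc z ^+ 2 - 1)^-1 <= \det g ^+ 2.
Proof.
move=> zk; have z1 := collar_expanding_k zk.
move: zk; rewrite -(croots_char_poly (char_poly_tr k)) => zk.
have [|u [v [uv0 _]]] := @posdef_expanding n k^T C z Cp _ zk; first by rewrite trmxK.
rewrite trmxK -/M; set c := _ - 1 => e.
have c0 : 0 < c by rewrite subr_gt0 exprn_egt1.
(* An inequality between sums of values at [u] and [v] holds at [u] or at [v]. *)
have [x x0 xM] : exists2 x, x != 0 & qf M x <= c * qf C x.
  have [u0|u0] := eqVneq u 0.
    exists v; first by move: uv0; rewrite u0 eqxx.
    by move: e; rewrite u0 !qf0 !add0r => ->.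
  have [h|h] := leP (qf M u) (c * qf C u); first by exists u.
  have h' : qf M v < c * qf C v by rewrite mulrDr in e; lra.
  exists v; last exact: ltW.
  by apply: contraTneq h' => ->; rewrite !qf0 mulr0 ltxx.
have xC := qf_inv_mono x Pp Np; rewrite -/C in xC.
have d := det_add_rank1 Mp (posdef_inv Pp) x0.
have Pd := posdef_det Pp; have Md := posdef_det Mp.
have Yd : \det Y * \det M = \det P * \det (M + invmx P).
  rewrite -!det_mulmx [P *m _]mulmxDr mulmxV ?posdef_unit //.
  by rewrite -[Y in LHS](subrK P) mulmxDl YM addrC.
have c1 : c^-1 <= qf (invmx P) x / qf M x.
  rewrite ler_pdivlMr ?Mp.2 // mulrC ler_pdivrMr // mulrC.
  by apply: le_trans xM _; rewrite ler_pM2l.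
rewrite -(ler_pM2r Pd); apply: le_trans det_g_ge.
rewrite -(ler_pM2r Md) Yd [c^-1 * _]mulrC -mulrA ler_pM2l // mulrC; apply: le_trans d; rewrite ler_pM2l //.
by apply: le_trans c1 _; rewrite lerDr.
Qed.

(** Minkowski's inequality bounds from above the determinants of
    [g *m P *m g^T - P] and of [M] by [(r - 1) ^+ n] and [(s - 1) ^+ n] times those
    of [P] and [C]. The product of the first two is at least 1, because [M] is the
    inverse of [Y - P], and the product of the last two is at most 1. *)
Lemma collar_det r s : 0 < r -> 0 < s -> r ^+ n = \det g ^+ 2 ->
  s ^+ n = \det k ^+ 2 -> 1 <= (r - 1) * (s - 1).
Proof.
move=> r0 s0 rn sn.
have [d d0 dn] := root_ex n0 (posdef_det Pp).
have [c c0 cn] := root_ex n0 (posdef_det Cp).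
have [e e0 en] := root_ex n0 (posdef_det gPp).
have [m m0 mn] := root_ex n0 (posdef_det Mp).
have h1 : e + d <= r * d.
  apply: (minkowski_det n0 gPp Pp) => //; first exact: mulr_gt0.
  rewrite subrK !det_mulmx det_tr exprMn rn dn; ring.
have h2 : m + c <= s * c.
  apply: (minkowski_det n0 Mp Cp) => //; first exact: mulr_gt0.
  rewrite subrK !det_mulmx det_tr exprMn sn cn; ring.
have em0 : 0 <= e * m by rewrite ltW // mulr_gt0.
have cd0 : 0 <= c * d by rewrite ltW // mulr_gt0.
have em : 1 <= e * m.
  rewrite -(ler_pXn2r n0) ?nnegrE // expr1n exprMn en mn.
  have -> : 1 = \det (Y - P) * \det M by rewrite -det_mulmx YM det1.
  rewrite ler_pM2r ?posdef_det //.
  have -> : g *m P *m g^T - P = (Y - P) + (g *m P *m g^T - Y).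
    by rewrite [RHS]addrC addrA subrK.
  exact: det_add_mono.
have cd : c * d <= 1.
  rewrite -(ler_pXn2r n0) ?nnegrE // expr1n exprMn cn dn.
  have := det_add_mono (posdef_psd Np) Pp.
  by rewrite /C det_inv ler_pdivrMl ?mulr1 ?posdef_det //; apply: posdefD.
have h3 : e <= (r - 1) * d by lra.
have h4 : m <= (s - 1) * c by lra.
have r1 : 0 <= r - 1 by rewrite -(pmulr_lge0 _ d0); apply: le_trans h3; exact: ltW.
have s1 : 0 <= s - 1 by rewrite -(pmulr_lge0 _ c0); apply: le_trans h4; exact: ltW.
apply: le_trans em _; apply: le_trans (ler_pM (ltW e0) (ltW m0) h3 h4) _.
rewrite mulrACA [d * c]mulrC ler_piMr // mulr_ge0 //.
Qed.

End Collar.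

End PosDef.

(** * Characteristic polynomials *)

Section CharPoly.
Variable F : rcfType.

Lemma char_poly_conj m1 m2 (S : 'M[F]_(m1, m2)) A B : m1 = m2 -> row_free S ->
  S *m A = B *m S -> char_poly A = char_poly B.
Proof.
move=> E; case: m2 / E S A => S A; rewrite row_free_unit => Su SA.
have := congr1 (fun M => \det (map_mx polyC M)) SA; pose T := map_mx polyC S.
have SX : T *m char_poly_mx A = char_poly_mx B *m T.
  by rewrite mulmxBr mulmxBl -!map_mxM SA scalar_mxC.
have T0 : \det T != 0.
  by rewrite det_map_mx polyC_eq0 -unitfE -unitmxE.
move=> _; apply: (mulfI T0); rewrite -det_mulmx SX det_mulmx mulrC //.
Qed.

Lemma char_poly_block m1 m2 (K1 : 'M[F]_m1) (K2 : 'M[F]_m2) :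
  char_poly (block_mx K1 0 0 K2) = char_poly K1 * char_poly K2.
Proof.
rewrite /char_poly -(det_ublock _ 0); congr (\det _).
rewrite /char_poly_mx map_block_mx !raddf0 scalar_mx_block.
by rewrite opp_block_mx add_block_mx !oppr0 !addr0.
Qed.

Lemma normc_ge0 (z : F[i]) : 0 <= Normc.normc z.
Proof. by case: z => a b; exact: sqrtr_ge0. Qed.

Lemma normc_real (x : F) : Normc.normc x%:C%C = `|x|.
Proof. by rewrite /= expr0n addr0 sqrtr_sqr. Qed.

Lemma normc_prod (s : seq F[i]) :
  \prod_(z <- s) Normc.normc z = Normc.normc (\prod_(z <- s) z).
Proof.
elim: s => [|z s IH]; first by rewrite !big_nil Normc.normc1.
by rewrite !big_cons Normc.normcM IH.
Qed.

Lemma mem_croots n (A : 'M[F]_n) z :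
  (z \in croots A) = root (map_poly (real_complex F) (char_poly A)) z.
Proof. by rewrite crootsE root_prod_XsubC. Qed.

Lemma croots_inv n (K : 'M[F]_n) z : K \in unitmx -> z \in croots (invmx K) ->
  z^-1 \in croots K.
Proof.
move=> Ku; rewrite !mem_croots !map_char_poly -!eigenvalue_root_char.
move=> /eigenvalueP[w wK w0]; apply/eigenvalueP; exists w => //.
rewrite map_invmx in wK; have Ku' : map_mx (real_complex F) K \in unitmx.
  by rewrite map_unitmx.
have wE : w = z *: (w *m map_mx (real_complex F) K) by rewrite scalemxAl -wK mulmxKV.
have z0 : z != 0 by apply: contraNneq w0 => z0; rewrite wE z0 scale0r.
by rewrite {2}wE scalerA mulVf // scale1r.
Qed.

Lemma perm_croots_cat m n1 n2 (A : 'M[F]_m) (K1 : 'M[F]_n1) (K2 : 'M[F]_n2) :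
  char_poly A = char_poly K1 * char_poly K2 ->
  perm_eq (croots A) (croots K1 ++ croots K2).
Proof.
move=> e; suff : \prod_(z <- croots A) ('X - z%:P) = \prod_(z <- croots K1 ++ croots K2) ('X - z%:P).
  by move/prod_XsubC_eq.
by rewrite big_cat /= -!crootsE -rmorphM e.
Qed.

End CharPoly.

(** * Lagrangians as graphs *)

Section SymplecticMatrices.
Variables (F : rcfType) (V : vectType F) (om : {skew_symmetric V}).

Local Notation N := (\dim {:V}).
Local Notation e := (vbasis {:V}).
Local Notation Mx := (mxof e e).
Local Notation Ms := (msof e).
Local Notation rv := (rVof e).
Local Notation vec := (vecof e).
Local Notation eb := (vbasisP {:V}).

Definition gram : 'M[F]_N := \matrix_(i, j) om e`_i e`_j.
Local Notation J := gram.

Lemma om_gram u v : om u v = (rv u *m J *m (rv v)^T) 0 0.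
Proof.
rewrite -{1}(rVofK eb u) -{1}(rVofK eb v) /vecof.
rewrite linear_sumlz mxE; under [RHS]eq_bigr do rewrite !mxE mulr_suml.
rewrite exchange_big; apply: eq_bigr => i _ /=.
rewrite linearZl_LR linear_sumr /= mulr_sumr; apply: eq_bigr => j _ /=.
by rewrite linearZr_LR /= !mxE; ring.
Qed.

Lemma om_vec x y : om (vec x) (vec y) = (x *m J *m y^T) 0 0.
Proof. by rewrite om_gram !(vecofK eb). Qed.

Lemma gram_skew : J^T = - J.
Proof.
by apply/matrixP=> i j; rewrite !mxE hermC expr1 mulN1r.
Qed.

Lemma in_Sp_mx f : in_Sp om f -> Mx f *m J *m (Mx f)^T = J.
Proof.
move=> fS; have q (A B : 'M[F]_N) :
    (forall x y : 'rV_N, (x *m A *m y^T) 0 0 = (x *m B *m y^T) 0 0) -> A = B.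
  move=> h; apply/matrixP=> i j; have := h (delta_mx 0 i) (delta_mx 0 j).
  by rewrite -!rowE !trmx_delta -!colE !mxE.
apply: q => x y; rewrite -om_vec -(fS (vec x)) !(hom_vecof e eb) om_vec.
by rewrite trmx_mul !mulmxA.
Qed.

Lemma mx_comp f g : Mx (f \o g)%VF = Mx g *m Mx f.
Proof. exact: (mxof_comp _ _ eb). Qed.

Lemma ms_image f L m (X : 'M[F]_(m, N)) : (X <= Ms L)%MS -> (X *m Mx f <= Ms (f @: L))%MS.
Proof.
move=> XL; apply/rV_subP => _ /submxP[u ->].
rewrite mulmxA -(mem_vecof eb) -(hom_vecof e eb) memv_img //.
by rewrite (mem_vecof eb) (submx_trans (submxMl _ _)).
Qed.

Lemma ms_span n L (X : 'M[F]_(n, N)) : \dim L = n -> row_free X -> (X <= Ms L)%MS ->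
  (Ms L <= X)%MS.
Proof.
move=> dL Xf XL; rewrite -(geq_leqif (mxrank_leqif_sup XL)) (eqP Xf).
have LB : (Ms L <= \matrix_(i < \dim L) rv (vbasis L)`_i)%MS.
  apply/rV_subP => u; rewrite -(mem_vecof eb) => /coord_vbasis uE.
  rewrite -(vecofK eb u) uE linear_sum summx_sub // => i _.
  rewrite linearZ scalemx_sub //.
  by have := row_sub i (\matrix_(i < \dim L) rv (vbasis L)`_i); rewrite rowK.
by rewrite (leq_trans (mxrankS LB)) // (leq_trans (rank_leq_row _)) ?dL.
Qed.

Lemma isotropicP L m1 m2 (X : 'M[F]_(m1, N)) (Y : 'M[F]_(m2, N)) : lagrangian om L ->
  (X <= Ms L)%MS -> (Y <= Ms L)%MS -> X *m J *m Y^T = 0.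
Proof.
move=> [/orthovP iso _] XL YL; apply/matrixP=> i j; rewrite [RHS]mxE.
have -> : (X *m J *m Y^T) i j = (row i X *m J *m (row j Y)^T) 0 0.
  rewrite -row_mul [LHS]mxE [RHS]mxE; apply: eq_bigr => k _.
  by rewrite !mxE.
rewrite -om_vec; apply: iso; rewrite (mem_vecof eb).
  exact: submx_trans (row_sub _ _) XL.
exact: submx_trans (row_sub _ _) YL.
Qed.

(** [Z] describes [z] as the graph of a linear map from the span of [E] to [b]. *)
Definition graph_mx n (E : 'M[F]_(n, N)) (b z : {vspace V}) (Z : 'M[F]_(n, N)) : Prop :=
  (Z <= Ms z)%MS /\ (Z - E <= Ms b)%MS.

Lemma graph_mx_ex n (E : 'M[F]_(n, N)) b z : transverse z b ->
  (\dim z + \dim b = N)%N -> exists Z, graph_mx E b z Z.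
Proof.
move=> tr dzb; have fz : (z + b)%VS = fullv.
  apply/eqP; rewrite eqEdim subvf dimv_disjoint_sum //=.
  by rewrite dzb.
exists (E *m Mx (daddv_pi z b)); split.
  apply/rV_subP=> _ /submxP[u ->].
  by rewrite mulmxA -(mem_vecof eb) -(hom_vecof e eb) memv_pi.
rewrite -opprB eqmx_opp; apply/rV_subP=> _ /submxP[u ->].
rewrite -(mem_vecof eb) mulmxBr mulmxA linearB /= -(hom_vecof e eb).
set v := vec (u *m E); have : daddv_pi z b v + daddv_pi b z v = v.
  by apply: daddv_pi_add => //; rewrite fz memvf.
by move/(canRL (addKr _)); rewrite addrC => <-; rewrite memv_pi.
Qed.

Section Graphs.
Variables (n : nat) (a b : {vspace V}) (E : 'M[F]_(n, N)).
Hypotheses (aL : lagrangian om a) (bL : lagrangian om b) (Ea : (E <= Ms a)%MS).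

(** If [Z] is the graph of [T] from [a] to [b] then this is the matrix of the
    bilinear form [om v (T w)] in the basis [E]. *)
Definition graph_form (Z : 'M[F]_(n, N)) := E *m J *m Z^T.

Lemma graph_base : graph_mx E b a E.
Proof. by split=> //; rewrite subrr sub0mx. Qed.

Lemma graph_form_base : graph_form E = 0.
Proof. exact: isotropicP aL Ea Ea. Qed.

(** [Z - E] and [Z' - E] have rows in the isotropic space [b]. *)
Lemma gram_graph_raw z z' Z Z' : graph_mx E b z Z -> graph_mx E b z' Z' ->
  Z *m J *m Z'^T = graph_form Z' - (graph_form Z)^T.
Proof.
move=> [_ Zb] [_ Zb']; have := isotropicP bL Zb Zb'.
have EE := isotropicP aL Ea Ea.
rewrite linearB /= mulmxBr !mulmxBl EE subr0 -/(graph_form Z').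
have -> : Z *m J *m E^T = - (graph_form Z)^T.
  by rewrite /graph_form !trmx_mul trmxK gram_skew mulNmx mulmxN opprK mulmxA.
by rewrite -addrA -opprD => /subr0_eq.
Qed.

Lemma graph_form_sym z Z : lagrangian om z -> graph_mx E b z Z ->
  (graph_form Z)^T = graph_form Z.
Proof.
move=> zL Zg; have := gram_graph_raw Zg Zg; rewrite (isotropicP zL Zg.1 Zg.1).
by move/esym/subr0_eq.
Qed.

Lemma gram_graph z z' Z Z' : lagrangian om z ->
  graph_mx E b z Z -> graph_mx E b z' Z' ->
  Z *m J *m Z'^T = graph_form Z' - graph_form Z.
Proof. by move=> zL Zg Zg'; rewrite (gram_graph_raw Zg Zg') (graph_form_sym zL Zg). Qed.

Lemma graph_free z Z : row_free E -> transverse a b -> graph_mx E b z Z -> row_free Z.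
Proof.
move=> Ef tr [_ Zb]; rewrite -kermx_eq0; apply/rowV0P=> v /sub_kermxP vZ.
have : (v *m E <= Ms b)%MS.
  have -> : v *m E = - (v *m (Z - E)) by rewrite mulmxBr vZ sub0r opprK.
  by rewrite eqmx_opp (submx_trans (submxMl _ _)).
have : (v *m E <= Ms a)%MS by rewrite (submx_trans (submxMl _ _)).
rewrite -!(mem_vecof eb) => va vb.
have : vec (v *m E) \in (a :&: b)%VS by rewrite memv_cap va vb.
rewrite tr memv0 (vecof_eq0 eb) => /eqP vE.
by apply: (row_free_inj Ef); rewrite vE mul0mx.
Qed.

(** For [v] in the first graph, the vector of [b] that leads to the second graph
    is the difference of the two maps applied to the component of [v] in [a]. *)
Lemma maximal_graph z z' Z Z' : row_free E -> lagrangian om z -> lagrangian om z' ->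
  graph_mx E b z Z -> graph_mx E b z' Z' -> transverse a b ->
  maximal_triple om z z' b -> posdef (graph_form Z' - graph_form Z).
Proof.
move=> Ef zL zL' Zg Zg' tab [_ tr _ mx].
split.
  by rewrite linearB /= (graph_form_sym zL Zg) (graph_form_sym zL' Zg').
move=> v v0; have := mx (vec (v *m Z)).
rewrite (mem_vecof eb) (submx_trans (submxMl _ _)) ?Zg.1 // => /(_ isT).
rewrite (vecof_eq0 eb) => h.
have vZ0 : v *m Z != 0.
  by apply: contra v0 => /eqP vZ; apply/eqP/(row_free_inj (graph_free Ef tab Zg)); rewrite vZ mul0mx.
move: (h vZ0); rewrite /triple_form.
have Zb : (Z' - Z <= Ms b)%MS.
  have -> : Z' - Z = (Z' - E) + (- (Z - E)) by rewrite opprB addrA subrK.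
  by rewrite addmx_sub ?eqmx_opp ?Zg.2 ?Zg'.2.
have <- : vec (v *m (Z' - Z)) = triple_map z' b (vec (v *m Z)).
  have vZ' : vec (v *m Z) + vec (v *m (Z' - Z)) \in z'.
    by rewrite -linearD /= mulmxBr addrC subrK (mem_vecof eb) (submx_trans (submxMl _ _)) ?Zg'.1.
  have vZb : vec (v *m (Z' - Z)) \in b.
    by rewrite (mem_vecof eb) (submx_trans (submxMl _ _)).
  apply/triple_mapP => //.
  by rewrite -[vec (v *m Z)](addrK (vec (v *m (Z' - Z)))) memv_add // rpredN.
have ZZ : Z *m J *m (Z' - Z)^T = graph_form Z' - graph_form Z.
  rewrite linearB /= mulmxBr (isotropicP zL Zg.1 Zg.1) subr0.
  exact: gram_graph Zg Zg'.
by rewrite om_vec /qf /bf -ZZ trmx_mul !mulmxA.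
Qed.

End Graphs.

Lemma eigenvaluesE f : eigenvalues f = croots (Mx f).
Proof. by []. Qed.

(** * Symplectic maps with two invariant Lagrangians *)

Section Spectrum.
Variables (n : nat) (f : 'End(V)) (A B : 'M[F]_(n, N)) (K1 K2 : 'M[F]_n).
Hypotheses (dV : N = (n + n)%N) (fS : in_Sp om f).
Hypotheses (AA : A *m J *m A^T = 0) (BB : B *m J *m B^T = 0)
  (AB : A *m J *m B^T \in unitmx).
Hypotheses (fA : A *m Mx f = K1 *m A) (fB : B *m Mx f = K2 *m B).

Lemma free_of_gram m (S : 'M[F]_(m, N)) T : S *m J *m T \in unitmx -> row_free S.
Proof.
rewrite -row_free_unit -!kermx_eq0 => /eqP k0; apply/rowV0P => v /sub_kermxP vS.
apply/eqP; rewrite -submx0 -k0; apply/sub_kermxP.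
by rewrite !mulmxA vS !mul0mx.
Qed.

Lemma spectrum_split : char_poly (Mx f) = char_poly K1 * char_poly K2.
Proof.
rewrite -char_poly_block; apply: (@char_poly_conj _ _ _ (col_mx A B)).
- by rewrite dV.
- apply: (@free_of_gram _ _ (col_mx A B)^T); rewrite -row_free_unit.
  rewrite mul_col_mx tr_col_mx mul_col_row AA BB.
  have -> : B *m J *m A^T = - (A *m J *m B^T)^T.
    by rewrite !trmx_mul trmxK gram_skew mulNmx mulmxN opprK mulmxA.
  have := AB; set U := A *m J *m B^T => Uu.
  suff /mulmx1_unit[] : block_mx 0 U (- U^T) 0 *m
      block_mx 0 (- (invmx U)^T) (invmx U) 0 = 1%:M by rewrite row_free_unit.
  rewrite mulmx_block !(mul0mx, mulmx0, add0r, addr0) mulNmx mulmxN opprK.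
  by rewrite -trmx_mul mulmxV // mulVmx // trmx1 -scalar_mx_block.
- by rewrite mul_col_mx fA fB mul_block_col !mul0mx addr0 add0r.
Qed.

Let K1U : K1 *m (A *m J *m B^T) *m K2^T = A *m J *m B^T.
Proof.
rewrite -{2}(in_Sp_mx fS) !mulmxA fA -[RHS]mulmxA -[RHS]mulmxA.
by rewrite -trmx_mul fB trmx_mul !mulmxA.
Qed.

(** The symplectic form pairs the two invariant Lagrangians, so [K2] is conjugate
    to the transposed inverse of [K1]. *)
Lemma contracting_K2 z : (forall z, z \in croots K1 -> 1 < Normc.normc z) ->
  z \in croots K2 -> Normc.normc z < 1.
Proof.
move=> K1e zK2; have := K1U; have := AB; move: (A *m J *m B^T) => U Uu KUK.
have /mulmx1_unit[K1u _] : K1 *m (U *m K2^T *m invmx U) = 1%:M.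
  by rewrite !mulmxA KUK mulmxV.
have K2E : char_poly K2 = char_poly (invmx K1).
  rewrite -(char_poly_tr K2); apply: (@char_poly_conj _ _ _ U) => //.
    by rewrite row_free_unit.
  by rewrite -[LHS](mulKmx K1u) [K1 *m _]mulmxA KUK.
move: zK2; rewrite (croots_char_poly K2E) => /(croots_inv K1u) /K1e.
have [->|z0] := eqVneq z 0; first by rewrite invr0 Normc.normc0.
have e : Normc.normc z * Normc.normc z^-1 = 1.
  by rewrite -Normc.normcM divff // Normc.normc1.
have := normc_ge0 z; nra.
Qed.

Hypothesis K1e : forall z, z \in croots K1 -> 1 < Normc.normc z.

Lemma spectrum_noncentral z : z \in eigenvalues f -> Normc.normc z <> 1.
Proof.
rewrite eigenvaluesE (perm_mem (perm_croots_cat spectrum_split)) mem_cat.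
by case/orP=> [/K1e|/(contracting_K2 K1e)] h e; rewrite e ltxx in h.
Qed.

Lemma expanding_perm : perm_eq (expanding_eigenvalues f) (croots K1).
Proof.
rewrite /expanding_eigenvalues perm_sort eigenvaluesE.
apply: perm_trans (perm_filter _ (perm_croots_cat spectrum_split)) _.
rewrite filter_cat.
rewrite (_ : [seq _ <- croots K2 | _] = [::]) ?cats0.
  by rewrite (_ : [seq _ <- croots K1 | _] = croots K1) //; apply/all_filterP/allP => z /K1e.
apply/eqP; rewrite -[_ == _]negbK -has_filter -all_predC; apply/allP => z.
by move=> /(contracting_K2 K1e) /=; rewrite -leNgt => /ltW.
Qed.

Lemma size_expanding : size (expanding_eigenvalues f) = n.
Proof. by rewrite (perm_size expanding_perm) size_croots. Qed.

Lemma expanding_prod :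
  \prod_(i < n) Normc.normc (expanding_eigenvalues f)`_i = `|\det K1|.
Proof.
rewrite -normc_real -prod_croots -normc_prod -(perm_big _ expanding_perm) /=.
by rewrite (big_nth 0) size_expanding big_mkord.
Qed.

Lemma expanding_pos_root (n0 : (0 < n)%N) (r := \prod_(i < n) pos_root n (Normc.normc (expanding_eigenvalues f)`_i ^+ 2)) :
  0 < r /\ r ^+ n = \det K1 ^+ 2.
Proof.
have L0 (i : 'I_n) : 0 < Normc.normc (expanding_eigenvalues f)`_i ^+ 2.
  rewrite exprn_gt0 // (lt_trans ltr01) // K1e // -(perm_mem expanding_perm).
  by rewrite mem_nth ?size_expanding.
split; first by apply: prodr_gt0 => i _; case: (pos_rootP n0 (L0 i)).
rewrite /r -prodrXl (eq_bigr (fun i : 'I_n => Normc.normc (expanding_eigenvalues f)`_i ^+ 2)).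
  by rewrite prodrXl expanding_prod real_normK ?num_real.
by move=> i _; case: (pos_rootP n0 (L0 i)).
Qed.

Lemma expanding_head (n0 : (0 < n)%N) :
  \det K1 ^+ 2 <= Normc.normc (expanding_eigenvalues f)`_0 ^+ (2 * n).
Proof.
set L := expanding_eigenvalues f.
have Ls : sorted (fun z w => Normc.normc w <= Normc.normc z) L.
  by apply: sort_sorted => z w; exact: le_total.
have Lmax (i : 'I_n) : Normc.normc L`_i <= Normc.normc L`_0.
  apply: (@sorted_leq_nth _ (fun z w => Normc.normc w <= Normc.normc z) _ _ 0 L) => //.
  - by move=> x y z h1 h2; exact: le_trans h2 h1.
  - by rewrite inE size_expanding.
  - by rewrite inE size_expanding.
rewrite -real_normK ?num_real // -expanding_prod mulnC exprM ler_pXn2r ?nnegrE //.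
- rewrite -/L -[n in _ ^+ n]card_ord -prodr_const; apply: ler_prod => i _.
  by rewrite normc_ge0 Lmax.
- by apply: prodr_ge0 => i _; rewrite normc_ge0.
- by rewrite exprn_ge0 ?normc_ge0.
Qed.

Lemma expanding_last (n0 : (0 < n)%N) : (expanding_eigenvalues f)`_n.-1 \in croots K1.
Proof. by rewrite -(perm_mem expanding_perm) mem_nth // size_expanding prednK. Qed.

End Spectrum.

(** * Configurations of Lagrangians *)

Lemma ms_image_sub f L m (X : 'M[F]_(m, N)) : (Ms L <= X)%MS ->
  (Ms (f @: L) <= X *m Mx f)%MS.
Proof.
move=> LX; apply/rV_subP => u; rewrite -(mem_vecof eb) => /memv_imgP[v vL].
rewrite -(rVofK eb v) (hom_vecof e eb) => /(can_inj (vecofK eb)) ->.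
by rewrite submxMr // (submx_trans _ LX) // -(mem_vecof eb) rVofK // vbasisP.
Qed.

Lemma ms_basis L n : \dim L = n -> exists2 E : 'M[F]_(n, N), row_free E & (E <= Ms L)%MS.
Proof.
move=> <-; pose E := \matrix_(i < \dim L) rv (vbasis L)`_i.
have vE (v : 'rV_(\dim L)) : vec (v *m E) = \sum_i v 0 i *: (vbasis L)`_i.
  rewrite mulmx_sum_row linear_sum; apply: eq_bigr => i _.
  by rewrite linearZ /= rowK rVofK // vbasisP.
exists E.
  rewrite -kermx_eq0; apply/rowV0P=> v /sub_kermxP vE0; apply/rowP => i.
  have /freeP fr := basis_free (vbasisP L).
  by rewrite [RHS]mxE; apply: (fr (fun i => v 0 i)); rewrite -vE vE0 linear0.
apply/rV_subP => _ /submxP[v ->]; rewrite -(mem_vecof eb) vE memv_suml // => i _.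
by rewrite memvZ // vbasis_mem // mem_nth // size_tuple.
Qed.

Lemma ms_coef n L (X Y : 'M[F]_(n, N)) : (Ms L <= X)%MS -> (Y <= Ms L)%MS ->
  exists K, Y = K *m X.
Proof. by move=> LX YL; apply/submxP/(submx_trans YL). Qed.

Lemma lagrangian_dim n L : N = (n + n)%N -> lagrangian om L -> \dim L = n.
Proof. by move=> dV [_]; rewrite dV addnn => /double_inj. Qed.

(** In the basis [E] of [a], and in the basis [P - E] of [b], [f] is block diagonal
    with blocks [g0] and [K1]. It maps the graph with form [P] to the one with form
    [g P g^T], [g] being the inverse of [g0], and as [f] is symplectic the form [P]
    conjugates the transpose of [K1] to [g]. *)
Lemma fixed_pair_config n (f : 'End(V)) (a b p : {vspace V}) (E P : 'M[F]_(n, N)) :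
  N = (n + n)%N -> in_Sp om f -> lagrangian om a -> lagrangian om b -> lagrangian om p ->
  (f @: a)%VS = a -> (f @: b)%VS = b -> row_free E -> (E <= Ms a)%MS ->
  graph_mx E b p P -> posdef (graph_form E P) ->
  exists g K1 g0 : 'M[F]_n,
  [/\ (P - E) *m J *m (P - E)^T = 0, E *m J *m E^T = 0,
      (P - E) *m J *m E^T \in unitmx,
      (P - E) *m Mx f = K1 *m (P - E) & E *m Mx f = g0 *m E] /\
  graph_form E P *m K1^T = g *m graph_form E P /\
  exists2 G, graph_mx E b (f @: p) G &
    graph_form E G = g *m graph_form E P *m g^T.
Proof.
move=> dV fS aL bL pL fa fb Ef Ea Pg Pp; have Eg := graph_base b Ea.
pose gf := graph_form E; have gfE : gf E = 0 := graph_form_base aL Ea.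
have Pu : gf P \in unitmx := posdef_unit Pp; have PEb := Pg.2.
have EP : E *m J *m (P - E)^T = gf P.
  by rewrite linearB /= mulmxBr (isotropicP aL Ea Ea) subr0.
have [g0 Eg0] : exists K, E *m Mx f = K *m E.
  apply: (@ms_coef _ a); last by rewrite -fa ms_image ?Ea.
  exact: ms_span (lagrangian_dim dV aL) Ef Ea.
have AEP : (P - E) *m J *m E^T = - gf P.
  have := gram_graph aL bL Ea pL Pg Eg; rewrite -/(gf E) gfE sub0r => <-.
  by rewrite !mulmxBl (isotropicP aL Ea Ea) subr0.
have [K1 AK] : exists K, (P - E) *m Mx f = K *m (P - E).
  apply: (@ms_coef _ b); last by rewrite -fb ms_image ?Pg.2.
  apply: (ms_span (lagrangian_dim dV bL)) => //; apply: (@free_of_gram _ _ E^T).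
  by rewrite AEP -scaleN1r unitmxZ ?unitrN1.
have gK : g0 *m gf P *m K1^T = gf P.
  rewrite -EP -{2}(in_Sp_mx fS) !mulmxA Eg0 -[in RHS]mulmxA.
  by rewrite -[in RHS]trmx_mul AK trmx_mul !mulmxA.
have /mulmx1_unit[g0u _] : g0 *m (gf P *m K1^T *m invmx (gf P)) = 1%:M.
  by move: (gf P) Pu gK => X Xu gK; rewrite !mulmxA gK mulmxV.
pose G := invmx g0 *m (P *m Mx f).
have Gg : graph_mx E b (f @: p) G.
  split; first by rewrite (submx_trans (submxMl _ _)) // ms_image ?Pg.1.
  have -> : G - E = invmx g0 *m ((P - E) *m Mx f).
    by rewrite mulmxBl mulmxBr Eg0 mulKmx.
  by rewrite (submx_trans (submxMl _ _)) // -fb ms_image ?Pg.2.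
have gG : gf G = invmx g0 *m gf P *m (invmx g0)^T.
  rewrite /gf /graph_form -{1}(mulKmx g0u E) -Eg0 trmx_mul trmx_mul.
  by rewrite -{2}(in_Sp_mx fS) !mulmxA.
exists (invmx g0), K1, g0; split.
  split=> //; first exact: (isotropicP bL PEb PEb).
  by rewrite AEP -scaleN1r unitmxZ ?unitrN1.
split; last by exists G.
by rewrite -/(gf P); move: (gf P) gK => X gK; rewrite -[in RHS]gK !mulmxA mulVmx // mul1mx.
Qed.

(** The form of [p] increases when [f] is applied, that is [g P g^T - P] is positive
    definite, which forces all eigenvalues of [g] to be expanding. *)
Lemma expanding_spectrum n (f : 'End(V)) (a b p : {vspace V}) :
  N = (n + n)%N -> in_Sp om f -> lagrangian om a -> lagrangian om b ->
  lagrangian om p -> lagrangian om (f @: p) ->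
  (f @: a)%VS = a -> (f @: b)%VS = b ->
  maximal_triple om a p b -> maximal_triple om p (f @: p) b ->
  (forall z, z \in eigenvalues f -> Normc.normc z <> 1) /\
  size (expanding_eigenvalues f) = n.
Proof.
move=> dV fS aL bL pL fpL fa fb apb pfb.
have [tap tpb tab _] := apb.
have [E Ef Ea] := ms_basis (lagrangian_dim dV aL).
have dpb : (\dim p + \dim b = N)%N by rewrite (lagrangian_dim dV pL) (lagrangian_dim dV bL) dV.
have [P Pg] := graph_mx_ex E tpb dpb.
have Pp : posdef (graph_form E P).
  rewrite -[graph_form E P]subr0 -(graph_form_base aL Ea).
  exact: (maximal_graph aL bL Ea Ef aL pL (graph_base b Ea) Pg).
have [g [K1 [g0 [[AA BB AB fA fB] [PK [G Gg gG]]]]]] :=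
  fixed_pair_config dV fS aL bL pL fa fb Ef Ea Pg Pp.
have gPp : posdef (g *m graph_form E P *m g^T - graph_form E P).
  by rewrite -gG; apply: (maximal_graph aL bL Ea Ef pL fpL Pg Gg).
have K1e z : z \in croots K1 -> 1 < Normc.normc z.
  rewrite (croots_char_poly (B := g)); first by move=> /(posdef_expanding Pp gPp)[u [v []]].
  rewrite -char_poly_tr; apply: (@char_poly_conj _ _ _ (graph_form E P)) => //.
  by rewrite row_free_unit posdef_unit.
split=> [z|]; first exact: (spectrum_noncentral dV fS AA BB AB fA fB K1e).
exact: (size_expanding dV fS AA BB AB fA fB K1e).
Qed.

Section Collar.
Variables (n : nat) (n0 : (0 < n)%N) (dV : N = (n + n)%N).
Variables (a b p q : {vspace V}) (f h : 'End(V)).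
Hypotheses (aL : lagrangian om a) (bL : lagrangian om b).
Hypotheses (pL : lagrangian om p) (qL : lagrangian om q).
Hypotheses (hbL : lagrangian om (h @: b)) (fpL : lagrangian om (f @: p)).
Hypotheses (fS : in_Sp om f) (hS : in_Sp om h).
Hypotheses (fa : (f @: a)%VS = a) (fb : (f @: b)%VS = b).
Hypotheses (hp : (h @: p)%VS = p) (hq : (h @: q)%VS = q).
Hypotheses (apb : maximal_triple om a p b) (qab : maximal_triple om q a b).
Hypothesis (phb : maximal_triple om p (h @: b) b).
Hypothesis (hbfp : (h @: b)%VS = (f @: p)%VS \/ maximal_triple om (h @: b) (f @: p) b).

Let dLL L L' : lagrangian om L -> lagrangian om L' -> (\dim L + \dim L' = N)%N.
Proof. by move=> /(lagrangian_dim dV) -> /(lagrangian_dim dV) ->. Qed.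

(** The matrices of the collar inequalities, read off in a basis of [a]. The key
    relation, between [Y] and the matrix [k] of [h] on [p], comes from [b] being
    spanned by [P - Q] for the graphs [P] and [Q] of [p] and [q]: the basis [Y] of
    [h b] is then [L *m (k *m P - k2 *m Q)] for some [L]. *)
Lemma collar_config : exists P Q Y g k, exists A1 A2 B1 B2 : 'M[F]_(n, N),
  exists K1 K2 k2 : 'M[F]_n,
  [/\ posdef P, posdef Q, posdef (Y - P),
    (Y - P) *m (k^T *m invmx (P + Q) *m k - invmx (P + Q)) = 1%:M
    & psd (g *m P *m g^T - Y)] /\
  [/\ A1 *m J *m A1^T = 0, A2 *m J *m A2^T = 0, A1 *m J *m A2^T \in unitmx,
     A1 *m Mx f = K1 *m A1 & A2 *m Mx f = K2 *m A2] /\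
  [/\ B1 *m J *m B1^T = 0, B2 *m J *m B2^T = 0, B1 *m J *m B2^T \in unitmx,
     B1 *m Mx h = k *m B1 & B2 *m Mx h = k2 *m B2] /\
  P *m K1^T = g *m P.
Proof.
have [tap tpb tab _] := apb; have [tqa _ tqb _] := qab.
have [_ thb _ _] := phb.
have [E Ef Ea] := ms_basis (lagrangian_dim dV aL).
have [P Pg] := graph_mx_ex E tpb (dLL pL bL).
have [Q Qg] := graph_mx_ex E tqb (dLL qL bL).
have [Y Yg] := graph_mx_ex E thb (dLL hbL bL).
have Eg := graph_base b Ea.
pose gf := graph_form E; have gfE : gf E = 0 := graph_form_base aL Ea.
have Pp : posdef (gf P).
  by rewrite -[gf P]subr0 -gfE; apply: (maximal_graph aL bL Ea Ef aL pL Eg Pg).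
have Qp : posdef (- gf Q).
  by rewrite -[- _]add0r -gfE; apply: (maximal_graph aL bL Ea Ef qL aL Qg Eg).
have YPp : posdef (gf Y - gf P).
  exact: (maximal_graph aL bL Ea Ef pL hbL Pg Yg).
have Pu := posdef_unit Pp.
pose D := gf P + - gf Q; have Dp : posdef D by apply: posdefD.
have Du := posdef_unit Dp.
have PQ : P *m J *m Q^T = - D by rewrite (gram_graph aL bL Ea pL Pg Qg) /D opprB.
have PP := isotropicP pL Pg.1 Pg.1; have QQ := isotropicP qL Qg.1 Qg.1.
have [k1 Pk] : exists K, P *m Mx h = K *m P.
  apply: (@ms_coef _ p); last by rewrite -hp ms_image ?Pg.1.
  exact: ms_span (lagrangian_dim dV pL) (graph_free Ea Ef tab Pg) Pg.1.
have [k2 Qk] : exists K, Q *m Mx h = K *m Q.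
  apply: (@ms_coef _ q); last by rewrite -hq ms_image ?Qg.1.
  exact: ms_span (lagrangian_dim dV qL) (graph_free Ea Ef tab Qg) Qg.1.
have PQb : (P - Q <= Ms b)%MS.
  have -> : P - Q = (P - E) + (- (Q - E)) by rewrite opprB addrA subrK.
  by rewrite addmx_sub ?eqmx_opp ?Pg.2 ?Qg.2.
have [L YL] : exists L, Y = L *m ((P - Q) *m Mx h).
  apply: (@ms_coef _ (h @: b)); last exact: Yg.1.
  apply/ms_image_sub/(ms_span (lagrangian_dim dV bL)) => //.
  apply: (@free_of_gram _ _ Q^T); rewrite !mulmxBl PQ QQ subr0.
  by rewrite -scaleN1r unitmxZ ?unitrN1.
have PEb := Pg.2.
have EP : E *m J *m (P - E)^T = gf P.
  by rewrite linearB /= mulmxBr (isotropicP aL Ea Ea) subr0.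
have gP z Z : graph_mx E b z Z -> Z *m (J *m (P - E)^T) = gf P.
  move=> [_ Zb]; rewrite -[Z](subrK E) mulmxDl !mulmxA (isotropicP bL Zb PEb) add0r.
  exact: EP.
have YE : Y = L *m (k1 *m P - k2 *m Q) by rewrite YL mulmxBl Pk Qk.
have Lk : L *m (k1 - k2) = 1%:M.
  have := gP _ _ Yg; have := gP _ _ Pg; have := gP _ _ Qg.
  move: (J *m _) => T QT PT; rewrite YE -mulmxA mulmxBl -!mulmxA PT QT -mulmxBl mulmxA => e.
  by rewrite -[LHS](mulmxK Pu) e mulmxV.
have kDk : k1 *m D *m k2^T = D.
  apply: oppr_inj; rewrite -mulNmx -mulmxN -PQ -{2}(in_Sp_mx hS) !mulmxA Pk.
  by rewrite -[in RHS]mulmxA -trmx_mul Qk trmx_mul !mulmxA.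
have kDk' : k2 *m D *m k1^T = D.
  by have := congr1 trmx kDk; rewrite !trmx_mul trmxK Dp.1 mulmxA.
have YP : gf Y - gf P = L *m k2 *m D.
  have QP := gram_graph aL bL Ea qL Qg Pg.
  have := gram_graph aL bL Ea hbL Yg Pg; rewrite -!(mulmxA _ J).
  rewrite -!(mulmxA _ J) in PP QP; move: (J *m P^T) PP QP => T PT QT.
  rewrite YE -mulmxA mulmxBl -!mulmxA PT QT mulmx0 sub0r mulmxN => e.
  by rewrite -opprB -e opprK mulmxA.
have [g [K1 [g0 [spf [PK [G Gg gG]]]]]] :=
  fixed_pair_config dV fS aL bL pL fa fb Ef Ea Pg Pp.
exists (gf P), (- gf Q), (gf Y), g, k1, (P - E), E, P, Q, K1, g0, k2.
split; [split=> // | split; [by [] | split; first split => //]] => //.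
- rewrite YP mulmxBr -[k1^T *m _ *m _]mulmxA !mulmxA -(mulmxA L) -(mulmxA L) kDk'.
  by rewrite -!(mulmxA L) -/D !mulmxA !(mulmxK Du) -mulmxBr.
- rewrite -gG; case: hbfp => [hf|mx].
    rewrite -hf in Gg; have := gram_graph aL bL Ea hbL Yg Gg.
    rewrite (isotropicP hbL Yg.1 Gg.1) => <-; split; first by rewrite trmx0.
    by move=> v; rewrite /qf /bf mulmx0 mul0mx mxE.
  exact/posdef_psd/(maximal_graph aL bL Ea Ef hbL fpL Yg Gg).
- by rewrite PQ -scaleN1r unitmxZ ?unitrN1.
Qed.

Lemma collar_symplectic
    (lamf := fun i => Normc.normc (expanding_eigenvalues f)`_i)
    (lamh := fun i => Normc.normc (expanding_eigenvalues h)`_i) :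
  1 / (lamh n.-1 ^+ 2 - 1) <= lamf 0%N ^+ (2 * n) /\
  1 <= (\prod_(i < n) pos_root n (lamf i ^+ 2) - 1)
       * (\prod_(i < n) pos_root n (lamh i ^+ 2) - 1).
Proof.
have [P [Q [Y [g [k [A1 [A2 [B1 [B2 [K1 [K2 [k2]]]]]]]]]]]] := collar_config.
move=> [[Pp Qp YPp YM gY]] [[AA1 AA2 AA fA1 fA2]] [[BB1 BB2 BB hB1 hB2]] PK.
have Pu := posdef_unit Pp.
have K1g : char_poly K1 = char_poly g.
  rewrite -char_poly_tr; apply: (@char_poly_conj _ _ _ P) => //.
  by rewrite row_free_unit.
have dK1 : \det K1 ^+ 2 = \det g ^+ 2.
  have := congr1 determinant PK; rewrite !det_mulmx det_tr mulrC => /mulIf -> //.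
  by rewrite -unitfE -unitmxE.
have K1e z : z \in croots K1 -> 1 < Normc.normc z.
  by rewrite (croots_char_poly K1g); apply: (collar_expanding_g Pp YPp gY).
have ke z : z \in croots k -> 1 < Normc.normc z.
  exact: (collar_expanding_k Pp Qp YPp YM).
have [r0 rn] := expanding_pos_root dV fS AA1 AA2 AA fA1 fA2 K1e n0.
have [s0 sn] := expanding_pos_root dV hS BB1 BB2 BB hB1 hB2 ke n0.
rewrite dK1 in rn; split; last exact: (collar_det n0 Pp Qp YPp YM gY r0 s0 rn sn).
rewrite div1r; apply: le_trans (expanding_head dV fS AA1 AA2 AA fA1 fA2 K1e n0).
rewrite dK1; apply: (collar_eigen Pp Qp YPp YM gY).
exact: (expanding_last dV hS BB1 BB2 BB hB1 hB2 ke n0).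
Qed.

End Collar.

Lemma gram_unit : is_psymplectic om -> J \in unitmx.
Proof.
move=> [nd _ _]; rewrite -row_free_unit -kermx_eq0; apply/rowV0P=> v /sub_kermxP vJ.
have : vec v \in orthov om {:V}.
  apply/mem_orthovP => w _; rewrite -(rVofK eb w) om_vec vJ mul0mx mxE //.
by rewrite (eqP nd) memv0 (vecof_eq0 eb) => /eqP.
Qed.

Lemma eigenvalues_inverse (f f' : 'End(V)) : J \in unitmx -> in_Sp om f -> (f \o f')%VF = \1%VF ->
  eigenvalues f' = eigenvalues f.
Proof.
move=> Ju fS ff'; rewrite !eigenvaluesE; apply: croots_char_poly.
have MM : Mx f' *m Mx f = 1%:M by rewrite -mx_comp ff' mxof1 // (basis_free eb).
rewrite -(char_poly_tr (Mx f)); apply/esym/(char_poly_conj (S := J)) => //.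
  by rewrite row_free_unit.
by rewrite -{2}(in_Sp_mx fS) !mulmxA MM mul1mx.
Qed.

Lemma eigenvalues_conj (f c c' : 'End(V)) : (c \o c')%VF = \1%VF ->
  eigenvalues (c \o (f \o c'))%VF = eigenvalues f.
Proof.
move=> cc'; rewrite !eigenvaluesE; apply: croots_char_poly.
have MM : Mx c' *m Mx c = 1%:M by rewrite -mx_comp cc' mxof1 // (basis_free eb).
apply/esym/(char_poly_conj (S := Mx c')) => //.
  by rewrite row_free_unit; case: (mulmx1_unit MM).
by rewrite !mx_comp -[RHS]mulmxA (mulmx1C MM) mulmx1.
Qed.

End SymplecticMatrices.

(** * Two by two matrices and the boundary circle *)

Section TwoByTwo.
Variable R : realType.
Implicit Types (A B M : 'M[R]_2) (u v w : R * R).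

Definition mx2 (a b c d : R) : 'M[R]_2 :=
  \matrix_(i, j) if i == 0 then (if j == 0 then a else b)
                 else (if j == 0 then c else d).

Lemma mx2_00 a b c d : mx2 a b c d 0 0 = a. Proof. by rewrite mxE. Qed.
Lemma mx2_01 a b c d : mx2 a b c d 0 1 = b. Proof. by rewrite mxE. Qed.
Lemma mx2_10 a b c d : mx2 a b c d 1 0 = c. Proof. by rewrite mxE. Qed.
Lemma mx2_11 a b c d : mx2 a b c d 1 1 = d. Proof. by rewrite mxE. Qed.
Definition mx2_entry := (mx2_00, mx2_01, mx2_10, mx2_11).

Lemma ord2P (P : 'I_2 -> Prop) : P 0 -> P 1 -> forall i, P i.
Proof.
move=> P0 P1; case=> [[|[|//]] i]; [rewrite (_ : Ordinal _ = 0) //|rewrite (_ : Ordinal _ = 1) //]; exact: val_inj.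
Qed.

Lemma mx2P A B : A 0 0 = B 0 0 -> A 0 1 = B 0 1 -> A 1 0 = B 1 0 -> A 1 1 = B 1 1 -> A = B.
Proof.
by move=> e1 e2 e3 e4; apply/matrixP; apply: ord2P; apply: ord2P.
Qed.

Lemma mx2E A : A = mx2 (A 0 0) (A 0 1) (A 1 0) (A 1 1).
Proof. by apply: mx2P; rewrite mx2_entry. Qed.

Lemma sum_ord2 (f : 'I_2 -> R) : \sum_i f i = f 0 + f 1.
Proof.
by rewrite big_ord_recl big_ord1; congr (_ + f _); apply: val_inj.
Qed.

Lemma mulmx2E A B i j : (A *m B) i j = A i 0 * B 0 j + A i 1 * B 1 j.
Proof. by rewrite mxE sum_ord2. Qed.

Lemma mx2M a b c d a' b' c' d' : mx2 a b c d *m mx2 a' b' c' d' =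
  mx2 (a * a' + b * c') (a * b' + b * d') (c * a' + d * c') (c * b' + d * d').
Proof. by apply: mx2P; rewrite mulmx2E !mx2_entry. Qed.

Lemma tr2E A : \tr A = A 0 0 + A 1 1.
Proof. by rewrite /mxtrace sum_ord2. Qed.

Lemma det2E A : \det A = A 0 0 * A 1 1 - A 0 1 * A 1 0.
Proof.
rewrite (expand_det_row _ ord0) sum_ord2 /cofactor !det_mx11 !mxE /=.
rewrite expr0 expr1 mul1r mulN1r mulrN; congr (_ * _ - _ * _); congr (A _ _); exact: val_inj.
Qed.

Lemma mx2_1 : mx2 1 0 0 1 = 1%:M.
Proof. by apply: mx2P; rewrite mx2_entry !mxE. Qed.

Lemma mx2N a b c d : - mx2 a b c d = mx2 (- a) (- b) (- c) (- d).
Proof. by apply: mx2P; rewrite !mx2_entry mxE mx2_entry. Qed.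

Lemma invmx_uniq A B : A *m B = 1%:M -> B = invmx A.
Proof.
move=> e; have [Au _] := mulmx1_unit e.
by rewrite -[LHS]mul1mx -(mulVmx Au) -mulmxA e mulmx1.
Qed.

Lemma invmx2 A : \det A = 1 -> invmx A = mx2 (A 1 1) (- A 0 1) (- A 1 0) (A 0 0).
Proof.
rewrite det2E => dA; apply/esym/invmx_uniq; rewrite {1}(mx2E A) mx2M -mx2_1.
by apply: mx2P; rewrite !mx2_entry -?dA; ring.
Qed.

Definition act A v : R * R := (A 0 0 * v.1 + A 0 1 * v.2, A 1 0 * v.1 + A 1 1 * v.2).
Definition br u v : R := u.1 * v.2 - u.2 * v.1.

(** Boundary points are treated as nonzero vectors up to a factor, which removes
    the case distinctions about infinity. *)
Definition bdpt v : boundary R := if v.2 == 0 then None else Some (v.1 / v.2).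

Lemma actM A B v : act (A *m B) v = act A (act B v).
Proof. by rewrite /act !mulmx2E /=; congr pair; ring. Qed.

Lemma act1 v : act 1%:M v = v.
Proof. by case: v => a b; rewrite /act !mxE /=; congr pair; ring. Qed.

Lemma br_act A u v : br (act A u) (act A v) = \det A * br u v.
Proof. by rewrite /br /act det2E /=; ring. Qed.

Lemma act_neq0 A v : \det A = 1 -> v != (0, 0) -> act A v != (0, 0).
Proof.
move=> dA; apply: contra => /eqP e.
have : act (invmx A) (act A v) = v by rewrite -actM mulVmx ?act1 // unitmxE dA unitr1.
by rewrite e /act /= !mulr0 addr0 => <-.
Qed.

Lemma bdptZ s v : s != 0 -> bdpt (s * v.1, s * v.2) = bdpt v.
Proof.
move=> s0; rewrite /bdpt /= mulf_eq0 (negPf s0) /=; case: eqP => // /eqP v0.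
by rewrite -mulf_div divff // mul1r.
Qed.

Lemma mobius_bd_act A v : v != (0, 0) -> mobius_bd A (bdpt v) = bdpt (act A v).
Proof.
case: v => x y; rewrite xpair_eqE negb_and /bdpt /act /=.
have [->|y0] := eqVneq y 0; rewrite ?orbF.
  move=> x0; rewrite /= !mulr0 !addr0 mulf_eq0 (negPf x0) orbF.
  by case: eqP => // /eqP c0; rewrite -mulf_div divff // mulr1.
move=> _ /=.
have -> : A 1 0 * (x / y) + A 1 1 = (A 1 0 * x + A 1 1 * y) / y by field.
have -> : A 0 0 * (x / y) + A 0 1 = (A 0 0 * x + A 0 1 * y) / y by field.
rewrite mulf_eq0 invr_eq0 (negPf y0) orbF; case: eqP => // /eqP c0.
by congr Some; field; rewrite y0 c0.
Qed.

Lemma oriented_br u v w : u != (0, 0) -> v != (0, 0) -> w != (0, 0) ->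
  0 < br u v * br v w * br w u ->
  positively_oriented (bdpt u) (bdpt v) (bdpt w).
Proof.
have dec x : x != (0, 0) -> (exists s l, [/\ l != 0, x = (s * l, l) & bdpt x = Some s]) \/
    (exists l, [/\ l != 0, x = (l, 0) & bdpt x = None]).
  case: x => a b x0; have [b0|b0] := eqVneq b 0.
    right; exists a; rewrite b0 /bdpt /= eqxx; split=> //.
    by move: x0; rewrite b0 xpair_eqE eqxx andbT.
  by left; exists (a / b), b; rewrite /bdpt /= (negPf b0); split=> //; rewrite divfK.
have pos x y z : 0 < x :> R -> 0 < y :> R -> 0 < z :> R -> 0 < x * y * z.
  by move=> x0 y0 z0; rewrite !mulr_gt0.
have sgn x y z : 0 < x * y * z :> R -> x + y + z = 0 ->
    [|| (x < 0) && (y < 0), (y < 0) && (z < 0) | (z < 0) && (x < 0)].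
  move=> h; case: (ltP x 0) => x0; case: (ltP y 0) => y0; case: (ltP z 0) => z0 //= e; exfalso.
  - by rewrite -mulrA nmulr_rgt0 // ltNge mulr_ge0 in h.
  - by rewrite mulrAC nmulr_lgt0 // ltNge mulr_ge0 in h.
  - by rewrite nmulr_lgt0 // ltNge mulr_ge0 in h.
  - have xx : x = 0 by lra.
    by rewrite xx !mul0r ltxx in h.
have sq l : l != 0 :> R -> 0 < l ^+ 2 by move=> l0; rewrite exprn_even_gt0.
move=> /dec[[s [l [/sq l0 -> ->]]]|[l [/sq l0 -> ->]]]
  /dec[[t [m [/sq m0 -> ->]]]|[m [/sq m0 -> ->]]]
  /dec[[r [k [/sq k0 -> ->]]]|[k [/sq k0 -> ->]]]; rewrite /br /positively_oriented /=.
- rewrite (_ : _ * _ * _ = (l ^+ 2 * m ^+ 2 * k ^+ 2) * ((s - t) * (t - r) * (r - s))); last by ring.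
  rewrite pmulr_rgt0; last exact: pos.
  by move=> /sgn; rewrite !subr_lt0; apply; ring.
- rewrite (_ : _ * _ * _ = (l ^+ 2 * m ^+ 2 * k ^+ 2) * (t - s)); last by ring.
  by rewrite pmulr_rgt0 ?subr_gt0 => [->|]; last exact: pos.
- rewrite (_ : _ * _ * _ = (l ^+ 2 * m ^+ 2 * k ^+ 2) * (s - r)); last by ring.
  by rewrite pmulr_rgt0 ?subr_gt0 => [->|]; rewrite ?orbT //; exact: pos.
- by rewrite !(mul0r, mulr0, subrr) ltxx.
- rewrite (_ : _ * _ * _ = (l ^+ 2 * m ^+ 2 * k ^+ 2) * (r - t)); last by ring.
  by rewrite pmulr_rgt0 ?subr_gt0 => [->|]; rewrite ?orbT //; exact: pos.
- by rewrite !(mul0r, mulr0, subrr) ltxx.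
- by rewrite !(mul0r, mulr0, subrr) ltxx.
- by rewrite !(mul0r, mulr0, subrr) ltxx.
Qed.

End TwoByTwo.

(** * Maximal framings *)

Section Framings.
Variables (R : realType) (F : rcfType) (V : vectType F) (om : {skew_symmetric V}).
Implicit Types (G : set 'M[R]_2) (rho : 'M[R]_2 -> 'End(V)).
Implicit Types (S : R * R -> Prop) (Phi : R * R -> {vspace V}).

(** A maximal framing in homogeneous coordinates. There fixed points are
    eigenvectors, and orientation is the sign of a product of determinants. *)
Record vframing G rho S Phi : Prop := VFraming {
  vf_stable : forall A v, G A -> v != (0, 0) -> S v -> S (act A v);
  vf_fixed : forall A v l, G A -> hyperbolic A -> v != (0, 0) ->
    act A v = (l * v.1, l * v.2) -> S v;
  vf_lagrangian : forall v, v != (0, 0) -> S v -> lagrangian om (Phi v);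
  vf_equivariant : forall A v, G A -> v != (0, 0) -> S v ->
    Phi (act A v) = (rho A @: Phi v)%VS;
  vf_scale : forall s v, s != 0 -> Phi (s * v.1, s * v.2) = Phi v;
  vf_maximal : forall u v w, u != (0, 0) -> v != (0, 0) -> w != (0, 0) ->
    S u -> S v -> S w -> 0 < br u v * br v w * br w u ->
    maximal_triple om (Phi u) (Phi v) (Phi w) }.

Lemma vframing_of G rho T phi : PSL2_subgroup G -> maximal_framing om G rho T phi ->
  vframing G rho (fun v => T (bdpt v)) (fun v => phi (bdpt v)).
Proof.
move=> [_ dG _ _ _] [st fx lg eq mx]; split.
- by move=> A v GA v0 Sv; rewrite -mobius_bd_act //; apply: st.
- move=> A v l GA hA v0 Av; apply: (fx A) => //.
  have l0 : l != 0.
    have := act_neq0 (dG _ GA) v0; rewrite Av; apply: contra => /eqP ->.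
    by rewrite !mul0r.
  by rewrite mobius_bd_act // Av bdptZ.
- by move=> v v0 Sv; apply: lg.
- by move=> A v GA v0 Sv; rewrite -mobius_bd_act // eq.
- by move=> s v s0; rewrite bdptZ.
- by move=> u v w u0 v0 w0 Su Sv Sw h; apply: mx => //; apply: oriented_br.
Qed.

Definition conjG (M : 'M[R]_2) G : set 'M[R]_2 := [set X | G (M *m X *m invmx M)].
Definition conj_rep (M : 'M[R]_2) rho X := rho (M *m X *m invmx M).

Lemma conjmxM (M X Y : 'M[R]_2) : M \in unitmx ->
  M *m (X *m Y) *m invmx M = (M *m X *m invmx M) *m (M *m Y *m invmx M).
Proof. by move=> Mu; rewrite !mulmxA mulmxKV. Qed.

Lemma hyperbolic_conj (M X : 'M[R]_2) : M \in unitmx ->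
  hyperbolic (M *m X *m invmx M) = hyperbolic X.
Proof. by move=> Mu; rewrite /hyperbolic mxtrace_mulC mulmxA mulVmx // mul1mx. Qed.

Lemma vframing_conj G rho S Phi M : \det M = 1 -> vframing G rho S Phi ->
  vframing (conjG M G) (conj_rep M rho) (fun v => S (act M v)) (fun v => Phi (act M v)).
Proof.
move=> dM [st fx lg eq sc mx]; have Mu : M \in unitmx by rewrite unitmxE dM unitr1.
have aM A v : act M (act A v) = act (M *m A *m invmx M) (act M v).
  by rewrite -!actM mulmxKV.
have M0 v : v != (0, 0) -> act M v != (0, 0) by apply: act_neq0.
have Ms s v : act M (s * v.1, s * v.2) = (s * (act M v).1, s * (act M v).2).
  by rewrite /act /=; congr pair; ring.
split.
- by move=> A v GA v0 Sv; rewrite aM; apply: st => //; apply: M0.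
- move=> A v l GA hA v0 Av; apply: (fx (M *m A *m invmx M) _ l) => //.
  + by rewrite hyperbolic_conj.
  + exact: M0.
  + by rewrite -aM Av Ms.
- by move=> v v0 Sv; apply: lg => //; apply: M0.
- by move=> A v GA v0 Sv; rewrite aM eq //; apply: M0.
- by move=> s v s0; rewrite Ms sc.
- move=> u v w u0 v0 w0 Su Sv Sw h; apply: mx => //; try exact: M0.
  by rewrite !br_act dM !mul1r.
Qed.

Lemma PSL2_conj G M : \det M = 1 -> PSL2_subgroup G -> PSL2_subgroup (conjG M G).
Proof.
move=> dM [G1 dG GM GV GN]; have Mu : M \in unitmx by rewrite unitmxE dM unitr1.
split; rewrite /conjG /=.
- by rewrite mulmx1 mulmxV.
- by move=> A /dG; rewrite !det_mulmx det_inv dM invr1 mul1r mulr1.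
- by move=> A B GA GB; rewrite conjmxM //; apply: GM.
- move=> A GA; have dA : A \in unitmx.
    have := dG _ GA; rewrite !det_mulmx det_inv dM invr1 mul1r mulr1 => e.
    by rewrite unitmxE e unitr1.
  rewrite (_ : _ *m _ = invmx (M *m A *m invmx M)); first exact: GV.
  by apply: invmx_uniq; rewrite -conjmxM // mulmxV // mulmx1 mulmxV.
- by move=> A GA; rewrite mulmxN mulNmx; apply: GN.
Qed.

Lemma rep_conj G rho M : \det M = 1 -> symplectic_representation om G rho ->
  symplectic_representation om (conjG M G) (conj_rep M rho).
Proof.
move=> dM [sp mul opp]; have Mu : M \in unitmx by rewrite unitmxE dM unitr1.
split; rewrite /conj_rep.
- by move=> A GA; apply: sp.
- by move=> A B GA GB; rewrite conjmxM // mul.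
- by move=> A GA; rewrite mulmxN mulNmx opp.
Qed.

End Framings.

(** * Normalized pairs of hyperbolic elements *)

(** With [m > m'] the eigenvalues of the matrix of rows [(al, be)] and [(c, de)],
    [(m - de) / c] is its attracting fixed point and [al / c] the image of infinity.
    The conclusion compares the latter with the image of the former under
    multiplication by [k ^+ 2]. *)
Lemma attracting_bound (R : realType) (al be c de m m' k : R) :
  al * de - be * c = 1 -> m * m' = 1 -> m + m' = al + de ->
  1 < k -> 0 < m - de -> m' - de < 0 ->
  k ^+ 2 <= (k ^+ 2 - 1) * (al ^+ 2 + k ^+ 2 * (be * c)) ->
  al <= k ^+ 2 * (m - de).
Proof.
move=> dX mm mD k1 p0 q0 cond; rewrite leNgt; apply/negP => h.
have k2 : 0 < k ^+ 2 by rewrite exprn_gt0 //; lra.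
have h1 : 0 < al - k ^+ 2 * (m - de) by lra.
have kp := mulr_gt0 k2 p0; have al0 : 0 < al by lra.
have h2 : 0 < al - k ^+ 2 * (m' - de).
  have : k ^+ 2 * (m' - de) < 0 by rewrite pmulr_rlt0.
  by lra.
(* The product is symmetric in [m] and [m'], hence a polynomial in the entries,
   and [cond] says that it is not positive. *)
have := mulr_gt0 h1 h2.
rewrite (_ : (al - _) * _ = al ^+ 2 - k ^+ 2 * al * (m + m' - 2 * de)
   + k ^+ 4 * (m * m' - de * (m + m') + de ^+ 2)); last by ring.
rewrite mm mD (_ : _ + _ = k ^+ 2 * (al * de) - (k ^+ 2 - 1) * al ^+ 2
   + k ^+ 4 * (1 - al * de)); last by ring.
have -> : al * de = 1 + be * c by lra.
rewrite ltNge => /negP; apply; rewrite -subr_ge0.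
move: cond; rewrite -subr_ge0; congr (0 <= _); ring.
Qed.

Section Normalized.
Variables (R : realType) (F : rcfType) (V : vectType F) (om : {skew_symmetric V}).
Variables (n : nat) (n_gt0 : (0 < n)%N) (dimV : \dim {:V} = (n + n)%N).
Hypothesis om_symplectic : is_psymplectic om.
Variables (G : set 'M[R]_2) (rho : 'M[R]_2 -> 'End(V)).
Hypotheses (hG : PSL2_subgroup G) (hrho : symplectic_representation om G rho).

Let G1 : G 1%:M. Proof. by case: hG. Qed.
Let Gdet A : G A -> \det A = 1. Proof. by case: hG => _ + _ _ _; apply. Qed.
Let GM A B : G A -> G B -> G (A *m B). Proof. by case: hG => _ _ + _ _; apply. Qed.
Let GV A : G A -> G (invmx A). Proof. by case: hG => _ _ _ + _; apply. Qed.
Let Gunit A : G A -> A \in unitmx.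
Proof. by move=> /Gdet e; rewrite unitmxE e unitr1. Qed.

(** Being symplectic, the idempotent [rho 1%:M] is invertible. *)
Lemma rep1 : rho 1%:M = \1%VF.
Proof.
case: hrho => sp mul _; have := mul _ _ G1 G1; rewrite mulmx1 => e.
have := in_Sp_mx (sp _ G1); set M := mxof _ _ _ => MJ.
have Ju := gram_unit om_symplectic.
have Mu : M \in unitmx.
  have /mulmx1_unit[] // : M *m (gram om *m M^T *m invmx (gram om)) = 1%:M.
  by rewrite !mulmxA MJ mulmxV.
have MM : M *m M = M by rewrite /M {3}e mx_comp.
have M1 : M = 1%:M by rewrite -[LHS](mulmxK Mu) MM mulmxV.
apply: (can_inj (mxofK (vbasisP {:V}) (vbasisP {:V}))).
by rewrite -/M M1 mxof1 // (basis_free (vbasisP {:V})).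
Qed.

Lemma repV A : G A -> (rho A \o rho (invmx A))%VF = \1%VF.
Proof.
move=> GA; case: hrho => _ mul _.
by rewrite -mul ?mulmxV ?rep1 ?Gunit //; apply: GV.
Qed.

Lemma eigenvalues_repV A : G A -> eigenvalues (rho (invmx A)) = eigenvalues (rho A).
Proof.
move=> GA; apply: (eigenvalues_inverse (om := om)); last exact: repV.
  exact: gram_unit.
by case: hrho => sp _ _; apply: sp.
Qed.

Lemma eigenvalues_rep_conj B C : G B -> G C ->
  eigenvalues (rho (C *m B *m invmx C)) = eigenvalues (rho B).
Proof.
move=> GB GC; case: hrho => _ mul _; have GCV := GV GC.
rewrite -mulmxA (mul _ _ GC (GM GB GCV)) (mul _ _ GB GCV).
exact/eigenvalues_conj/repV.
Qed.

Variables (S : R * R -> Prop) (Phi : R * R -> {vspace V}).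
Hypothesis fr : vframing om G rho S Phi.

Lemma fixed_image A v l : G A -> hyperbolic A -> v != (0, 0) -> l != 0 ->
  act A v = (l * v.1, l * v.2) -> S v /\ (rho A @: Phi v)%VS = Phi v.
Proof.
move=> GA hA v0 l0 Av; have Sv := vf_fixed fr GA hA v0 Av.
by split=> //; rewrite -(vf_equivariant fr GA v0 Sv) Av (vf_scale fr).
Qed.

(** The action moves [v] from the eigenvector [a] towards the eigenvector [b]. *)
Lemma expandingP A a b v la lb : G A -> hyperbolic A -> la != 0 -> lb != 0 ->
  a != (0, 0) -> b != (0, 0) -> v != (0, 0) -> S v ->
  act A a = (la * a.1, la * a.2) -> act A b = (lb * b.1, lb * b.2) ->
  0 < br a v * br v b * br b a ->
  0 < br v (act A v) * br (act A v) b * br b v ->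
  (forall z, z \in eigenvalues (rho A) -> Normc.normc z <> 1) /\
  size (expanding_eigenvalues (rho A)) = n.
Proof.
move=> GA hA la0 lb0 a0 b0 v0 Sv Aa Ab h1 h2.
have [Sa fa] := fixed_image GA hA a0 la0 Aa.
have [Sb fb] := fixed_image GA hA b0 lb0 Ab.
have Av0 : act A v != (0, 0) by apply: act_neq0 => //; apply: Gdet.
have SAv := vf_stable fr GA v0 Sv.
have e := vf_equivariant fr GA v0 Sv.
apply: (@expanding_spectrum _ _ om n (rho A) (Phi a) (Phi b) (Phi v)) => //.
- by case: hrho => sp _ _; apply: sp.
- exact: (vf_lagrangian fr).
- exact: (vf_lagrangian fr).
- exact: (vf_lagrangian fr).
- by rewrite -e; apply: (vf_lagrangian fr).
- exact: (vf_maximal fr).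
- by rewrite -e; apply: (vf_maximal fr).
Qed.

Let e1_neq0 : ((1, 0) : R * R) != (0, 0).
Proof. by rewrite xpair_eqE oner_eq0. Qed.
Let e2_neq0 : ((0, 1) : R * R) != (0, 0).
Proof. by rewrite xpair_eqE oner_eq0 andbF. Qed.

(** On the positive half line [D] moves points from 0 to infinity in the positive
    direction; on the negative half line its inverse moves them from infinity to 0
    in the positive direction. The images of both under [rho] have the same
    eigenvalues. *)
Lemma diag_spectrum k (D := mx2 k 0 0 k^-1) v : 1 < k -> G D ->
  v.1 != 0 -> v.2 != 0 -> S v ->
  (forall z, z \in eigenvalues (rho D) -> Normc.normc z <> 1) /\
  size (expanding_eigenvalues (rho D)) = n.
Proof.
case: v => x y k1 GD /= x0 y0 Sv; have k0 : 0 < k by lra.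
have kn0 : k != 0 by rewrite gt_eqF.
have kV : 0 < k^-1 by rewrite invr_gt0.
have kk : k * k^-1 = 1 by rewrite divff.
have kV1 : k^-1 < 1 by rewrite invf_lt1.
have dk : 0 < k - k^-1 by lra.
have hD : hyperbolic D.
  by rewrite /hyperbolic tr2E !mx2_entry ger0_norm; nra.
have Dinv : invmx D = mx2 k^-1 0 0 k.
  by rewrite (invmx2 (Gdet GD)) /D !mx2_entry !oppr0.
have hDV : hyperbolic (invmx D).
  by rewrite Dinv /hyperbolic tr2E !mx2_entry ger0_norm; nra.
have v0 : (x, y) != (0, 0) by rewrite xpair_eqE negb_and x0.
have x2 : 0 < x * x by rewrite -expr2 exprn_even_gt0.
have y2 : 0 < y * y by rewrite -expr2 exprn_even_gt0.
have [xy|xy] := ltP 0 (x * y).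
  apply: (@expandingP D (0, 1) (1, 0) (x, y) k^-1 k) => //; rewrite ?gt_eqF //.
  - by rewrite /act /D !mx2_entry /=; congr pair; ring.
  - by rewrite /act /D !mx2_entry /=; congr pair; ring.
  - by rewrite /br /=; lra.
  - rewrite /br /act /D !mx2_entry /= (_ : _ * _ = (x * y) * (y * y) * (k - k^-1) * k^-1); last by ring.
    exact: (mulr_gt0 (mulr_gt0 (mulr_gt0 xy y2) dk) kV).
have xy' : 0 < - (x * y).
  by rewrite oppr_gt0 lt_neqAle xy mulf_neq0.
have [] := @expandingP (invmx D) (1, 0) (0, 1) (x, y) k^-1 k (GV GD) hDV.
- by rewrite gt_eqF.
- by rewrite gt_eqF.
- by [].
- by [].
- by [].
- by [].
- by rewrite /act Dinv !mx2_entry /=; congr pair; ring.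
- by rewrite /act Dinv !mx2_entry /=; congr pair; ring.
- by rewrite /br /=; lra.
- rewrite /br /act Dinv !mx2_entry /= (_ : _ * _ = (- (x * y)) * (x * x) * (k - k^-1) * k^-1); last by ring.
  exact: (mulr_gt0 (mulr_gt0 (mulr_gt0 xy' x2) dk) kV).
by rewrite /expanding_eigenvalues eigenvalues_repV.
Qed.

(** The Lagrangians at 0, at infinity and at the fixed points [w] and [w'] of [X]
    form the configuration of [collar_symplectic]. The last hypothesis places
    the image of infinity under [X] between [w] and its image under [D]. *)
Lemma diag_collar k (D := mx2 k 0 0 k^-1) X : 1 < k -> G D -> G X ->
  2 < \tr X -> 0 < X 0 1 -> 0 < X 1 0 ->
  k ^+ 2 <= (k ^+ 2 - 1) * (X 0 0 ^+ 2 + k ^+ 2 * (X 0 1 * X 1 0)) ->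
  let lamf i := Normc.normc (expanding_eigenvalues (rho D))`_i in
  let lamh i := Normc.normc (expanding_eigenvalues (rho X))`_i in
  1 / (lamh n.-1 ^+ 2 - 1) <= lamf 0%N ^+ (2 * n) /\
  1 <= (\prod_(i < n) pos_root n (lamf i ^+ 2) - 1)
       * (\prod_(i < n) pos_root n (lamh i ^+ 2) - 1).
Proof.
move=> k1 GD GX; have := Gdet GX; rewrite det2E tr2E.
set al := X 0 0; set be := X 0 1; set c := X 1 0; set de := X 1 1.
move=> dX trX be0 c0 cond lamf lamh; have k0 : 0 < k by lra.
have kn0 : k != 0 by rewrite gt_eqF.
have kV : 0 < k^-1 by rewrite invr_gt0.
have kk : k * k^-1 = 1 by rewrite divff.
have kV1 : k^-1 < 1 by rewrite invf_lt1.
have hD : hyperbolic D by rewrite /hyperbolic tr2E !mx2_entry ger0_norm; nra.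
have hX : hyperbolic X by rewrite /hyperbolic tr2E -/al -/de ger0_norm; lra.
pose tau := al + de; pose s := Num.sqrt (tau ^+ 2 - 4).
have s2 : s ^+ 2 = tau ^+ 2 - 4 by rewrite sqr_sqrtr //; rewrite /tau; nra.
have s0 : 0 < s by rewrite sqrtr_gt0 /tau; nra.
pose m := (tau + s) / 2; pose m' := (tau - s) / 2.
have mm : m * m' = 1 by rewrite /m /m'; lra.
have mD : m + m' = tau by rewrite /m /m'; lra.
have m0 : 0 < m by rewrite /m /tau; lra.
have m'0 : 0 < m' by rewrite -(pmulr_rgt0 _ m0) mm.
have mgt : m' < m by rewrite /m /m'; lra.
have bc : 0 < be * c by apply: mulr_gt0.
have md : (m - al) * (m - de) = be * c by rewrite /m /m' /tau in mm mD *; nra.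
have md' : (m' - al) * (m' - de) = be * c by rewrite /m /m' /tau in mm mD *; nra.
have p0 : 0 < m - de by rewrite /tau in mD; nra.
have q0 : m' - de < 0 by rewrite /tau in mD; nra.
have key : al <= k ^+ 2 * (m - de).
  by apply: (@attracting_bound R al be c de m m' k) => //; rewrite mD.
pose w : R * R := (m - de, c); pose w' : R * R := (m' - de, c).
have cn0 : c != 0 by rewrite gt_eqF.
have w0 : w != (0, 0) by rewrite xpair_eqE negb_and cn0 orbT.
have w'0 : w' != (0, 0) by rewrite xpair_eqE negb_and cn0 orbT.
have Xw : act X w = (m * w.1, m * w.2).
  rewrite /act -/al -/be -/c -/de /=; congr pair; last by ring.
  by rewrite -md; ring.
have Xw' : act X w' = (m' * w'.1, m' * w'.2).
  rewrite /act -/al -/be -/c -/de /=; congr pair; last by ring.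
  by rewrite -md'; ring.
have De1 : act D (1, 0) = (k * 1, k * 0).
  by rewrite /act /D !mx2_entry /=; congr pair; ring.
have De2 : act D (0, 1) = (k^-1 * 0, k^-1 * 1).
  by rewrite /act /D !mx2_entry /=; congr pair; ring.
have kVn0 : k^-1 != 0 by rewrite gt_eqF.
have mn0 : m != 0 by rewrite gt_eqF.
have m'n0 : m' != 0 by rewrite gt_eqF.
have [Sb fb] := fixed_image GD hD e1_neq0 kn0 De1.
have [Sa fa] := fixed_image GD hD e2_neq0 kVn0 De2.
have [Sp hp] := fixed_image GX hX w0 mn0 Xw.
have [Sq hq] := fixed_image GX hX w'0 m'n0 Xw'.
have eXb := vf_equivariant fr GX e1_neq0 Sb.
have SXb := vf_stable fr GX e1_neq0 Sb.
have Xb0 := act_neq0 (Gdet GX) e1_neq0.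
have eDp := vf_equivariant fr GD w0 Sp.
have SDp := vf_stable fr GD w0 Sp.
have Dp0 := act_neq0 (Gdet GD) w0.
have XbE : act X (1, 0) = (al, c).
  by rewrite /act -/al -/be -/c -/de /=; congr pair; ring.
have DpE : act D w = (k * (m - de), k^-1 * c).
  by rewrite /act /D !mx2_entry /=; congr pair; ring.
have rS A : G A -> in_Sp om (rho A) by case: hrho => sp _ _; apply: sp.
have c2 : 0 < c * c by apply: mulr_gt0.
apply: (@collar_symplectic _ _ om n n_gt0 dimV (Phi (0, 1)) (Phi (1, 0)) (Phi w) (Phi w')
  (rho D) (rho X)) => //.
- exact: (vf_lagrangian fr).
- exact: (vf_lagrangian fr).
- exact: (vf_lagrangian fr).
- exact: (vf_lagrangian fr).
- by rewrite -eXb; apply: (vf_lagrangian fr).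
- by rewrite -eDp; apply: (vf_lagrangian fr).
- exact: rS.
- exact: rS.
- apply: (vf_maximal fr) => //; rewrite /br /=.
  rewrite (_ : _ * _ = (m - de) * c); last by ring.
  exact: mulr_gt0.
- apply: (vf_maximal fr) => //; rewrite /br /=.
  rewrite (_ : _ * _ = - (m' - de) * c); last by ring.
  by apply: mulr_gt0 => //; rewrite oppr_gt0.
- rewrite -eXb; apply: (vf_maximal fr) => //; rewrite XbE /br /=.
  rewrite (_ : _ * _ = (al + de - m) * c * (c * c)); last by ring.
  rewrite -/tau -mD addrAC subrr add0r.
  by apply: mulr_gt0 => //; apply: mulr_gt0.
- have [e|ne] := eqVneq al (k ^+ 2 * (m - de)).
    left; rewrite -eXb -eDp XbE DpE -(vf_scale fr (k * (m - de), k^-1 * c) kn0) /= e.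
    by rewrite !mulrA -expr2 divff // mul1r.
  right; rewrite -eXb -eDp; apply: (vf_maximal fr) => //; rewrite XbE DpE /br /=.
  rewrite [X in 0 < X](_ : _ = k^-1 * (k ^+ 2 * (m - de) - al) * k^-1 * (c * (c * c))); last first.
    by field.
  by do !(apply: mulr_gt0 => //); rewrite subr_gt0 lt_neqAle ne.
Qed.

End Normalized.

(** * Discreteness and crossings of smallest angle *)

Section Discreteness.
Variable R : realType.
Implicit Types (G : set 'M[R]_2) (A B X Y : 'M[R]_2).

Lemma mxBE A B i j : (A - B) i j = A i j - B i j.
Proof. by rewrite !mxE. Qed.

Lemma mulmx2_bound A B a b : (forall i j, `|A i j| <= a) -> (forall i j, `|B i j| <= b) ->
  forall i j, `|(A *m B) i j| <= 2 * (a * b).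
Proof.
move=> hA hB i j; rewrite mulmx2E (le_trans (ler_normD _ _)) // !normrM mulr2n mulrDl !mul1r.
by apply: lerD; apply: ler_pM.
Qed.

Lemma invmx2_bound A a : \det A = 1 -> (forall i j, `|A i j| <= a) ->
  forall i j, `|invmx A i j| <= a.
Proof.
by move=> dA hA; rewrite (invmx2 dA); apply: ord2P; apply: ord2P; rewrite mx2_entry ?normrN.
Qed.

Lemma discrete_gap G : G 1%:M -> discrete_subgroup G -> exists2 e : R, 0 < e &
  forall X, G X -> (forall i j, `|X i j - (1%:M : 'M[R]_2) i j| < e) -> X = 1%:M.
Proof.
move=> G1 /(_ _ G1) [_ [W W1 WG]].
have [e /= e0 eW] := (nbhs_ballP _ _).1 W1; exists e => // X GX hX.
have : (W `&` G) X.
  by split=> //; apply: eW; split=> // i j; rewrite -ball_normE /= distrC.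
by rewrite WG.
Qed.

(** Two elements with nearby entries differ by an element near the identity,
    hence coincide: a pigeonhole on a fine grid counts the bounded ones. *)
Lemma discrete_bounded_finite G (K : R) : PSL2_subgroup G -> discrete_subgroup G ->
  finite_set [set X | G X /\ forall i j, `|X i j| <= K].
Proof.
move=> [G1 dG GM GV _] /(discrete_gap G1) [e e0 gap].
have [K0|K0] := leP K 0.
  apply: (@sub_finite_set _ _ [set 0]); last exact: finite_set1.
  move=> X [_ hX] /=; apply/matrixP => i j; rewrite !mxE; apply/eqP.
  by rewrite -normr_le0 (le_trans (hX i j)).
pose h := e / (4 * K); have h0 : 0 < h by rewrite divr_gt0 // mulr_gt0.
pose M := Num.trunc (2 * K / h).
pose f X : {ffun 'I_2 * 'I_2 -> 'I_M.+1} :=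
  [ffun p => inord (Num.trunc ((X p.1 p.2 + K) / h))].
set T := [set X | _].
have rng X i j : T X -> 0 <= (X i j + K) / h /\ (Num.trunc ((X i j + K) / h) < M.+1)%N.
  move=> [_ /(_ i j)]; rewrite ler_norml => /andP[x1 x2]; split.
    by apply: divr_ge0; [lra | exact: ltW].
  by rewrite ltnS; apply: le_truncn; rewrite ler_pM2r ?invr_gt0 //; lra.
have finj : {in T &, injective f}.
  move=> X Y /set_mem TX /set_mem TY /ffunP fXY.
  have near i j : `|Y i j - X i j| <= h.
    have := congr1 val (fXY (i, j)); rewrite !ffunE /=.
    have [x0 xM] := rng X i j TX; have [y0 yM] := rng Y i j TY.
    rewrite !inordK // => t.
    have /andP[a1 a2] := truncn_itv x0; have /andP[b1 b2] := truncn_itv y0.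
    rewrite -t in b1 b2; move: (Num.trunc _) a1 a2 b1 b2 => q.
    rewrite -natr1 ler_pdivlMr // ltr_pdivrMr // => a1 a2.
    rewrite ler_pdivlMr // ltr_pdivrMr // => b1 b2.
    by rewrite ler_norml; apply/andP; split; lra.
  have dX := dG _ TX.1.
  have Xu : X \in unitmx by rewrite unitmxE dX unitr1.
  have : invmx X *m Y = 1%:M.
    apply: gap; first by apply: GM; [apply: GV; exact: TX.1 | exact: TY.1].
    move=> i j.
    have -> : (invmx X *m Y) i j - (1%:M : 'M[R]_2) i j = (invmx X *m (Y - X)) i j.
      by rewrite mulmxBr mulVmx // mxBE.
    have nXY : forall i j, `|(Y - X) i j| <= h by move=> a b; rewrite mxBE.
    apply: le_lt_trans (mulmx2_bound (invmx2_bound dX TX.2) nXY i j) _.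
    have -> : 2 * (K * h) = e / 2 by rewrite /h; field; rewrite gt_eqF.
    by lra.
  by move/(congr1 (mulmx X)); rewrite mulmxA mulmxV // mul1mx mulmx1.
rewrite -(eq_finite_set (inj_card_eq finj)); exact: finite_finset.
Qed.

Lemma conj_bounded_finite G M (K : R) : \det M = 1 -> PSL2_subgroup G -> discrete_subgroup G ->
  finite_set [set X | conjG M G X /\ forall i j, `|X i j| <= K].
Proof.
move=> dM hG dG; have Mu : M \in unitmx by rewrite unitmxE dM unitr1.
have [m mM] : exists m, forall i j, `|M i j| <= m.
  exists (`|M 0 0| + `|M 0 1| + (`|M 1 0| + `|M 1 1|)).
  have p i j := normr_ge0 (M i j).
  have := (p 0 0, p 0 1, p 1 0, p 1 1) => -[[[p1 p2] p3] p4].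
  by apply: ord2P; apply: ord2P; lra.
pose K' := 2 * (2 * (m * K) * m).
apply: (@sub_finite_set _ _ ((fun Y => invmx M *m Y *m M) @`
   [set Y | G Y /\ forall i j, `|Y i j| <= K'])); last first.
  by apply: finite_image; apply: discrete_bounded_finite.
move=> X [GX hX]; exists (M *m X *m invmx M).
  split=> //; apply: mulmx2_bound; last exact: invmx2_bound.
  exact: mulmx2_bound.
by rewrite !mulmxA mulVmx // mul1mx mulmxKV.
Qed.

Lemma finite_argmax (T : choiceType) (A : set T) (g : T -> R) : finite_set A -> A !=set0 ->
  exists2 x, A x & forall y, A y -> g y <= g x.
Proof.
move=> /finite_seqP[s ->] [x0 /= xs].
elim: s x0 xs => // a s IH _ _; case: s IH => [_|b s IH].
  by exists a => /= [|y]; rewrite !inE // => /eqP ->.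
have [x /= xs hx] := IH b (mem_head _ _).
have [h|h] := leP (g a) (g x).
  exists x => /= [|y]; first by rewrite inE xs orbT.
  by rewrite inE => /orP[/eqP -> //|/hx].
exists a => /= [|y]; first by rewrite mem_head.
by rewrite inE => /orP[/eqP -> //|/hx /le_trans]; apply; apply: ltW.
Qed.

Lemma expr_unbounded (K x : R) : 1 < K -> exists N, x < K ^+ N.
Proof.
move=> K1; have bern N : 1 + N%:R * (K - 1) <= K ^+ N.
  elim: N => [|N IH]; first by rewrite mul0r addr0 expr0.
  rewrite exprS -natr1; have p1 : 1 <= K ^+ N by rewrite exprn_ege1 // ltW.
  have : 0 <= (K - 1) * (K ^+ N - 1) by rewrite mulr_ge0 // subr_ge0 // ltW.
  by nra.
have d0 : 0 < K - 1 by lra.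
exists (Num.trunc (x / (K - 1))).+1; apply: lt_le_trans (bern _).
have := truncnS_gt (x / (K - 1)); rewrite ltr_pdivrMr //; lra.
Qed.

Lemma pow_window (K r : R) : 1 < K -> 0 < r ->
  exists i j, 1 <= r * (K ^+ i / K ^+ j) < K.
Proof.
move=> K1 r0; have K0 : 0 < K by lra.
have [i hi] := expr_unbounded r^-1 K1; exists i.
have ri : 1 <= r * K ^+ i.
  by rewrite mulrC -ler_pdivrMr // div1r ltW.
have ex : exists j, r * K ^+ i < K ^+ j.+1.
  have [N hN] := expr_unbounded (r * K ^+ i) K1; exists N; apply: lt_trans hN _.
  by rewrite exprS ltr_pMl ?exprn_gt0.
case: (ex_minnP ex) => j hj jmin; exists j.
have Kj : 0 < K ^+ j by rewrite exprn_gt0.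
rewrite mulrA ler_pdivlMr // ltr_pdivrMr // mul1r -exprS hj andbT.
case: j hj jmin Kj => [//|j] hj jmin Kj.
by rewrite leNgt; apply/negP => /jmin; rewrite ltnn.
Qed.

Lemma diag_pow G k N : PSL2_subgroup G -> G (mx2 k 0 0 k^-1) ->
  G (mx2 (k ^+ N) 0 0 (k ^- N)).
Proof.
move=> [G1 _ GM _ _] GD; elim: N => [|N IH]; first by rewrite invr1 mx2_1.
have := GM _ _ GD IH; rewrite mx2M !(mul0r, mulr0, addr0, add0r).
by rewrite exprS invfM.
Qed.

(** Among the conjugates of [X0] whose axis crosses the imaginary axis in the
    positive direction, one with the largest upper left entry, hence the smallest
    angle, exists by discreteness. If the conclusion failed for it then its
    conjugate [X^-1 D X D^-1 X] would cross at a still smaller angle. *)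
Lemma minimal_crossing G k (D := mx2 k 0 0 k^-1) X0 : PSL2_subgroup G ->
  (forall K : R, finite_set [set X | G X /\ forall i j, `|X i j| <= K]) ->
  1 < k -> G D -> G X0 -> 2 < \tr X0 -> 0 < X0 0 1 -> 0 < X0 1 0 ->
  exists2 C, G C & let X := C *m X0 *m invmx C in
  [/\ 0 < X 0 1, 0 < X 1 0 &
    k ^+ 2 <= (k ^+ 2 - 1) * (X 0 0 ^+ 2 + k ^+ 2 * (X 0 1 * X 1 0))].
Proof.
move=> hG fin k1 GD GX0 tr0 be0 c0; have [G1 dG GM GV GN] := hG.
have Gu A : G A -> A \in unitmx by move=> /dG e; rewrite unitmxE e unitr1.
have k0 : 0 < k by lra.
have kn0 : k != 0 by rewrite gt_eqF.
have k4 : 1 < k ^+ 4 by rewrite exprn_egt1.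
pose cj X := exists2 C, G C & X = C *m X0 *m invmx C.
have cjG X : cj X -> G X.
  by move=> [C GC ->]; apply: (GM _ _ (GM _ _ GC GX0)); apply: GV.
have cjC X C : G C -> cj X -> cj (C *m X *m invmx C).
  move=> GC [B GB ->]; exists (C *m B); first exact: GM.
  have -> : invmx (C *m B) = invmx B *m invmx C.
    by apply/esym/invmx_uniq; rewrite !mulmxA mulmxK ?mulmxV ?Gu.
  by rewrite !mulmxA.
have cjt X : cj X -> \tr X = \tr X0.
  by move=> [C GC ->]; rewrite mxtrace_mulC mulmxA mulVmx ?mul1mx ?Gu.
(* Conjugation by powers of [D] multiplies [X 0 1 / X 1 0] by powers of [k ^+ 4] and
   keeps the diagonal, so that the maximum may be sought in the finite set [T]. *)
pose T := [set X | [/\ cj X, 0 < X 0 1, 0 < X 1 0 & X 1 0 <= X 0 1 < k ^+ 4 * X 1 0]].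
have norm X : cj X -> 0 < X 0 1 -> 0 < X 1 0 ->
    exists2 Y, T Y & Y 0 0 = X 0 0.
  move=> cX b0 d0; have [i [j]] := pow_window k4 (divr_gt0 b0 d0).
  pose t := k ^+ i / k ^+ j; have t0 : 0 < t by rewrite divr_gt0 ?exprn_gt0.
  have -> : k ^+ 4 ^+ i / k ^+ 4 ^+ j = t ^+ 4.
    by rewrite /t expr_div_n -!exprM ![(4 * _)%N]mulnC.
  move=> win; pose E := mx2 t 0 0 t^-1.
  have GE : G E.
    have := GM _ _ (diag_pow i hG GD) (GV _ (diag_pow j hG GD)).
    rewrite invmx2; last exact: dG (diag_pow j hG GD).
    rewrite !mx2_entry mx2M !(mul0r, mulr0, addr0, add0r, oppr0) /E /t.
    by rewrite invfM invrK [k ^- i * _]mulrC.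
  have EX : E *m X *m invmx E = mx2 (X 0 0) (t ^+ 2 * X 0 1) (t ^- 2 * X 1 0) (X 1 1).
    rewrite (invmx2 (dG _ GE)) {1}(mx2E X) /E !mx2_entry !mx2M.
    have tn0 : t != 0 by rewrite gt_eqF.
    by apply: mx2P; rewrite !mx2_entry; field.
  exists (E *m X *m invmx E); last by rewrite EX mx2_entry.
  rewrite /T /= EX !mx2_entry; split; first by rewrite -EX; apply: cjC.
  - by rewrite mulr_gt0 ?exprn_gt0.
  - by rewrite mulr_gt0 ?invr_gt0 ?exprn_gt0.
  have t2 : 0 < t ^+ 2 by rewrite exprn_gt0.
  move: win; rewrite mulrAC ler_pdivlMr // ltr_pdivrMr // mul1r.
  move=> /andP[w1 w2]; apply/andP; split.
    by rewrite ler_pdivrMl // mulrA -exprD mulrC.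
  by rewrite [ltRHS]mulrCA ltr_pdivlMl // mulrA -exprD mulrC.
have Tfin : finite_set T.
  pose tau := \tr X0.
  apply: sub_finite_set (fin (k ^+ 4 * tau)) => X [cX b0 d0 /andP[w1 w2]].
  split; first exact: cjG.
  have := dG _ (cjG _ cX); have := cjt _ cX; rewrite det2E tr2E -/tau.
  move=> tX dX; have tau0 : 2 < tau by [].
  have bc : 0 < X 0 1 * X 1 0 by apply: mulr_gt0.
  have a0 : 0 < X 0 0 by nra.
  have e0 : 0 < X 1 1 by nra.
  have tt : tau <= k ^+ 4 * tau by nra.
  have cc : X 1 0 <= tau by nra.
  have bb : X 0 1 <= k ^+ 4 * tau by nra.
  by apply: ord2P; apply: ord2P; rewrite gtr0_norm //; lra.
have cX0 : cj X0 by exists 1%:M; rewrite // mul1mx invmx1 mulmx1.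
have [X1 TX1 _] := norm X0 cX0 be0 c0.
have [X [[C GC XE] b0 d0 win] Xmax] := @finite_argmax _ T (fun X => X 0 0) Tfin (ex_intro _ X1 TX1).
have cX : cj X by exists C.
exists C => //=; rewrite -XE; split=> //.
rewrite leNgt; apply/negP => bad.
have GX := cjG _ cX; have dX := dG _ GX.
pose B := invmx X *m D; have GB : G B by apply: GM => //; apply: GV.
pose X' := B *m X *m invmx B; have cX' : cj X' by apply: cjC.
have BV : invmx B = invmx D *m X.
  by apply/esym/invmx_uniq; rewrite /B !mulmxA mulmxK ?mulVmx ?Gu.
have k2 : 1 < k ^+ 2 by rewrite exprn_egt1.
have kk : k ^+ 2 * k ^- 2 = 1 by rewrite divff // expf_neq0.
have kV0 : 0 < k ^- 2 by rewrite invr_gt0 exprn_gt0.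
have kV1 : k ^- 2 < 1 by rewrite invf_lt1 // exprn_gt0.
have X'E : X' = mx2 (X 1 1) (- X 0 1) (- X 1 0) (X 0 0) *m
    mx2 (X 0 0) (k ^+ 2 * X 0 1) (k ^- 2 * X 1 0) (X 1 1) *m X.
  rewrite /X' BV /B (invmx2 dX) -!mulmxA; congr (_ *m _); rewrite !mulmxA.
  congr (_ *m _); rewrite (invmx2 (dG _ GD)) {1}(mx2E X) /D !mx2_entry !mx2M.
  by apply: mx2P; rewrite !mx2_entry; field.
rewrite det2E in dX; have := cjt _ cX; rewrite tr2E => tX.
have bc : 0 < X 0 1 * X 1 0 by apply: mulr_gt0.
have a0 : 0 < X 0 0 by nra.
have e0 : 0 < X 1 1 by nra.
rewrite (mx2E X) !mx2M in X'E.
have X00 : X' 0 0 = X 0 0 + (X 0 1 * X 1 0) * (k ^+ 2 - 1) * (X 0 0 * k ^- 2 + X 1 1).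
  apply/eqP; rewrite -subr_eq0 X'E !mx2_entry; apply/eqP.
  transitivity (X 0 0 * (X 0 0 * X 1 1 - X 0 1 * X 1 0 - 1)
    + X 0 1 * X 1 0 * X 0 0 * (1 - k ^+ 2 * k ^- 2)); first by ring.
  by rewrite kk dX; ring.
have X01 : X' 0 1 = X 0 1 * (1 + X 0 1 * X 1 0 * (1 - k ^- 2) + (k ^+ 2 - 1) * X 1 1 ^+ 2).
  apply/eqP; rewrite -subr_eq0 X'E !mx2_entry; apply/eqP.
  transitivity (X 0 1 * (X 0 0 * X 1 1 - X 0 1 * X 1 0 - 1)); first by ring.
  by rewrite dX; ring.
have X10 : X' 1 0 = X 1 0 * (1 - (1 - k ^- 2) * (X 0 0 ^+ 2 + k ^+ 2 * (X 0 1 * X 1 0))).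
  apply/eqP; rewrite -subr_eq0 X'E !mx2_entry; apply/eqP.
  transitivity (X 1 0 * (X 0 0 * X 1 1 - X 0 1 * X 1 0 - 1)
     + X 1 0 * X 0 1 * X 1 0 * (1 - k ^+ 2 * k ^- 2)); first by ring.
  by rewrite kk dX; ring.
have gt : X 0 0 < X' 0 0.
  rewrite X00 ltrDl; apply: mulr_gt0; first by apply: mulr_gt0 => //; lra.
  by apply: addr_gt0 => //; apply: mulr_gt0.
have p01 : 0 < X' 0 1.
  rewrite X01; apply: mulr_gt0 => //.
  have h1 : 0 < X 0 1 * X 1 0 * (1 - k ^- 2) by apply: mulr_gt0 => //; lra.
  have h2 : 0 < (k ^+ 2 - 1) * X 1 1 ^+ 2 by apply: mulr_gt0; [lra | rewrite exprn_gt0].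
  by lra.
have p10 : 0 < X' 1 0.
  rewrite X10; apply: mulr_gt0 => //; rewrite -(pmulr_rgt0 _ (lt_trans ltr01 k2)).
  move: bad; rewrite -subr_gt0; congr (0 < _).
  transitivity (k ^+ 2 - (k ^+ 2 - k ^+ 2 * k ^- 2) *
    (X 0 0 ^+ 2 + k ^+ 2 * (X 0 1 * X 1 0))); [by rewrite kk | ring].
have [Y TY YE] := norm X' cX' p01 p10.
by have := Xmax Y TY; rewrite YE leNgt gt.
Qed.

End Discreteness.

(** * Axes *)

Section Axes.
Variable R : realType.
Implicit Types (A B M X : 'M[R]_2).

Lemma diagonalize A : \det A = 1 -> 2 < \tr A -> exists M k, [/\ \det M = 1, 1 < k
  & A = M *m mx2 k 0 0 k^-1 *m invmx M].
Proof.
move=> dA tA; suff [M [k [dM k1 e]]] : exists M k, [/\ \det M = 1, 1 < k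
    & A *m M = M *m mx2 k 0 0 k^-1].
  by exists M, k; split=> //; rewrite -e mulmxK // unitmxE dM unitr1.
move: dA tA; rewrite det2E tr2E (mx2E A) !mx2_entry.
move: (A 0 0) (A 0 1) (A 1 0) (A 1 1) => a b c d dA tA.
have [c0|c0] := eqVneq c 0.
  rewrite c0 mulr0 subr0 in dA.
  have ap : 0 < a by nra. have dp : 0 < d by nra.
  have aV : a^-1 = d by apply: (mulfI (lt0r_neq0 ap)); rewrite divff ?gt_eqF // dA.
  have dV : d^-1 = a by apply: (mulfI (lt0r_neq0 dp)); rewrite divff ?gt_eqF // mulrC dA.
  have [ad|da|ad] := ltgtP a d.
  - exists (mx2 (b / (d - a)) (-1) 1 0), d; have da0 : d - a != 0 by rewrite gt_eqF // subr_gt0.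
    split; [by rewrite det2E !mx2_entry; ring | by nra |].
    by rewrite !mx2M dV c0; apply: mx2P; rewrite !mx2_entry; field.
  - exists (mx2 1 (b / (d - a)) 0 1), a; have da0 : d - a != 0 by rewrite lt_eqF // subr_lt0.
    split; [by rewrite det2E !mx2_entry; ring | by nra |].
    by rewrite !mx2M aV c0; apply: mx2P; rewrite !mx2_entry; field.
  - by exfalso; rewrite ad in dA tA; nra.
pose s := Num.sqrt ((a + d) ^+ 2 - 4).
have s2 : s ^+ 2 = (a + d) ^+ 2 - 4 by rewrite sqr_sqrtr //; nra.
have s0 : 0 < s by rewrite sqrtr_gt0; nra.
pose k := (a + d + s) / 2; pose k' := (a + d - s) / 2.
have kk : k * k' = 1 by rewrite /k /k'; lra.
have kD : k' = a + d - k by rewrite /k /k'; lra.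
have k1 : 1 < k by rewrite /k; lra.
have kn : k - k' != 0 by rewrite gt_eqF // /k /k'; lra.
have k0 : k != 0 by rewrite gt_eqF //; lra.
have kV : k^-1 = k' by apply: (mulfI k0); rewrite divff.
have bE : b = (a * d - 1) / c by apply: (mulIf c0); rewrite divfK //; lra.
exists (mx2 (k - d) ((k' - d) / ((k - k') * c)) c (k - k')^-1), k.
move: kn kk kD kV; move: k' => k' kn kk kD kV.
split=> //; first by rewrite det2E !mx2_entry; field; rewrite c0 kn.
have q : k * (a + d - k) = 1 by rewrite -kD.
rewrite kV !mx2M bE; apply: mx2P; rewrite !mx2_entry ?mulr0 ?addr0 ?add0r.
- transitivity ((a * (k - d) + (a * d - 1))); first by field.
  by rewrite -q; ring.
- transitivity (((a * (k' - d) + (a * d - 1)) / ((k - k') * c))); first by field; rewrite c0 kn.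
  transitivity ((k' - d) * k' / ((k - k') * c)); last by field; rewrite c0 kn.
  by congr (_ / _); rewrite -q kD; ring.
- by ring.
- by field; rewrite c0 kn.
Qed.

(** The circle has the same coefficients as the fixed point equation of [A]. *)
Lemma axis_equation A z : axis A z -> 0 < complex.Im z /\
  A 1 0 * (complex.Re z ^+ 2 + complex.Im z ^+ 2) + (A 1 1 - A 0 0) * complex.Re z - A 0 1 = 0.
Proof.
have fixS t : mobius_bd A (Some t) = Some t -> A 1 0 * t ^+ 2 + (A 1 1 - A 0 0) * t - A 0 1 = 0.
  rewrite /=; case: eqP => // /eqP n0 [e].
  have : A 0 0 * t + A 0 1 = t * (A 1 0 * t + A 1 1) by rewrite -{2}e divfK.
  nra.
have fixN : mobius_bd A None = None -> A 1 0 = 0 by rewrite /=; case: eqP.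
case: z => x y [] [s|] [] [t|] [//] /=; rewrite ?(inj_eq Some_inj).
- move=> st /fixS es /fixS et [y0 e]; split=> //.
  have e1 : A 1 0 * (s + t) + (A 1 1 - A 0 0) = 0.
    by apply: (mulfI (_ : s - t != 0)); [rewrite subr_eq0 | nra].
  have : A 1 0 * ((x - (s + t) / 2) ^+ 2 + y ^+ 2 - ((t - s) / 2) ^+ 2) = 0.
    by rewrite e subrr mulr0.
  nra.
- by move=> _ /fixS es /fixN c0 [y0 ->]; split=> //; rewrite c0 in es *; nra.
- by move=> _ /fixN c0 /fixS es [y0 ->]; split=> //; rewrite c0 in es *; nra.
Qed.

Lemma fixed_bdE A x : \det A = 1 -> mobius_bd A x = x <->
  match x with
  | Some t => A 1 0 * t ^+ 2 + (A 1 1 - A 0 0) * t - A 0 1 = 0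
  | None => A 1 0 = 0
  end.
Proof.
rewrite det2E => dA; case: x => [t|] /=; last by case: eqP; split.
case: eqP => [c0|/eqP c0]; split=> //.
- by move=> e; exfalso; have : (A 1 0 * t + A 1 1) * (A 0 0 - A 1 0 * t) = 0; [rewrite c0 mul0r|nra].
- case=> e; have : A 0 0 * t + A 0 1 = t * (A 1 0 * t + A 1 1) by rewrite -{2}e divfK.
  nra.
- by move=> e; congr Some; apply: (mulIf c0); rewrite divfK //; nra.
Qed.

Lemma axis_eq A B c : \det A = 1 -> \det B = 1 -> c != 0 -> B 1 0 = c * A 1 0 ->
  B 1 1 - B 0 0 = c * (A 1 1 - A 0 0) -> B 0 1 = c * A 0 1 -> axis A = axis B.
Proof.
move=> dA dB c0 e1 e2 e3.
have fixE x : (mobius_bd A x = x) = (mobius_bd B x = x).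
  apply/propext; rewrite !fixed_bdE //; case: x => [t|].
    rewrite e1 e2 e3 (_ : _ - c * _ = c * (A 1 0 * t ^+ 2 + (A 1 1 - A 0 0) * t - A 0 1)); last by ring.
    by split=> [->|/eqP]; rewrite ?mulr0 // mulf_eq0 (negPf c0) => /eqP.
  by rewrite e1; split=> [->|/eqP]; rewrite ?mulr0 // mulf_eq0 (negPf c0) => /eqP.
apply/seteqP; split=> z [x [y [xy hx hy hz]]]; exists x, y; split=> //.
- by rewrite -fixE.
- by rewrite -fixE.
- by rewrite fixE.
- by rewrite fixE.
Qed.

(** If [x + i y] lies on the axis of [C] then the quadratic form [br v (act C v)]
    sums to zero over [v = (x, 1)] and [v = (y, 0)]. In the eigenbasis of [A] this
    makes the mixed term vanish at a common point, and the equation for [B] becomes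
    an equality between positive multiples of its two off-diagonal entries. *)
Lemma crossing_offdiag A B M a d : \det A = 1 -> \det B = 1 -> \det M = 1 -> a != d ->
  hyperbolic B -> A = M *m mx2 a 0 0 d *m invmx M ->
  axis A <> axis B -> (axis A `&` axis B) !=set0 ->
  0 < (invmx M *m B *m M) 0 1 * (invmx M *m B *m M) 1 0.
Proof.
move=> dA dB dM ad hB AE neq [z [zA zB]].
have Mu : M \in unitmx by rewrite unitmxE dM unitr1.
have dMV : \det (invmx M) = 1 by rewrite det_inv dM invr1.
pose X := invmx M *m B *m M; rewrite -/X.
have BE : B = M *m X *m invmx M by rewrite /X !mulmxA mulmxV // mul1mx mulmxK.
have [y0 eA] := axis_equation zA; have [_ eB] := axis_equation zB.
move: y0 eA eB; move: (complex.Re z) (complex.Im z) => x y y0 eA eB.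
have form C Y : C = M *m Y *m invmx M -> forall v,
    br v (act C v) = br (act (invmx M) v) (act Y (act (invmx M) v)).
  move=> -> v; rewrite -[br (act _ _) _]mul1r -{1}dM -br_act -!actM.
  by rewrite mulmxV // act1.
have eP (C : 'M[R]_2) : C 1 0 * (x ^+ 2 + y ^+ 2) + (C 1 1 - C 0 0) * x - C 0 1 =
    br (x, 1) (act C (x, 1)) + br (y, 0) (act C (y, 0)).
  by rewrite /br /act /=; ring.
have PQ : br (act (invmx M) (x, 1)) (act (invmx M) (y, 0)) = - y.
  by rewrite br_act dMV mul1r /br /=; ring.
move: eA eB; rewrite !eP !(form _ _ AE) !(form _ _ BE).
move: (act _ (x, 1)) (act _ (y, 0)) PQ => [p1 p2] [q1 q2].
rewrite /br /act !mx2_entry /= => PQ eA eB.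
have ort : p1 * p2 + q1 * q2 = 0.
  apply: (mulfI (_ : d - a != 0)); first by rewrite subr_eq0 eq_sym.
  by rewrite mulr0 -eA; ring.
have bal : X 1 0 * (p1 ^+ 2 + q1 ^+ 2) = X 0 1 * (p2 ^+ 2 + q2 ^+ 2).
  apply/eqP; rewrite -subr_eq0 -eB; apply/eqP.
  transitivity (X 1 0 * (p1 ^+ 2 + q1 ^+ 2) - X 0 1 * (p2 ^+ 2 + q2 ^+ 2)
    + (X 1 1 - X 0 0) * (p1 * p2 + q1 * q2)); last by ring.
  by rewrite ort mulr0 addr0.
have pos1 : 0 < p1 ^+ 2 + q1 ^+ 2.
  rewrite lt_def addr_ge0 ?sqr_ge0 // andbT paddr_eq0 ?sqr_ge0 // !sqrf_eq0.
  apply/negP => /andP[/eqP p0 /eqP q0]; move: PQ; rewrite p0 q0; lra.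
have pos2 : 0 < p2 ^+ 2 + q2 ^+ 2.
  rewrite lt_def addr_ge0 ?sqr_ge0 // andbT paddr_eq0 ?sqr_ge0 // !sqrf_eq0.
  apply/negP => /andP[/eqP p0 /eqP q0]; move: PQ; rewrite p0 q0; lra.
have [X0|X0] := eqVneq (X 1 0) 0; last first.
  rewrite -(pmulr_lgt0 _ pos2) mulrAC -bal mulrAC pmulr_lgt0 // -expr2.
  by rewrite exprn_even_gt0.
have X1 : X 0 1 = 0.
  by apply: (mulIf (lt0r_neq0 pos2)); rewrite -bal X0 !mul0r.
exfalso; apply: neq.
have dX : \det X = 1 by rewrite !det_mulmx dMV dM mul1r mulr1.
have Xn : X 0 0 != X 1 1.
  apply/negP => /eqP e; move: hB; rewrite BE hyperbolic_conj // /hyperbolic tr2E.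
  move: dX; rewrite det2E X0 X1 e => h; rewrite -(ltr_pXn2r (ltn0Sn 1)) ?nnegrE //.
  by rewrite real_normK ?num_real //; nra.
have da0 : d - a != 0 by rewrite subr_eq0 eq_sym.
apply: (@axis_eq _ _ ((X 1 1 - X 0 0) / (d - a))) => //.
- by rewrite mulf_neq0 ?invr_eq0 // subr_eq0 eq_sym.
- rewrite BE AE (invmx2 dM) (mx2E M) (mx2E X) X0 X1 !mx2_entry !mx2M !mx2_entry.
  by field.
- rewrite BE AE (invmx2 dM) (mx2E M) (mx2E X) X0 X1 !mx2_entry !mx2M !mx2_entry.
  by field.
- rewrite BE AE (invmx2 dM) (mx2E M) (mx2E X) X0 X1 !mx2_entry !mx2M !mx2_entry.
  by field.
Qed.

End Axes.

(** * Hyperbolic area in logarithmic coordinates *)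

Section LogMeasure.
Variable R : realType.
Local Notation T := (measurableTypeR R).
Local Notation mu := (@lebesgue_measure R).

(** The density [1 / y], extended to a nonnegative measurable function on the line. *)
Definition wt (y : T) : R := expR (- ln y).

Lemma wtE y : 0 < y -> wt y = y^-1.
Proof. by move=> y0; rewrite /wt expRN lnK. Qed.

Lemma wt_ge0 y : 0 <= wt y. Proof. exact: expR_ge0. Qed.

Lemma measurable_wt D : measurable_fun D wt.
Proof.
apply: measurable_funTS; apply: measurableT_comp => //.
by apply: measurableT_comp => //; exact: measurable_ln.
Qed.

(** The measure [dy / y] on positive reals, in the logarithmic coordinate. *)
Definition logm (B : set T) : \bar R :=
  (\int[mu]_(y in `]0%R, +oo[ `&` (@ln R) @^-1` B) (wt y)%:E)%E.

Lemma measurable_logdom B : measurable B -> measurable (`]0%R, +oo[ `&` (@ln R : T -> T) @^-1` B).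
Proof.
move=> mB; apply: measurableI => //.
by rewrite -[X in measurable X]setTI; apply: measurable_ln.
Qed.

Let logm0 : logm set0 = 0%E.
Proof. by rewrite /logm preimage_set0 setI0 integral_set0. Qed.

Let logm_ge0 B : (0 <= logm B)%E.
Proof. by apply: integral_ge0 => y _; rewrite lee_fin wt_ge0. Qed.

Let logm_sigma_additive : semi_sigma_additive logm.
Proof.
move=> F mF tF mUF; rewrite /logm preimage_bigcup setI_bigcupr.
rewrite ge0_integral_bigcup //.
- by apply: is_cvg_ereal_nneg_natsum_cond => n _ _; apply: logm_ge0.
- by move=> k; apply: measurable_logdom.
- by apply/measurable_EFinP; apply: measurable_wt.
- by move=> y _; rewrite lee_fin wt_ge0.
- apply/trivIsetP => /= i j _ _ ij; apply/seteqP; split=> // y [[_ Fi] [_ Fj]].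
  have : (F i `&` F j) (ln y) by [].
  by move/trivIsetP : tF => /(_ _ _ _ _ ij) ->.
Qed.

HB.instance Definition _ := isMeasure.Build _ _ _
  logm logm0 logm_ge0 logm_sigma_additive.

Lemma logmE B : measurable B -> logm B = mu B.
Proof.
move=> mB; apply/esym/lebesgue_measure_unique => // _ [[a b]] _ <-.
rewrite lebesgue_measure_itv /= lte_fin /logm.
have -> : `]0%R, +oo[ `&` (@ln R) @^-1` `]a, b] = `]expR a, expR b]%classic.
  apply/seteqP; split=> y /=; rewrite !in_itv /= andbT.
    by move=> [y0 /andP[h1 h2]]; rewrite -[y]lnK // ltr_expR ler_expR h1.
  move=> /andP[h1 h2]; have y0 : 0 < y by apply: lt_trans h1; exact: expR_gt0.
  by split=> //; rewrite -ltr_expR -ler_expR lnK // h1.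
have [ab|ba] := ltP a b; last first.
  by rewrite set_itv_ge ?integral_set0 // bnd_simp -leNgt ler_expR.
have eab : expR a < expR b by rewrite ltr_expR.
rewrite integral_itv_obnd_cbnd; last by apply/measurable_EFinP; apply: measurable_wt.
have pos y : expR a <= y -> 0 < y by apply: lt_le_trans; exact: expR_gt0.
rewrite (@continuous_FTC2 R wt (@ln R) (expR a) (expR b) eab).
- by rewrite !expRK.
- apply: continuous_in_subspaceT => y; rewrite inE /= in_itv /= => /andP[/pos y0 _].
  apply: continuous_comp; last exact: continuous_expR.
  by apply: continuousN; apply: continuous_ln.
- split.
  + move=> y; rewrite in_itv /= => /andP[/ltW/pos y0 _].
    by have := is_derive1_ln y0 => -[].
  + by apply: cvg_at_right_filter; apply: continuous_ln; exact: expR_gt0.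
  + by apply: cvg_at_left_filter; apply: continuous_ln; exact: expR_gt0.
- move=> y; rewrite in_itv /= => /andP[/ltW/pos y0 _].
  by rewrite wtE // derive1E; have := is_derive1_ln y0 => -[].
Qed.

End LogMeasure.

Section LebesgueAffine.
Variable R : realType.
Local Notation T := (measurableTypeR R).
Local Notation mu := (@lebesgue_measure R).

Lemma measurable_preimage (f : T -> T) (B : set T) : measurable_fun setT f ->
  measurable B -> measurable (f @^-1` B).
Proof. by move=> mf mB; rewrite -[X in measurable X]setTI; apply: mf. Qed.

Lemma lebesgue_translation (t : R) (B : set T) : measurable B ->
  mu ((fun x => x + t) @^-1` B) = mu B.
Proof.
move=> mB; pose f : T -> T := fun x => x + t.
have mf : measurable_fun setT f by apply: measurable_funD.
rewrite -[LHS]/(pushforward mu f B).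
apply/esym/(@lebesgue_measure_unique R (pushforward mu f)) => // _ [[a b]] _ <-.
rewrite -[RHS]/(mu (f @^-1` `]a, b])) /=.
have -> : f @^-1` `]a, b] = `]a - t, b - t]%classic.
  by apply/seteqP; split=> y; rewrite /f /= !in_itv /= ltrBlDr lerBrDr.
by rewrite !lebesgue_measure_itv /= !lte_fin ltrD2r; case: ltP => // _; congr EFin; ring.
Qed.

Lemma lebesgue_reflection (t : R) (B : set T) : measurable B ->
  mu ((fun x => - x + t) @^-1` B) = mu B.
Proof.
move=> mB; have mB' : measurable ((fun x : T => x + t) @^-1` B).
  by apply: measurable_preimage => //; apply: measurable_funD.
rewrite -(lebesgue_translation t mB) -(lebesgue_measureN mB') /pushforward.
by congr (mu _).
Qed.

Lemma lebesgue_scale (c : R) (B : set T) : 0 < c -> measurable B ->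
  mu B = (c%:E * mu ((fun x => (x * c)%R) @^-1` B))%E.
Proof.
move=> c0 mB; pose f : T -> T := fun x => x * c.
have mf : measurable_fun setT f by apply: measurable_funM.
apply: (@lebesgue_measure_unique R (mscale (NngNum (ltW c0)) (pushforward mu f))) => // _ [[a b]] _ <-.
rewrite -[RHS]/(c%:E * mu (f @^-1` `]a, b]))%E /=.
have -> : f @^-1` `]a, b] = `]a / c, b / c]%classic.
  by apply/seteqP; split=> y; rewrite /f /= !in_itv /= ltr_pdivrMr // ler_pdivlMr.
rewrite !lebesgue_measure_itv /= !lte_fin ltr_pM2r ?invr_gt0 //; case: ltP => [_|_]; last by rewrite mule0.
by rewrite -EFinM; congr EFin; field; rewrite gt_eqF.
Qed.

End LebesgueAffine.

Section Slices.
Variable R : realType.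
Local Notation T := (measurableTypeR R).
Local Notation mu := (@lebesgue_measure R).
Implicit Types E : set (T * T).
Local Open Scope ereal_scope.

(** Area for [ds dr]. With [x = s e^r] and [y = e^r] it is the hyperbolic area, and
    isometries act by shears, reflections and translations of the slices. *)
Definition slice_area E : \bar R := \int[mu]_s mu [set r | E (s, r)].

Lemma measurable_slice1 E s : measurable E -> measurable [set r | E (s, r)].
Proof. by move=> mE; have := measurable_xsection s mE; rewrite xsectionE. Qed.

Lemma measurable_slice2 E r : measurable E -> measurable [set s | E (s, r)].
Proof. by move=> mE; have := measurable_ysection r mE; rewrite ysectionE. Qed.

Lemma int_indic1 E s : measurable E ->
  \int[mu]_r (\1_E (s, r))%:E = mu [set r | E (s, r)].
Proof.
move=> mE; rewrite (eq_integral (fun r => (\1_[set r | E (s, r)] r)%:E)); last first.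
  by move=> r _; rewrite !indicE; congr (_%:R%:E); apply/idP/idP; rewrite !inE.
by rewrite integral_indic ?setIT //; apply: measurable_slice1.
Qed.

Lemma int_indic2 E r : measurable E ->
  \int[mu]_s (\1_E (s, r))%:E = mu [set s | E (s, r)].
Proof.
move=> mE; rewrite (eq_integral (fun s => (\1_[set s | E (s, r)] s)%:E)); last first.
  by move=> s _; rewrite !indicE; congr (_%:R%:E); apply/idP/idP; rewrite !inE.
by rewrite integral_indic ?setIT //; apply: measurable_slice2.
Qed.

Lemma slice_area_swap E : measurable E ->
  slice_area E = \int[mu]_r mu [set s | E (s, r)].
Proof.
move=> mE; rewrite /slice_area; under eq_integral do rewrite -int_indic1 //.
rewrite (@fubini_tonelli _ _ T T R mu mu (fun p => (\1_E p)%:E)) /=.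
- by apply: eq_integral => r _; apply: int_indic2.
- by apply/measurable_EFinP; apply: measurable_indic.
- by move=> p; rewrite lee_fin indicE.
Qed.

Lemma slice_area_eq2 E E' : measurable E -> measurable E' ->
  (forall r, mu [set s | E (s, r)] = mu [set s | E' (s, r)]) ->
  slice_area E = slice_area E'.
Proof. by move=> mE mE' h; rewrite !slice_area_swap //; apply: eq_integral => r _. Qed.

Lemma measurable_preimage2 (f : T * T -> T * T) E : measurable_fun setT f ->
  measurable E -> measurable (f @^-1` E).
Proof. by move=> mf mE; rewrite -[X in measurable X]setTI; apply: mf. Qed.

Lemma measurable_shear1 (g : T -> T) : measurable_fun setT g ->
  measurable_fun setT (fun p : T * T => ((p.1 + g p.2)%R, p.2)).
Proof.
move=> mg; apply: measurable_fun_pair => //.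
by apply: measurable_funD => //; apply: measurableT_comp.
Qed.

Lemma slice_area_shear (g : T -> T) E : measurable_fun setT g -> measurable E ->
  slice_area [set p | E ((p.1 + g p.2)%R, p.2)] = slice_area E.
Proof.
move=> mg mE; have mE' := measurable_preimage2 (measurable_shear1 mg) mE.
apply: slice_area_eq2 => // r.
exact: (lebesgue_translation (g r) (measurable_slice2 r mE)).
Qed.

Lemma measurable_flip (g : T -> T) : measurable_fun setT g ->
  measurable_fun setT (fun p : T * T => ((- p.1)%R, (- p.2 + g p.1)%R)).
Proof.
move=> mg; apply: measurable_fun_pair; first exact: measurable_funN.
by apply: measurable_funD; [exact: measurable_funN | apply: measurableT_comp].
Qed.

Lemma slice_area_flip (g : T -> T) E : measurable_fun setT g -> measurable E ->
  slice_area [set p | E ((- p.1)%R, (- p.2 + g p.1)%R)] = slice_area E.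
Proof.
move=> mg mE; pose E1 : set (T * T) := [set p | E ((- p.1)%R, p.2)].
have mE1 : measurable E1.
  apply: (@measurable_preimage2 (fun p => ((- p.1)%R, p.2))) => //.
  by apply: measurable_fun_pair => //; exact: measurable_funN.
rewrite -[RHS](@slice_area_eq2 E1) //; last first.
  move=> r; have := lebesgue_reflection 0 (measurable_slice2 r mE).
  by under eq_fun do rewrite addr0.
apply: eq_integral => s _.
exact: (lebesgue_reflection (g s) (measurable_slice1 s mE1)).
Qed.

End Slices.

Section AreaInSlices.
Variable R : realType.
Local Notation T := (measurableTypeR R).
Local Notation mu := (@lebesgue_measure R).

Lemma measurable_dilate (g : T -> T) : measurable_fun setT g ->
  measurable_fun setT (fun p : T * T => (p.1 * g p.2, g p.2)).
Proof.
move=> mg; apply: measurable_fun_pair; last exact: measurableT_comp.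
by apply: measurable_funM => //; apply: measurableT_comp.
Qed.

Lemma measurable_weighted (E : set (T * T)) : measurable E ->
  measurable_fun setT (fun p : T * T => (wt p.2 * \1_E p)%:E).
Proof.
move=> mE; apply/measurable_EFinP; apply: measurable_funM; last exact: measurable_indic.
by apply: measurableT_comp => //; exact: measurable_wt.
Qed.

Lemma measurable_weighted2 (E : set (T * T)) : measurable E ->
  measurable_fun setT (fun p : T * T => (wt p.2 * (wt p.2 * \1_E p))%:E).
Proof.
move=> mE; have mw : measurable_fun setT (fun p : T * T => wt p.2).
  by apply: measurableT_comp => //; exact: measurable_wt.
apply/measurable_EFinP; by do 2!apply: measurable_funM => //; exact: measurable_indic.
Qed.

(** The substitution [x = s y] absorbs one of the two factors [1 / y], the
    substitution [y = e^r] the other one. *)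
Lemma plane_area_slices (P : set (T * T)) : measurable P -> (forall p, P p -> 0 < p.2) ->
  (\int[mu \x mu]_(p in P) (p.2 ^- 2)%:E)%E
  = slice_area [set p : T * T | P (p.1 * expR p.2, expR p.2)].
Proof.
move=> mP P0; pose Q : set (T * T) := [set p | P (p.1 * p.2, p.2)].
have mQ : measurable Q.
  apply: (@measurable_preimage2 _ (fun p : T * T => (p.1 * p.2, p.2))) => //.
  exact: (@measurable_dilate id).
rewrite integral_mkcond (eq_integral (fun p => (wt p.2 * (wt p.2 * \1_P p))%:E)); last first.
  move=> p _; rewrite patchE indicE; case: ifPn => [/set_mem /P0 p0|_].
    by rewrite wtE //= mulr1 -invfM.
  by rewrite !mulr0.
rewrite (@fubini_tonelli2 _ _ T T R mu mu) /=.
- rewrite (eq_integral (fun y => \int[mu]_s (wt y * \1_Q (s, y))%:E)%E); last first.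
    move=> y _; rewrite /fubini_G /=.
    under eq_integral do rewrite mulrA EFinM.
    under [RHS]eq_integral do rewrite EFinM.
    have w0 := wt_ge0 y.
    have m1 (E : set (T * T)) : measurable E -> measurable_fun setT (fun s : T => (\1_E (s, y))%:E).
      move=> mE; apply/measurable_EFinP; apply: (measurableT_comp (measurable_indic mE)).
      exact: pair2_measurable.
    rewrite !ge0_integralZl_EFin ?mulr_ge0 //; try by [move=> ? _; rewrite lee_fin indicE | exact: m1].
    rewrite !int_indic2 //; have [y0|y0] := ltP 0 y.
      rewrite (lebesgue_scale y0 (measurable_slice2 y mP)) muleA -EFinM.
      by rewrite -mulrA {2}wtE // mulVf ?mulr1 // gt_eqF.
    have e (E : set (T * T)) : (forall s, ~ E (s, y)) -> mu [set s | E (s, y)] = 0%E.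
      by move=> h; rewrite (_ : [set s | _] = set0) ?measure0 //; apply/seteqP; split=> // s /h.
    by rewrite !e ?mule0 // => s /P0 /=; rewrite ltNge y0.
  rewrite -(@fubini_tonelli _ _ T T R mu mu (fun p => (wt p.2 * \1_Q p)%:E)) /=.
  + apply: eq_integral => s _; rewrite -logmE; last first.
      apply: (@measurable_slice1 _ [set p : T * T | P (p.1 * expR p.2, expR p.2)]).
      by apply: measurable_preimage2 mP; apply: measurable_dilate; exact: measurable_expR.
    rewrite /logm [RHS]integral_mkcond; apply: eq_integral => y _; rewrite patchE indicE.
    case: ifPn => [/set_mem [/= y0 h]|yN].
      rewrite mem_set ?mulr1 //; move: y0 h; rewrite in_itv /= andbT => y0.
      by rewrite lnK.
    rewrite memNset ?mulr0 // => h; move/negP: yN; apply; apply/mem_set.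
    have y0 : 0 < y by apply: P0 h.
    by split; rewrite /= ?in_itv /= ?andbT // lnK.
  + exact: measurable_weighted.
  + by move=> p; rewrite lee_fin mulr_ge0 ?wt_ge0 // indicE.
- exact: measurable_weighted2.
- by move=> p; rewrite lee_fin !mulr_ge0 ?wt_ge0 // indicE.
Qed.

End AreaInSlices.

(** * Invariance of the area *)

Section Isometries.
Variable R : realType.
Local Notation T := (measurableTypeR R).
Implicit Types (D : set R[i]) (A B : 'M[R]_2).

Definition slice_pt (p : T * T) : R[i] := Complex (p.1 * expR p.2) (expR p.2).

Definition slices D : set (T * T) := [set p | D (slice_pt p)].

Lemma hyperbolic_area_slices D : D `<=` @upper_half_plane R -> measurable (plane_coords D) ->
  measurable (slices D) /\ hyperbolic_area D = slice_area (slices D).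
Proof.
move=> DH mD; split.
  apply: (@measurable_preimage2 _ (fun p : T * T => (p.1 * expR p.2, expR p.2)) _ _ mD).
  by apply: measurable_dilate; exact: measurable_expR.
by rewrite /hyperbolic_area plane_area_slices // => -[x y] /DH.
Qed.

Lemma mobius_denom_neq0 A z : \det A = 1 -> 0 < complex.Im z ->
  ((A 1 0)%:C * z + (A 1 1)%:C)%C != 0.
Proof.
case: z => x y /=; rewrite det2E => dA y0; apply/eqP.
simpc => -[e1 e2]; have c0 : A 1 0 = 0.
  by apply/eqP; move/eqP: e2; rewrite mulf_eq0 (gt_eqF y0) orbF.
by move: dA; rewrite c0 in e1 *; rewrite mul0r add0r in e1; rewrite e1 !mulr0 subr0 => /esym/eqP; rewrite oner_eq0.
Qed.

Lemma mobiusM A B z : \det B = 1 -> 0 < complex.Im z ->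
  mobius (A *m B) z = mobius A (mobius B z).
Proof.
move=> dB z0; have := mobius_denom_neq0 dB z0; rewrite /mobius !mulmx2E !rmorphD !rmorphM /=.
set u := (_ + _ : R[i]) => u0.
have e (a b : R[i]) : a * (((B 0 0)%:C * z + (B 0 1)%:C) / u)%C + b =
    (a * ((B 0 0)%:C * z + (B 0 1)%:C)%C + b * u) / u by field.
rewrite !e -mulf_div divff ?invr_neq0 // mulr1; congr (_ / _); rewrite /u; ring.
Qed.

Definition slice_isometry A := exists f : T * T -> T * T,
  [/\ forall p, mobius A (slice_pt p) = slice_pt (f p), measurable_fun setT f
    & forall E, measurable E -> slice_area (f @^-1` E) = slice_area E].

Lemma slice_isometryM A B : \det B = 1 -> slice_isometry A -> slice_isometry B ->
  slice_isometry (A *m B).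
Proof.
move=> dB [f [fE mf areaf]] [g [gE mg areag]]; exists (f \o g); split.
- by move=> p; rewrite mobiusM ?expR_gt0 // gE fE.
- exact: measurableT_comp.
- move=> E mE; rewrite comp_preimage areag ?areaf //.
  exact: measurable_preimage2.
Qed.

Lemma slice_isometry_translation t : slice_isometry (mx2 1 t 0 1).
Proof.
pose g (r : T) : T := t * expR (- r).
have mg : measurable_fun setT g.
  by apply: measurable_funM => //; apply: measurableT_comp => //; exact: measurable_expR.
exists (fun p => (p.1 + g p.2, p.2)); split; first 1 last.
- exact: measurable_shear1.
- by move=> E mE; exact: slice_area_shear.
move=> [s r]; rewrite /mobius !mx2_entry /slice_pt /g /= rmorph0 rmorph1 mul0r add0r divr1 mul1r.
by simpc; rewrite mulrDl -mulrA -expRD addNr expR0 mulr1.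
Qed.

Lemma slice_isometry_inversion : slice_isometry (mx2 0 (-1) 1 0).
Proof.
pose g (s : T) : T := - ln (1 + s ^+ 2).
have mg : measurable_fun setT g.
  apply: measurableT_comp => //; apply: measurableT_comp; first exact: measurable_ln.
  by apply: measurable_funD.
exists (fun p => (- p.1, - p.2 + g p.1)); split; first 1 last.
- exact: measurable_flip.
- by move=> E mE; exact: slice_area_flip.
move=> [s r]; have z0 : (slice_pt (s, r) : R[i]) != 0.
  by apply/eqP => -[_ /eqP]; rewrite gt_eqF ?expR_gt0.
have n0 : 0 < 1 + s ^+ 2 by rewrite ltr_wpDr ?sqr_ge0.
rewrite /mobius !mx2_entry !rmorph0 !rmorph1 rmorphN1 mul0r mul1r add0r addr0.
apply: (mulIf z0); rewrite divfK // /slice_pt /g /=.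
have e0 : expR r != 0 by rewrite gt_eqF ?expR_gt0.
simpc; rewrite expRD !expRN lnK // .
by congr Complex; field; rewrite e0 gt_eqF.
Qed.

Lemma mobius_diag a (p : T * T) : a != 0 ->
  mobius (mx2 a 0 0 a^-1) (slice_pt p) = slice_pt (p.1, p.2 + ln (a ^+ 2)).
Proof.
move=> a0; have a20 : 0 < a ^+ 2 by rewrite exprn_even_gt0.
rewrite /mobius !mx2_entry /slice_pt /= rmorph0 mul0r add0r addr0 fmorphV invrK.
by simpc; rewrite expRD lnK //; congr Complex; ring.
Qed.

Lemma slice_isometry_diag a : a != 0 -> slice_isometry (mx2 a 0 0 a^-1).
Proof.
move=> a0; exists (fun p => (p.1, p.2 + ln (a ^+ 2))); split.
- by move=> p; exact: mobius_diag.
- by apply: measurable_fun_pair => //; apply: measurable_funD.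
- move=> E mE; apply: eq_integral => s _.
  exact: (lebesgue_translation (ln (a ^+ 2)) (measurable_slice1 s mE)).
Qed.

(** The Bruhat decomposition. *)
Lemma slice_isometry_SL2 A : \det A = 1 -> slice_isometry A.
Proof.
move=> dA; have [c0|c0] := eqVneq (A 1 0) 0.
  move: dA; rewrite det2E c0 mulr0 subr0 => ad.
  have a0 : A 0 0 != 0 by apply: contra_eq_neq ad => ->; rewrite mul0r eq_sym oner_eq0.
  have d1 : A 1 1 = (A 0 0)^-1 by apply: (mulfI a0); rewrite ad divff.
  have -> : A = mx2 1 (A 0 0 * A 0 1) 0 1 *m mx2 (A 0 0) 0 0 (A 0 0)^-1.
    by rewrite {1}(mx2E A) mx2M c0 d1; congr mx2; field.
  apply: slice_isometryM; first by rewrite det2E !mx2_entry mulr0 subr0 divff.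
    exact: slice_isometry_translation.
  exact: slice_isometry_diag.
have -> : A = mx2 1 (A 0 0 / A 1 0) 0 1 *m (mx2 0 (-1) 1 0 *m
    (mx2 (A 1 0) 0 0 (A 1 0)^-1 *m mx2 1 (A 1 1 / A 1 0) 0 1)).
  rewrite {1}(mx2E A) !mx2M; congr mx2; try by field.
  have -> : A 0 1 = (A 0 0 * A 1 1 - 1) / A 1 0.
    by apply: (mulIf c0); rewrite divfK //; move: dA; rewrite det2E; lra.
  by field.
have d1 : \det (mx2 (A 1 0) 0 0 (A 1 0)^-1) = 1.
  by rewrite det2E !mx2_entry mulr0 subr0 divff.
have d2 : \det (mx2 1 (A 1 1 / A 1 0) 0 1) = 1 by rewrite det2E !mx2_entry mulr0 subr0 mul1r.
apply: slice_isometryM; rewrite ?det_mulmx ?d1 ?d2 ?mulr1.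
- by rewrite det2E !mx2_entry; ring.
- exact: slice_isometry_translation.
- apply: slice_isometryM; rewrite ?det_mulmx ?d1 ?d2 ?mulr1 //.
    exact: slice_isometry_inversion.
  apply: slice_isometryM => //; first exact: slice_isometry_diag.
  exact: slice_isometry_translation.
Qed.

End Isometries.

(** * Finite coarea and axes *)

Section DiagonalCoarea.
Variable R : realType.
Local Notation T := (measurableTypeR R).
Local Notation mu := (@lebesgue_measure R).

(** The parts of [E] in the disjoint intervals [l <= r < l + c], translated by [- l],
    cover the interval from 0 to [c]. *)
Lemma lebesgue_tiles (L : set R) (c : R) (E : set T) : 0 < c -> measurable E ->
  (forall l l', L l -> L l' -> l != l' -> c <= `|l - l'|) ->
  (forall r, exists2 l, L l & E (r + l)) -> (c%:E <= mu E)%E.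
Proof.
move=> c0 mE gap cover; pose cell (l : R) := pickle (Num.floor (l / c)).
have cell_inj l l' : L l -> L l' -> cell l = cell l' -> l = l'.
  move=> Ll Ll' /(pcan_inj pickleK) e; apply/eqP; apply: contraT => /(gap _ _ Ll Ll').
  have /andP[] := floor_itv (l / c); have /andP[] := floor_itv (l' / c).
  rewrite -e intrD ler_pdivlMr // ltr_pdivrMr // ler_pdivlMr // ltr_pdivrMr // mulrDl mul1r.
  by move=> h1 h2 h3 h4; rewrite leNgt ltr_norml => /negP[]; apply/andP; split; lra.
pose F n : set T := [set r | 0 <= r < c /\ exists l, [/\ L l, cell l = n & E (r + l)]].
pose H n : set T := [set r | E r /\ exists l, [/\ L l, cell l = n & l <= r < l + c]].
have FH n : [/\ measurable (F n), measurable (H n) & mu (F n) = mu (H n)].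
  have [[l [Ll ln]]|none] := pselect (exists l, L l /\ cell l = n); last first.
    have -> : F n = set0.
      by apply/seteqP; split=> // r [_ [l [Ll ln _]]]; apply: none; exists l.
    have -> : H n = set0.
      by apply/seteqP; split=> // r [_ [l [Ll ln _]]]; apply: none; exists l.
    by split.
  have mH : measurable (H n).
    have -> : H n = E `&` `[l, l + c[%classic.
      apply/seteqP; split=> r /=; rewrite in_itv /=.
        by move=> [Er [l' [Ll' l'n h]]]; rewrite (cell_inj l l') // ln l'n.
      by move=> [Er h]; split=> //; exists l.
    exact: measurableI.
  have FE : F n = (fun r => r + l) @^-1` H n.
    apply/seteqP; split=> r /=.
      move=> [/andP[r0 rc] [l' [Ll' l'n]]]; rewrite (cell_inj l' l) ?ln // => h.
      by split=> //; exists l; split=> //; apply/andP; split; lra.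
    move=> [Er [l' [Ll' l'n]]]; rewrite (cell_inj l' l) ?ln // => /andP[h1 h2].
    by split; [apply/andP; split; lra | exists l].
  split=> //; last by rewrite FE lebesgue_translation.
  by rewrite FE; apply: measurable_preimage => //; apply: measurable_funD.
have <- : mu `[0, c[%classic = c%:E.
  by rewrite lebesgue_measure_itv /= lte_fin c0 sube0.
have sub : `[0, c[%classic `<=` \bigcup_n F n.
  move=> r /=; rewrite in_itv /= => rc; have [l Ll Er] := cover r.
  by exists (cell l) => //; split=> //; exists l.
have mF n := let: And3 h _ _ := FH n in h.
have mH n := let: And3 _ h _ := FH n in h.
have mI : measurable (`[0, c[%classic : set T) by [].
apply: le_trans (measure_sigma_subadditive mu mF mI sub) _.
rewrite (eq_eseriesr (g := fun n => mu (H n))); last by move=> n _; case: (FH n).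
rewrite -measure_semi_bigcup //; last 2 first.
- apply/trivIsetP => i j _ _ ij; apply/seteqP; split=> // r.
  move=> [[_ [l [Ll li /andP[l1 l2]]]] [_ [l' [Ll' l'j /andP[l'1 l'2]]]]].
  have ll : l != l' by apply: contra_neq ij => e; rewrite -li -l'j e.
  have := gap _ _ Ll Ll' ll; rewrite leNgt ltr_norml => /negP; apply.
  by apply/andP; split; lra.
- exact: bigcup_measurable.
apply: le_measure; rewrite ?inE //; first exact: bigcup_measurable.
by move=> r [n _ [Er _]].
Qed.

(** Only finitely many elements have logarithms in a given bounded interval. *)
Lemma diagonal_gap G M : \det M = 1 -> PSL2_subgroup G -> discrete_subgroup G ->
  exists2 c : R, 0 < c & forall a, conjG M G (mx2 a 0 0 a^-1) -> a != 0 ->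
    ln (a ^+ 2) != 0 -> c <= `|ln (a ^+ 2)|.
Proof.
move=> dM hG dG; pose Z : set 'M[R]_2 := [set X | [/\ conjG M G X,
  forall i j, `|X i j| <= expR 1 & ln (X 0 0 ^+ 2) != 0]].
have finZ : finite_set Z.
  apply: sub_finite_set (conj_bounded_finite (expR 1) dM hG dG).
  by move=> X [].
have small a : conjG M G (mx2 a 0 0 a^-1) -> a != 0 -> ln (a ^+ 2) != 0 ->
    `|ln (a ^+ 2)| < 1 -> Z (mx2 a 0 0 a^-1).
  move=> Ga a0 l0 l1; split; rewrite ?mx2_entry //.
  have a20 : 0 < a ^+ 2 by rewrite exprn_even_gt0.
  have e1 : 1 <= expR 1 :> R by rewrite -{1}expR0 ler_expR.
  have bnd (x : R) : x != 0 -> ln (x ^+ 2) < 1 -> `|x| <= expR 1.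
    move=> x0 lx; have x20 : 0 < x ^+ 2 by rewrite exprn_even_gt0.
    have : x ^+ 2 < expR 1 by rewrite -[x ^+ 2]lnK // ltr_expR.
    rewrite -real_normK ?num_real // leNgt => h; apply/negP => h'; move: h.
    by rewrite ltNge => /negP[]; move: (expR 1) e1 h' => u; nra.
  move: l1; rewrite ltr_norml => /andP[l1 l2].
  apply: ord2P; apply: ord2P; rewrite mx2_entry ?normr0 ?expR_ge0 //; apply: bnd => //.
    by rewrite invr_eq0.
  by rewrite exprVn lnV ?posrE //; lra.
have [Z0|] := pselect (Z !=set0); last first.
  move=> nZ; exists 1 => // a Ga a0 l0; rewrite leNgt; apply/negP => l1.
  by apply: nZ; exists (mx2 a 0 0 a^-1); apply: small.
have [X [GX _ X0] Xmin] :=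
  finite_argmax (fun X : 'M[R]_2 => - `|ln (X 0 0 ^+ 2)|) finZ Z0.
exists (Num.min 1 `|ln (X 0 0 ^+ 2)|); first by rewrite lt_min ltr01 normr_gt0.
move=> a Ga a0 l0; rewrite ge_min; have [//|l1] := leP 1 `|ln (a ^+ 2)|.
by have := Xmin _ (small a Ga a0 l0 l1); rewrite mx2_entry lerN2.
Qed.

Lemma slice_area_ge E (c : R) : measurable E -> 0 < c ->
  (forall s, c%:E <= mu [set r : T | E (s, r)])%E -> slice_area E = +oo%E.
Proof.
move=> mE c0 hE; apply/eqP; rewrite -leye_eq.
have <- : (\int[mu]_(s in setT) (cst c%:E) s = +oo)%E.
  rewrite integral_cst //= (_ : mu setT = +oo%E) ?gt0_muley ?lte_fin //.
  by have := @lebesgue_measure_itv R `]-oo, +oo[; rewrite set_itvNyy.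
apply: ge0_le_integral => //.
- by move=> s _; rewrite lee_fin ltW.
- have := measurable_fun_xsection mu mE.
  by congr measurable_fun; apply/funext => s; rewrite /= xsectionE.
Qed.

Implicit Types (G : set 'M[R]_2) (M A : 'M[R]_2).

(** A group of diagonal matrices translates each slice [s] by a discrete group of
    logarithms. Every slice of a fundamental domain then has length at least the
    gap [c] of that group, and the area is infinite. *)
Lemma not_diagonal G M : surface_group G -> \det M = 1 ->
  exists2 X, conjG M G X & X 0 1 != 0 \/ X 1 0 != 0.
Proof.
move=> [hG dG _ [D [[DH fund] mD areaD]]] dM; apply: contrapT => nex.
have Mu : M \in unitmx by rewrite unitmxE dM unitr1.
have hG' := PSL2_conj dM hG; have [_ G'det G'M G'V _] := hG'.
have diagP X : conjG M G X -> X 0 0 != 0 /\ X = mx2 (X 0 0) 0 0 (X 0 0)^-1.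
  move=> GX; have e01 : X 0 1 = 0.
    by apply/eqP; apply: contraT => h; case: nex; exists X => //; left.
  have e10 : X 1 0 = 0.
    by apply/eqP; apply: contraT => h; case: nex; exists X => //; right.
  have := G'det _ GX; rewrite det2E e01 mul0r subr0 => d.
  have x0 : X 0 0 != 0 by apply: contra_eq_neq d => ->; rewrite mul0r eq_sym oner_eq0.
  by split=> //; rewrite {1}(mx2E X) e01 e10; congr mx2; apply: (mulfI x0); rewrite d divff.
have [c c0 gap] := diagonal_gap dM hG dG.
have [mS areaE] := hyperbolic_area_slices DH mD.
have [f [fE mf areaf]] := slice_isometry_SL2 dM.
pose E := f @^-1` slices D; have mE : measurable E by exact: measurable_preimage2.
pose L : set R := [set ln (X 0 0 ^+ 2) | X in conjG M G].
suff : slice_area E = +oo%E by rewrite areaf // -areaE => h; move: areaD; rewrite h ltxx.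
apply: (slice_area_ge mE c0) => // s.
apply: (lebesgue_tiles (L := L)) => //; first exact: measurable_slice1.
- move=> _ _ [X GX <-] [Y GY <-] XY.
  have [x0 Xd] := diagP X GX; have [y0 Yd] := diagP Y GY.
  have sq (z : R) : z != 0 -> z ^+ 2 \is Num.pos by move=> z0; rewrite posrE exprn_even_gt0.
  have e : ln ((X 0 0 / Y 0 0) ^+ 2) = ln (X 0 0 ^+ 2) - ln (Y 0 0 ^+ 2).
    by rewrite expr_div_n ln_div ?sq.
  rewrite -e; apply: gap; rewrite ?mulf_neq0 ?invr_neq0 // ?e ?subr_eq0 //.
  have := G'M _ _ GX (G'V _ GY); rewrite (invmx2 (G'det _ GY)) {1}Xd Yd mx2M !mx2_entry.
  by congr (conjG M G _); congr mx2; field; rewrite ?x0 ?y0.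
- move=> r; have up : upper_half_plane (mobius M (slice_pt (s, r))).
    by rewrite fE; exact: expR_gt0.
  have [w [[Dw [A GA wE]] _]] := fund _ up.
  pose X := invmx M *m A *m M.
  have GX : conjG M G X by rewrite /conjG /X /= !mulmxA mulmxV // mul1mx mulmxK.
  have [x0 Xd] := diagP X GX; exists (ln (X 0 0 ^+ 2)); first by exists X.
  rewrite /E /slices /= -fE -(mobius_diag (s, r) x0) -Xd -mobiusM ?(G'det _ GX) ?expR_gt0 //.
  by rewrite /X !mulmxA mulmxV // mul1mx mobiusM ?expR_gt0 // -wE.
Qed.

Lemma trace0_elliptic A : \det A = 1 -> \tr A = 0 -> exists2 z : R[i], upper_half_plane z & mobius A z = z.
Proof.
rewrite det2E tr2E => dA tA; have d : A 1 1 = - A 0 0 by lra.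
have c0 : A 1 0 != 0.
  by apply/eqP => c0; move: dA; rewrite d c0; nra.
have n0 : 0 < `|A 1 0| by rewrite normr_gt0.
pose z : R[i] := Complex (A 0 0 / A 1 0) `|A 1 0|^-1.
have z0 : 0 < complex.Im z by rewrite invr_gt0.
exists z => //; have dA' : \det A = 1 by rewrite det2E.
apply: (mulIf (mobius_denom_neq0 dA' z0)); rewrite divfK ?mobius_denom_neq0 // /z d.
have nn : `|A 1 0| ^+ 2 = A 1 0 ^+ 2 by rewrite real_normK ?num_real.
have b : A 0 1 = - (A 0 0 ^+ 2 + 1) / A 1 0.
  by apply: (mulIf c0); rewrite divfK //; move: dA; rewrite d; lra.
simpc; rewrite b; congr Complex; last by field; rewrite c0 gt_eqF.
have -> : `|A 1 0|^-1 * (A 1 0 * `|A 1 0|^-1) = (A 1 0)^-1.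
  by rewrite mulrCA -invfM -expr2 nn; field.
by field.
Qed.

(** A non-diagonal element that preserves the pair formed by 0 and infinity exchanges
    the two points and has trace zero. It then has a fixed point in the half-plane,
    which freeness excludes. *)
Lemma off_axis G M : surface_group G -> \det M = 1 ->
  exists2 X, conjG M G X & X 0 0 * X 1 0 != 0 \/ X 0 1 * X 1 1 != 0.
Proof.
move=> hS dM; have [X GX hX] := not_diagonal hS dM; exists X => //.
have Mu : M \in unitmx by rewrite unitmxE dM unitr1.
case: hS => hG _ free _; have := PSL2_conj dM hG => -[_ /(_ _ GX) dX _ _ _].
apply: contrapT => /not_orP[/negP + /negP]; rewrite !negbK !mulf_eq0 => h0 h1.
have tX : \tr X = 0.
  move: dX h0 h1 hX; rewrite det2E tr2E => dX.
  case/orP=> /eqP e; rewrite e in dX *; case/orP=> /eqP e'; rewrite e' in dX *;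
    try lra; by case=> /eqP; case.
have tA : \tr (M *m X *m invmx M) = 0 by rewrite mxtrace_mulC mulmxA mulVmx // mul1mx.
have dA : \det (M *m X *m invmx M) = 1 by rewrite !det_mulmx det_inv dM dX invr1 !mul1r.
have [z z0 fz] := trace0_elliptic dA tA.
move: dX tA; case: (free _ _ GX z0 fz) => e dX; rewrite e tr2E !mxE /=; lra.
Qed.

End DiagonalCoarea.

(** * The collar lemma *)

Section Assembly.
Variables (R : realType) (G : set 'M[R]_2) (F : rcfType) (n : nat).
Variables (V : vectType F) (om : {skew_symmetric V}) (rho : 'M[R]_2 -> 'End(V)).
Hypotheses (hG : PSL2_subgroup G) (n_gt0 : (0 < n)%N) (dimV : \dim {:V} = (n + n)%N).
Hypotheses (om_symplectic : is_psymplectic om) (hrho : symplectic_representation om G rho).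

Lemma hyperbolic_normal A : G A -> hyperbolic A -> exists M k s,
  [/\ \det M = 1, 1 < k, s != 0, A = M *m mx2 (s * k) 0 0 (s * k^-1) *m invmx M
    & conjG M G (mx2 k 0 0 k^-1) /\ conj_rep M rho (mx2 k 0 0 k^-1) = rho A].
Proof.
case: hG hrho => _ dG _ _ GN [_ _ rhoN] GA; rewrite /hyperbolic.
have dA := dG _ GA; case: (ger0P (\tr A)) => _ tA.
  have [M [k [dM k1 AE]]] := diagonalize dA tA; exists M, k, 1.
  by rewrite !mul1r /conjG /conj_rep /= -AE; split=> //; exact: oner_neq0.
have dNA : \det (- A) = 1 by move: dA; rewrite !det2E !mxE => <-; ring.
have tNA : 2 < \tr (- A) by rewrite tr2E !mxE -opprD -tr2E.
have [M [k [dM k1 AE]]] := diagonalize dNA tNA; exists M, k, (-1).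
rewrite !mulN1r /conjG /conj_rep /= -AE; split=> //.
- by rewrite -{1}[A]opprK AE -mulNmx -mulmxN mx2N oppr0.
- by split; [apply: GN | rewrite rhoN].
Qed.

Section Framed.
Variables (S : R * R -> Prop) (Phi : R * R -> {vspace V}).
Hypothesis fr : vframing om G rho S Phi.

(** Besides the end points of the axis of [A], the framing is defined at their
    images under an element that does not preserve the axis. *)
Lemma framed_spectrum A : surface_group G -> G A -> hyperbolic A ->
  (forall z, z \in eigenvalues (rho A) -> Normc.normc z <> 1) /\
  size (expanding_eigenvalues (rho A)) = n.
Proof.
move=> hS GA hA; have [M [k [s [dM k1 _ _ [GD <-]]]]] := hyperbolic_normal GA hA.
have hG' := PSL2_conj dM hG; have hrho' := rep_conj dM hrho.
have fr' := vframing_conj dM fr.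
have k0 : 0 < k by lra.
have hD : hyperbolic (mx2 k 0 0 k^-1).
  have kk : k * k^-1 = 1 by rewrite divff ?gt_eqF.
  have kV : 0 < k^-1 by rewrite invr_gt0.
  by rewrite /hyperbolic tr2E !mx2_entry ger0_norm; nra.
have Se v l : v != (0, 0) -> act (mx2 k 0 0 k^-1) v = (l * v.1, l * v.2) -> S (act M v).
  by move=> v0 /(vf_fixed fr' GD hD v0).
have [X GX hX] := off_axis hS dM.
have dX : \det X = 1 by case: hG' => _ + _ _ _; apply.
case: hX; rewrite mulf_eq0 negb_or => /andP[x0 x1].
  have e0 : ((1, 0) : R * R) != (0, 0) by rewrite xpair_eqE oner_eq0.
  apply: (diag_spectrum dimV om_symplectic hG' hrho' fr' (v := act X (1, 0))) => //.
  - by rewrite /act /= mulr1 mulr0 addr0.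
  - by rewrite /act /= mulr1 mulr0 addr0.
  - apply: (vf_stable fr') => //; apply: (Se _ k) => //.
    by rewrite /act !mx2_entry /=; congr pair; ring.
have e0 : ((0, 1) : R * R) != (0, 0) by rewrite xpair_eqE oner_eq0 andbF.
apply: (diag_spectrum dimV om_symplectic hG' hrho' fr' (v := act X (0, 1))) => //.
- by rewrite /act /= mulr1 mulr0 add0r.
- by rewrite /act /= mulr1 mulr0 add0r.
- apply: (vf_stable fr') => //; apply: (Se _ k^-1) => //.
  by rewrite /act !mx2_entry /=; congr pair; ring.
Qed.

(** In an eigenbasis of [A], replacing [B] by a conjugate, by its opposite and by
    its inverse changes no eigenvalue of [rho B]. This reaches the normalized
    situation, then a crossing of smallest angle. *)
Lemma framed_collar A B : discrete_subgroup G -> G A -> G B ->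
  hyperbolic A -> hyperbolic B -> positive_intersection G A B ->
  let lamA i := Normc.normc (expanding_eigenvalues (rho A))`_i in
  let lamB i := Normc.normc (expanding_eigenvalues (rho B))`_i in
  1 / (lamB n.-1 ^+ 2 - 1) <= lamA 0%N ^+ (2 * n) /\
  1 <= (\prod_(i < n) pos_root n (lamA i ^+ 2) - 1)
       * (\prod_(i < n) pos_root n (lamB i ^+ 2) - 1).
Proof.
move=> dG GA GB hA hB [C GC [neq meet]].
have [M [k [s [dM k1 s0 AE [GD rD]]]]] := hyperbolic_normal GA hA.
have hG' := PSL2_conj dM hG; have hrho' := rep_conj dM hrho.
have fr' := vframing_conj dM fr.
have Mu : M \in unitmx by rewrite unitmxE dM unitr1.
have [_ G'det G'M G'V G'N] := hG'; have [_ _ rhoN'] := hrho'.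
have [_ Gdet GM GV _] := hG.
have Cu : C \in unitmx by rewrite unitmxE Gdet ?unitr1.
pose B' := C *m B *m invmx C.
have GB' : G B' by apply: (GM _ _ (GM _ _ GC GB)); apply: GV.
have hB' : hyperbolic B' by rewrite hyperbolic_conj.
pose X := invmx M *m B' *m M.
have XE : M *m X *m invmx M = B' by rewrite /X !mulmxA mulmxV // mul1mx mulmxK.
have GX : conjG M G X by rewrite /conjG /= XE.
have hX : hyperbolic X by rewrite -(hyperbolic_conj X Mu) XE.
have k0 : 0 < k by lra.
have kV : k^-1 < 1 by rewrite invf_lt1.
have sk : s * k != s * k^-1 by rewrite (inj_eq (mulfI s0)) gt_eqF //; lra.
have off := crossing_offdiag (Gdet _ GA) (Gdet _ GB') dM sk hB' AE neq meet.
rewrite -/X in off; move: X XE GX hX off => X XE GX hX off.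
have [Y [GY tY oY ev]] : exists Y, [/\ conjG M G Y, 2 < \tr Y, 0 < Y 0 1 * Y 1 0
    & eigenvalues (conj_rep M rho Y) = eigenvalues (rho B)].
  have evX : eigenvalues (conj_rep M rho X) = eigenvalues (rho B).
    by rewrite /conj_rep XE (eigenvalues_rep_conj om_symplectic hG hrho GB GC).
  move: hX; rewrite /hyperbolic; case: (ger0P (\tr X)) => _ tX.
    by exists X; split; [exact: GX | exact: tX | exact: off | exact: evX].
  exists (- X); split; [exact: G'N | | by rewrite !mxE mulrNN | by rewrite rhoN'].
  by rewrite tr2E !mxE -opprD -tr2E.
have [Z [GZ tZ Z01 Z10 evZ]] : exists Z, [/\ conjG M G Z, 2 < \tr Z, 0 < Z 0 1, 0 < Z 1 0
    & eigenvalues (conj_rep M rho Z) = eigenvalues (rho B)].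
  have [Y01|Y01] := ltP 0 (Y 0 1).
    exists Y; split; [exact: GY | exact: tY | exact: Y01 | | exact: ev].
    by move: oY; rewrite pmulr_rgt0.
  exists (invmx Y); rewrite (eigenvalues_repV om_symplectic hG' hrho' GY).
  split; [exact: G'V | | | | exact: ev].
  - by rewrite (invmx2 (G'det _ GY)) tr2E !mx2_entry addrC -tr2E.
  - rewrite (invmx2 (G'det _ GY)) mx2_entry oppr_gt0 lt_neqAle Y01 andbT.
    by apply: contraTneq oY => ->; rewrite mul0r ltxx.
  - by rewrite (invmx2 (G'det _ GY)) mx2_entry oppr_gt0 ltNge; apply: contraTN oY => y; rewrite -leNgt; exact: mulr_le0_ge0.
have [P GP [P01 P10 Pmin]] := minimal_crossing hG'
  (fun K => conj_bounded_finite K dM hG dG) k1 GD GZ tZ Z01 Z10.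
have Pu : P \in unitmx by rewrite unitmxE G'det ?unitr1.
have GW : conjG M G (P *m Z *m invmx P) by apply: (G'M _ _ (G'M _ _ GP GZ)); apply: G'V.
have tW : 2 < \tr (P *m Z *m invmx P) by rewrite mxtrace_mulC mulmxA (mulVmx Pu) mul1mx.
have := diag_collar n_gt0 dimV hG' hrho' fr' k1 GD GW tW P01 P10 Pmin.
rewrite /expanding_eigenvalues rD.
by rewrite (eigenvalues_rep_conj om_symplectic hG' hrho' GZ GP) evZ.
Qed.

End Framed.
End Assembly.

Theorem theorem1p8 (R : realType) (G : set 'M[R]_2) (hG : surface_group G)
    (F : rcfType) (n : nat) (n_gt0 : (0 < n)%N)
    (V : vectType F) (dimV : \dim {:V} = (2 * n)%N)
    (om : {skew_symmetric V}) (om_symplectic : is_psymplectic om)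
    (rho : 'M[R]_2 -> 'End(V)) (hrho : symplectic_representation om G rho)
    (hframing : admits_maximal_framing om G rho) :
  (forall A, G A -> hyperbolic A ->
     (forall z, z \in eigenvalues (rho A) -> Normc.normc z <> 1) /\
     size (expanding_eigenvalues (rho A)) = n)
  /\
  (forall A B, G A -> G B -> hyperbolic A -> hyperbolic B ->
     positive_intersection G A B ->
     let lamA i := Normc.normc (expanding_eigenvalues (rho A))`_i in
     let lamB i := Normc.normc (expanding_eigenvalues (rho B))`_i in
     lamA 0%N ^+ (2 * n) >= 1 / (lamB n.-1 ^+ 2 - 1) /\
     (\prod_(i < n) pos_root n (lamA i ^+ 2) - 1)
       * (\prod_(i < n) pos_root n (lamB i ^+ 2) - 1) >= 1).
Proof.
have [hG2 dG _ _] := hG; have [T [phi hphi]] := hframing.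
have fr := vframing_of hG2 hphi.
have dimV2 : \dim {:V} = (n + n)%N by rewrite dimV mul2n addnn.
split=> [A GA hA | A B GA GB hA hB hAB].
  exact: (framed_spectrum hG2 dimV2 om_symplectic hrho fr).
exact: (framed_collar hG2 n_gt0 dimV2 om_symplectic hrho fr).
Qed.
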